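(* Let $R$ be a ring and let $Q^{r,n}_{\mathbf{q},\sigma}(R):=R_{\mathbf{q},\sigma}[x_1^{\pm 1},\dots,x_r^{\pm 1},x_{r+1},\dots,x_n]$ be a ring of skew quantum polynomials over $R$. Then: (i) If $\mathrm{lgld}(R)<\infty$, then $\mathrm{lgld}(R)\le \mathrm{lgld}(Q^{r,n}_{\mathbf{q},\sigma}(R))\le \mathrm{lgld}(R)+n$. Moreover $\mathrm{lgld}(R_{\mathbf{q}}[x_1,\dots,x_n])=\mathrm{lgld}(R)+n$. If $R$ is semisimple, then $\mathrm{lgld}(R_{\mathbf{q}}[x_1,\dots,x_n])=n$ and $\mathrm{lgld}(R[x^{\pm1};\sigma])=1$. (ii) If $R$ is left Noetherian, then $\mathrm{lKdim}(R)\le \mathrm{lKdim}(Q^{r,n}_{\mathbf{q},\sigma}(R))\le \mathrm{lKdim}(R)+n$ and $\mathrm{lKdim}(R_{\mathbf{q}}[x_1,\dots,x_n])=\mathrm{lKdim}(R)+n$. If $R=\Bbbk$ is a field, then $\mathrm{lKdim}(\Bbbk_{\mathbf{q}}[x_1,\dots,x_n])=n$, $\mathrm{lKdim}(\Bbbk_{\mathbf{q}}[x_1^{\pm1},\dots,x_n^{\pm1}])\le n$ and $\mathrm{lKdim}(\Bbbk[x^{\pm1};\sigma])=1$. (iii) If $R$ is a left Noetherian domain, then $\mathrm{ludim}(Q^{r,n}_{\mathbf{q},\sigma}(R))=1$.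
   Context: Rings are associative with identity, not necessarily commutative. Let $R$ be a ring with a matrix $\mathbf{q}=[q_{ij}]\in M_n(R)$, $n\ge 2$, such that $q_{ii}=1=q_{ij}q_{ji}=q_{ji}q_{ij}$ for all $1\le i,j\le n$, and with automorphisms $\sigma_1,\dots,\sigma_n$ of $R$. For $0\le r\le n$, the ring of skew quantum polynomials over $R$, denoted $R_{\mathbf{q},\sigma}[x_1^{\pm1},\dots,x_r^{\pm1},x_{r+1},\dots,x_n]$, is the ring such that: it contains $R$; it is a free left $R$-module with basis $\{x_1^{\alpha_1}\cdots x_n^{\alpha_n}\mid \alpha_i\in\mathbb{Z}\text{ for }1\le i\le r,\ \alpha_i\in\mathbb{N}\text{ for }r+1\le i\le n\}$; and the variables satisfy $x_ix_i^{-1}=1=x_i^{-1}x_i$ for $1\le i\le r$, $x_jx_i=q_{ij}x_ix_j$ and $x_ia=\sigma_i(a)x_i$ for $a\in R$, $1\le i,j\le n$. (It is assumed that the data are such that this ring exists.) When all $\sigma_i$ are the identity, $\sigma$ is dropped from the notation: $R_{\mathbf{q}}[\dots]$ (ring of quantum polynomials over $R$); $R_{\mathbf q}[x_1,\dots,x_n]$ is the case $r=0$ and $R_{\mathbf q}[x_1^{\pm1},\dots,x_n^{\pm1}]$ the case $r=n$. $R[x^{\pm1};\sigma]$ denotes the skew Laurent polynomial ring ($xa=\sigma(a)x$, $\sigma$ an automorphism of $R$). $\mathrm{lgld}$ denotes the left global dimension, $\mathrm{lKdim}$ the left Krull dimension (in the sense of Gabriel--Rentschler), and $\mathrm{ludim}$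 the left Goldie (uniform) dimension of a ring. *)

(* Defs.v *)
From HB Require Import structures.
From mathcomp Require Import all_boot all_order all_algebra.
From mathcomp Require Import classical_sets.

Set Implicit Arguments.
Unset Strict Implicit.
Unset Printing Implicit Defensive.

Import GRing.Theory.
Local Open Scope classical_set_scope.
Local Open Scope ring_scope.

(* Since nzRingType excludes the zero ring, every ring below has global and
   Krull dimension at least 0. *)

Definition submodule (R : nzRingType) (M : lmodType R) (A : set M) : Prop :=
  A 0 /\ forall (a : R) (u v : M), A u -> A v -> A (a *: u + v).

Definition noetherian_module (R : nzRingType) (M : lmodType R) : Prop :=
  forall c : nat -> set M,
    (forall i, submodule (c i)) -> (forall i, c i `<=` c i.+1) ->
    exists N : nat, forall m : nat, (N <= m)%N -> c m = c N.

Definition semisimple_module (R : nzRingType) (M : lmodType R) : Prop :=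
  forall A : set M, submodule A ->
    exists B : set M, [/\ submodule B, A `&` B = [set 0]
      & forall u : M, exists a b : M, [/\ A a, B b & u = a + b]].

Definition left_noetherian (R : nzRingType) : Prop := @noetherian_module R R^o.

Definition semisimple_ring (R : nzRingType) : Prop := @semisimple_module R R^o.

Definition domain_ring (R : nzRingType) : Prop :=
  forall a b : R, a * b = 0 -> a = 0 \/ b = 0.

Definition projective (R : nzRingType) (P : lmodType R) : Prop :=
  forall (N N' : lmodType R) (g : {linear N -> N'}) (f : {linear P -> N'}),
    (forall y : N', exists x : N, g x = y) ->
    exists h : {linear P -> N}, forall x : P, g (h x) = f x.

(* There is an exact sequence 0 -> P_d -> ... -> P_0 -> M -> 0 with every P_i
   projective; it is indexed by nat and vanishes beyond d. *)
Definition has_proj_resolution (R : nzRingType) (M : lmodType R) (d : nat) : Prop :=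
  exists (P : nat -> lmodType R) (eps : {linear P 0%N -> M})
         (del : forall i : nat, {linear P i.+1 -> P i}),
    [/\ forall i, projective (P i),
        forall y : M, exists x : P 0%N, eps x = y,
        forall x : P 0%N, eps x = 0 <-> exists z : P 1%N, del 0%N z = x,
        forall (i : nat) (x : P i.+1),
          del i x = 0 <-> exists z : P i.+2, del i.+1 z = x
      & forall i : nat, (d < i)%N -> forall x : P i, x = 0].

(* Values in the natural numbers together with infinity, which is None. *)
Definition enat : Type := option nat.

Definition enat_le (v w : enat) : Prop :=
  match v, w with
  | _, None => True
  | None, Some _ => False
  | Some d, Some e => (d <= e)%N
  end.

Definition enat_addn (v : enat) (n : nat) : enat :=
  if v is Some d then Some (d + n)%N else None.

Definition is_pdim (R : nzRingType) (M : lmodType R) (v : enat) : Prop :=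
  match v with
  | Some d => has_proj_resolution M d
              /\ forall e : nat, has_proj_resolution M e -> (d <= e)%N
  | None => forall d : nat, ~ has_proj_resolution M d
  end.

Definition pdim_upper_bound (R : nzRingType) (v : enat) : Prop :=
  forall (M : lmodType R) (w : enat), is_pdim M w -> enat_le w v.

Definition is_lgld (R : nzRingType) (v : enat) : Prop :=
  pdim_upper_bound R v /\ forall w : enat, pdim_upper_bound R w -> enat_le v w.

(* Ordinals as well-founded trees: OSup f is the least ordinal strictly above
   every f i.  An ordinal is represented by many trees, and equality of ordinals
   is ole in both directions. *)
Inductive Ord : Type := OSup (X : Type) (f : X -> Ord).

Fixpoint ole (a b : Ord) {struct a} : Prop :=
  let: OSup X f := a in
  forall i : X, let: OSup Y g := b in exists j : Y, ole (f i) (g j).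

Definition ozero : Ord := OSup (fun e : False => match e with end).

Definition osucc (a : Ord) : Ord := OSup (fun _ : unit => a).

Definition oaddn (a : Ord) (n : nat) : Ord := iter n osucc a.

(* Gordon-Robson form of the Gabriel-Rentschler definition, for the subfactor
   hi / lo of M; its submodules are the submodules between lo and hi.  The
   Krull dimension of hi / lo is at most a when there is no infinite chain
   hi = c 0 >= c 1 >= ... above lo none of whose factors c i / c i.+1 has Krull
   dimension smaller than a.  Being smaller than a means being the zero module,
   whose Krull dimension is -1, or having dimension at most some b < a; for
   a = OSup f it is enough to let b range over the f j. *)
Fixpoint kdim_le (R : nzRingType) (M : lmodType R) (a : Ord) (lo hi : set M)
    {struct a} : Prop :=
  let: OSup X f := a in
  ~ exists c : nat -> set M,
      [/\ c 0%N = hi,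
          forall i : nat, submodule (c i),
          forall i : nat, lo `<=` c i.+1 /\ c i.+1 `<=` c i
        & forall i : nat, ~ (c i `<=` c i.+1 \/
            exists j : X, kdim_le (f j) (c i.+1) (c i))].

Definition kdim_lt (R : nzRingType) (M : lmodType R) (a : Ord) (lo hi : set M) :
    Prop :=
  hi `<=` lo \/ let: OSup X f := a in exists j : X, kdim_le (f j) lo hi.

Definition is_kdim (R : nzRingType) (M : lmodType R) (a : Ord) : Prop :=
  ~ @kdim_lt R M a [set 0] setT /\ @kdim_le R M a [set 0] setT.

Definition is_lKdim (R : nzRingType) (a : Ord) : Prop := @is_kdim R R^o a.

Definition nonzero_set (R : nzRingType) (M : lmodType R) (A : set M) : Prop :=
  exists u : M, A u /\ u <> 0.

Definition uniform_submodule (R : nzRingType) (M : lmodType R) (U : set M) : Prop :=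
  [/\ submodule U, nonzero_set U
    & forall A B : set M, submodule A -> submodule B -> A `<=` U -> B `<=` U ->
        nonzero_set A -> nonzero_set B -> nonzero_set (A `&` B)].

Definition essential_submodule (R : nzRingType) (M : lmodType R) (V : set M) :
    Prop :=
  submodule V /\
  forall A : set M, submodule A -> nonzero_set A -> nonzero_set (V `&` A).

Definition is_udim (R : nzRingType) (M : lmodType R) (n : nat) : Prop :=
  exists U : 'I_n -> set M,
    [/\ forall i, uniform_submodule (U i),
        forall u : 'I_n -> M, (forall i, U i (u i)) ->
          \sum_(i < n) u i = 0 -> forall i, u i = 0
      & essential_submodule
          [set v | exists u : 'I_n -> M,
                     (forall i, U i (u i)) /\ v = \sum_(i < n) u i]].

Definition is_ludim (R : nzRingType) (n : nat) : Prop := @is_udim R R^o n.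

(* The b i with i satisfying A form a basis of Q as a left R-module. *)
Definition left_basis (R Q : nzRingType) (iota : {rmorphism R -> Q})
    (I : eqType) (A : pred I) (b : I -> Q) : Prop :=
  (forall f : Q, exists (s : seq I) (c : I -> R),
      [/\ uniq s, all A s & f = \sum_(i <- s) iota (c i) * b i]) /\
  (forall (s : seq I) (c : I -> R), uniq s -> all A s ->
      \sum_(i <- s) iota (c i) * b i = 0 -> forall i, i \in s -> c i = 0).

(* Integer powers of x, where xi is its inverse if it has one. *)
Definition zpow (Q : nzRingType) (x xi : Q) (z : int) : Q :=
  match z with
  | Posz m => x ^+ m
  | Negz m => xi ^+ m.+1
  end.

(* The product is taken in increasing order of the indices.  The values of xi at
   indices i >= r are irrelevant. *)
Definition monomial (Q : nzRingType) (n : nat) (x xi : 'I_n -> Q)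
    (alpha : {ffun 'I_n -> int}) : Q :=
  \prod_(i < n) zpow (x i) (xi i) (alpha i).

Definition admissible (n r : nat) : pred {ffun 'I_n -> int} :=
  [pred alpha : {ffun 'I_n -> int} | [forall i : 'I_n, (r <= i)%N ==> (0 <= alpha i)]].

(* With 0-based indices, the invertible variables are the x i with i < r. *)
Record skew_quantum_polynomials (R : nzRingType) (n r : nat) (q : 'M[R]_n)
    (sigma : 'I_n -> {rmorphism R -> R}) (Q : nzRingType)
    (iota : {rmorphism R -> Q}) (x xi : 'I_n -> Q) : Prop := {
  sqp_q_diag : forall i, q i i = 1;
  sqp_q_inv : forall i j, q i j * q j i = 1 /\ q j i * q i j = 1;
  sqp_auto : forall i, bijective (sigma i);
  sqp_incl : injective iota;
  sqp_basis : left_basis iota (@admissible n r) (monomial x xi);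
  sqp_xinv : forall i : 'I_n, (i < r)%N -> x i * xi i = 1 /\ xi i * x i = 1;
  sqp_xx : forall i j, x j * x i = iota (q i j) * x i * x j;
  sqp_xa : forall i (a : R), x i * iota a = iota (sigma i a) * x i
}.

Definition is_skew_quantum_ring (R : nzRingType) (n r : nat) (q : 'M[R]_n)
    (sigma : 'I_n -> {rmorphism R -> R}) (Q : nzRingType) : Prop :=
  exists (iota : {rmorphism R -> Q}) (x xi : 'I_n -> Q),
    skew_quantum_polynomials r q sigma iota x xi.

Definition is_quantum_ring (R : nzRingType) (n r : nat) (q : 'M[R]_n)
    (Q : nzRingType) : Prop :=
  is_skew_quantum_ring r q (fun=> idfun : {rmorphism R -> R}) Q.

Record skew_laurent_polynomials (R : nzRingType) (tau : {rmorphism R -> R})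
    (S : nzRingType) (iota : {rmorphism R -> S}) (x xi : S) : Prop := {
  slp_auto : bijective tau;
  slp_incl : injective iota;
  slp_basis : left_basis iota predT (zpow x xi);
  slp_xinv : x * xi = 1 /\ xi * x = 1;
  slp_xa : forall a : R, x * iota a = iota (tau a) * x
}.

Definition is_skew_laurent_ring (R : nzRingType) (tau : {rmorphism R -> R})
    (S : nzRingType) : Prop :=
  exists (iota : {rmorphism R -> S}) (x xi : S),
    skew_laurent_polynomials tau iota x xi.

(* Main.v *)
(* A ring of skew quantum polynomials is reached from R by n successive extensions
   R[x; tau] or R[x^{+-1}; tau], tau bijective, so each claim is proved for one such
   extension S of R.

   Global dimension.  If an S-module K is R-projective and L is the kernel of the
   cover of K by a free S-module F, then L is S-projective: an R-linear lift of a map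
   on L fails to commute with x by a defect that can be solved for on the left
   R-basis x^z e_i of F.  Hence lgld S <= lgld R + 1.  Conversely an R-module M is an
   R-summand of the coinduced module Hom_R(S, M), so lgld R <= lgld S.  For
   S = R[x; tau], let x act on M by 0; if this S-module has projective dimension at
   most d + 1 then M has projective dimension at most d, which gives equality.

   Krull dimension.  Sending a left ideal I of S to its ascending sequence of left
   ideals of leading coefficients is strictly monotone, and for R left Noetherian
   such sequences form a poset of deviation at most lKdim R + 1; the same map gives
   Hilbert's basis theorem.  Extension of left ideals bounds lKdim S from below, and
   in R[x; tau] every factor of the chain of left ideals S x^i contains a copy of
   the lattice of left ideals of R, which accounts for the extra 1.

   Goldie dimension.  Domains and left Noetherian rings are preserved, and a left
   Noetherian domain is uniform. *)
Require Import Defs.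
From HB Require Import structures.
From mathcomp Require Import all_boot all_order all_algebra.
From mathcomp Require Import boolp classical_sets functions zify.

Set Implicit Arguments.
Unset Strict Implicit.
Unset Printing Implicit Defensive.

Import Order.TTheory GRing.Theory Num.Theory.
Local Open Scope classical_set_scope.
Local Open Scope ring_scope.

(** * Modules and projective dimension *)

(** Two obstacles shape the reduction to one variable. The q_ij are units of R that need be neither
    central nor fixed by the sigma_i, so the reordering of monomials is followed only up to a unit
    of R on the left. And conjugation by x_n makes no sense when x_n is not invertible: the
    automorphism tau of the subring V spanned by the monomials in the other variables is obtained
    from x_n V = V x_n together with cancellation of x_n on both sides.

    Coefficients are needed on both sides of x^z: left ones for the R-basis, right ones, which
    differ by tau^z, for the ideals of leading coefficients, because left multiplication by x shifts
    the right ones without changing them.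

    In the Laurent case x is a unit and cannot be set to 0, so the values 1 over semisimple rings
    and fields need another source. It is the R-linear functional adding up all coefficients. It
    kills S(1 - x), which makes the powers of 1 - x generate a strictly descending chain over a
    field; and as an element of Hom_R(S, R) it is fixed by x, whereas a free S-module has no nonzero
    vector fixed by x. *)

Definition mklin (R : nzRingType) (U V : lmodType R) (f : U -> V)
    (hf : linear f) : {linear U -> V} :=
  HB.pack f (GRing.isLinear.Build R U V *:%R f hf).

Section Submodules.
Variables (R : nzRingType) (M : lmodType R).
Implicit Type A : set M.

Definition subm_pred A (hA : submodule A) : pred M := fun x => `[< A x >].

Lemma subm_predP A (hA : submodule A) : subsemimod_closed (subm_pred hA).
Proof.
case: (hA) => A0 AL; split; first split.
- exact/asboolP.
- move=> u v /asboolP Au /asboolP Av; apply/asboolP.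
  by rewrite -[u]scale1r; apply: AL.
- move=> a u /asboolP Au; apply/asboolP.
  by rewrite -[_ *: _]addr0; apply: AL.
Qed.

Record subm A (hA : submodule A) : Type :=
  SubM { subm_val : M; subm_valP : subm_pred hA subm_val }.

HB.instance Definition _ A (hA : submodule A) :=
  [isSub for @subm_val A hA].
HB.instance Definition _ A (hA : submodule A) :=
  [Choice of subm hA by <:].
HB.instance Definition _ A (hA : submodule A) :=
  GRing.SubChoice_isSubLmodule.Build R M (subm_pred hA) (subm hA)
    (subm_predP hA).

Lemma submP A (hA : submodule A) (x : subm hA) : A (val x).
Proof. by have /asboolP := valP x. Qed.

Definition mksub A (hA : submodule A) (x : M) (Ax : A x) : subm hA :=
  @Sub M (subm_pred hA) (subm hA) x (asboolT Ax).

Definition inclm A (hA : submodule A) : {linear subm hA -> M} := val.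

Lemma inclm_inj A (hA : submodule A) : injective (inclm hA).
Proof. by move=> x y; exact: (@val_inj M (subm_pred hA) (subm hA) x y). Qed.

Lemma submoduleD A u v : submodule A -> A u -> A v -> A (u + v).
Proof. by case=> _ AL Au Av; rewrite -[u]scale1r; apply: AL. Qed.

Lemma submoduleZ A a u : submodule A -> A u -> A (a *: u).
Proof. by case=> A0 AL Au; rewrite -[_ *: _]addr0; apply: AL. Qed.

Lemma submoduleB A u v : submodule A -> A u -> A v -> A (u - v).
Proof.
by move=> hA Au Av; apply: submoduleD => //; rewrite -scaleN1r; apply: submoduleZ.
Qed.

End Submodules.

Lemma submodule_ker (R : nzRingType) (M N : lmodType R) (g : {linear M -> N}) :
  submodule [set x | g x = 0].
Proof.
split=> [|a u v /= gu gv]; first exact: raddf0.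
by rewrite /= linearP gu gv scaler0 addr0.
Qed.

Definition kerm (R : nzRingType) (M N : lmodType R) (g : {linear M -> N}) :
  lmodType R := subm (submodule_ker g).

HB.lock Definition kerm_incl (R : nzRingType) (M N : lmodType R)
  (g : {linear M -> N}) : {linear kerm g -> M} := inclm (submodule_ker g).

Lemma kerm_inclE (R : nzRingType) (M N : lmodType R) (g : {linear M -> N})
  (x : kerm g) : kerm_incl g x = val x.
Proof. by rewrite kerm_incl.unlock. Qed.

Lemma mem_kerm (R : nzRingType) (M N : lmodType R) (g : {linear M -> N})
  (x : kerm g) : g (kerm_incl g x) = 0.
Proof. by rewrite kerm_inclE; exact: (submP x). Qed.

Lemma kerm_incl_inj (R : nzRingType) (M N : lmodType R) (g : {linear M -> N}) :
  injective (kerm_incl g).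
Proof. by rewrite kerm_incl.unlock; exact: inclm_inj. Qed.

Section Exact.
Variable R : nzRingType.

Definition short_exact (K P M : lmodType R) (i : {linear K -> P})
    (p : {linear P -> M}) : Prop :=
  [/\ injective i, forall y, exists x, p x = y
    & forall x, p x = 0 <-> exists k, i k = x].

Lemma short_exact_ker (P M : lmodType R) (p : {linear P -> M}) :
  (forall y, exists x, p x = y) -> short_exact (kerm_incl p) p.
Proof.
move=> ps; split=> //; first exact: kerm_incl_inj.
move=> x; split=> [px|[k <-]]; last exact: mem_kerm.
by exists (mksub (submodule_ker p) (px : [set x | p x = 0] x)); rewrite kerm_inclE.
Qed.

Lemma short_exact_lift (K P M U : lmodType R) (i : {linear K -> P})
    (p : {linear P -> M}) (f : {linear U -> P}) :
  short_exact i p -> (forall u, p (f u) = 0) ->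
  exists g : {linear U -> K}, forall u, i (g u) = f u.
Proof.
move=> [ii _ ex] pf.
have /choice[g hg] : forall u, exists k, i k = f u by move=> u; apply/ex.
have lg : linear g by move=> a u v; apply: ii; rewrite linearP !hg linearP.
by exists (mklin lg).
Qed.

Lemma projective_summand (P Q : lmodType R) (s : {linear Q -> P})
    (t : {linear P -> Q}) :
  (forall x, t (s x) = x) -> projective P -> projective Q.
Proof.
move=> st hP N N' g f gs.
have [h hh] := hP N N' g (f \o t : {linear P -> N'}) gs.
by exists (h \o s : {linear Q -> N}) => x /=; rewrite hh /= st.
Qed.

Lemma projective_prod (P Q : lmodType R) :
  projective P -> projective Q -> projective (P * Q)%type.
Proof.
move=> hP hQ N N' g f gs.
have l1 : linear (fun x : P => f (x, 0)).
  by move=> a u v; rewrite -linearP; congr (f _); congr pair; rewrite /= scaler0 addr0.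
have l2 : linear (fun x : Q => f (0, x)).
  by move=> a u v; rewrite -linearP; congr (f _); congr pair; rewrite /= scaler0 addr0.
have [h1 e1] := hP N N' g (mklin l1) gs.
have [h2 e2] := hQ N N' g (mklin l2) gs.
have l : linear (fun x : P * Q => h1 x.1 + h2 x.2).
  by move=> a u v; rewrite /= !linearP scalerDr addrACA.
exists (mklin l) => -[x y] /=; rewrite linearD e1 e2 /= -linearD.
by congr (f _); congr pair; rewrite /= ?addr0 ?add0r.
Qed.

Lemma projective_zero (P : lmodType R) : (forall x : P, x = 0) -> projective P.
Proof.
move=> P0 N N' g f gs.
have l : linear (fun _ : P => 0 : N) by move=> a u v; rewrite scaler0 addr0.
by exists (mklin l) => x; rewrite (P0 x) !linear0.
Qed.

End Exact.

(** * Free modules on arbitrary types *)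

Section Free.
Variable R : nzRingType.

Section Def.
Variable X : Type.

(** [X] is an arbitrary type, so the support is a list over [{classic X}], whose equality is
    decidable classically. *)
Definition finsupp_fun : set (X -> R^o) :=
  [set f | exists s : seq {classic X}, forall x : {classic X}, x \notin s -> f x = 0].

Lemma finsupp_funP : submodule finsupp_fun.
Proof.
split; first by exists [::].
move=> a u v [s us] [t vt]; exists (s ++ t) => x.
rewrite mem_cat negb_or => /andP[/us ux /vt vx].
by rewrite addrfctE scalrfctE ux vx scaler0 addr0.
Qed.

Definition free_mod : lmodType R := subm finsupp_funP.
End Def.

Section Theory.
Variable X : Type.
Let F := free_mod X.

Definition fcoef (l : F) (x : X) : R := val l x.

Lemma fcoef_inj (l l' : F) : fcoef l =1 fcoef l' -> l = l'.
Proof. by move=> e; apply: val_inj; apply/funext. Qed.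

Lemma fcoefD l l' x : fcoef (l + l') x = fcoef l x + fcoef l' x.
Proof. by rewrite /fcoef raddfD. Qed.
Lemma fcoefB l l' x : fcoef (l - l') x = fcoef l x - fcoef l' x.
Proof. by rewrite /fcoef raddfB. Qed.
Lemma fcoef0 x : fcoef 0 x = 0.
Proof. by rewrite /fcoef raddf0. Qed.
Lemma fcoefZ a l x : fcoef (a *: l) x = a * fcoef l x.
Proof. by []. Qed.

Lemma delta_subproof (x : {classic X}) :
  @finsupp_fun X (fun y : {classic X} => (y == x)%:R).
Proof.
by exists [:: x] => y; rewrite inE => /negPf ->.
Qed.

Definition delta (x : X) : F := mksub (@finsupp_funP X) (delta_subproof x).

Lemma fcoef_delta (x y : {classic X}) : fcoef (delta x) y = (y == x)%:R.
Proof. by []. Qed.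

Lemma fsupp_exists (l : F) : exists s : seq {classic X},
  uniq s /\ forall x : {classic X}, x \notin s -> fcoef l x = 0.
Proof.
have [s hs] := submP l; exists (undup s); split; first exact: undup_uniq.
by move=> x; rewrite mem_undup; apply: hs.
Qed.

Definition fsupp l := sval (cid (fsupp_exists l)).

Lemma fsupp_uniq l : uniq (fsupp l).
Proof. by rewrite /fsupp; case: cid => s []. Qed.

Lemma fsuppP l (x : {classic X}) : x \notin fsupp l -> fcoef l x = 0.
Proof. by rewrite /fsupp; case: cid => s /= [_]; apply. Qed.

Section Sum.
Variables (N : zmodType) (psi : X -> {additive R -> N}).

(** The maps [psi x] are only additive, so that a free module over one ring can be mapped to a
    module over another; [restr_lift] and the linear-term map [p1] in [projective_of_pdle1] are of
    this kind. *)
Definition fsum (l : F) : N := \sum_(x <- fsupp l) psi x (fcoef l x).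

Lemma fsumE l (s : seq {classic X}) : uniq s ->
  (forall x : {classic X}, x \notin s -> fcoef l x = 0) ->
  fsum l = \sum_(x <- s) psi x (fcoef l x).
Proof.
move=> us hs; rewrite /fsum.
have key (t : seq {classic X}) : uniq t ->
    (forall x : {classic X}, x \notin t -> fcoef l x = 0) ->
    \sum_(x <- t) psi x (fcoef l x) =
    \sum_(x <- undup (s ++ fsupp l) | x \in t) psi x (fcoef l x).
  move=> ut ht; rewrite -[RHS]big_filter.
  have <- : \sum_(x <- [seq x <- t | x \in undup (s ++ fsupp l)]) psi x (fcoef l x) =
            \sum_(x <- t) psi x (fcoef l x).
    rewrite big_filter [RHS](bigID (fun x => x \in undup (s ++ fsupp l))) /=.
    rewrite [X in _ + X]big1 ?addr0 // => x.
    rewrite mem_undup mem_cat negb_or => /andP[_ /fsuppP ->].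
    exact: raddf0.
  apply: perm_big; apply: uniq_perm; rewrite ?filter_uniq ?undup_uniq //.
  by move=> x; rewrite !mem_filter andbC.
rewrite (key _ us hs) (key _ (fsupp_uniq l) (@fsuppP l)).
rewrite [LHS]big_rmcond_in => [|x _ /fsuppP ->]; last exact: raddf0.
by rewrite [RHS]big_rmcond_in // => x _ /hs ->; rewrite raddf0.
Qed.

Lemma fsum_is_zmod : zmod_morphism fsum.
Proof.
move=> l l'; pose s := undup (fsupp l ++ fsupp l').
have us : uniq s by exact: undup_uniq.
have h1 (x : {classic X}) : x \notin s -> fcoef l x = 0.
  by rewrite mem_undup mem_cat negb_or => /andP[/fsuppP].
have h2 (x : {classic X}) : x \notin s -> fcoef l' x = 0.
  by rewrite mem_undup mem_cat negb_or => /andP[_ /fsuppP].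
rewrite (@fsumE l s) // (@fsumE l' s) // (@fsumE _ s) //; last first.
  by move=> x xs; rewrite fcoefB h1 // h2 // subr0.
by rewrite -sumrB; apply: eq_bigr => x _; rewrite fcoefB raddfB.
Qed.
HB.instance Definition _ := GRing.isZmodMorphism.Build F N fsum fsum_is_zmod.

Lemma fsumZdelta a x : fsum (a *: delta x) = psi x a.
Proof.
rewrite (@fsumE _ [:: x : {classic X}]) //.
  by rewrite big_seq1 fcoefZ fcoef_delta eqxx mulr1.
by move=> y; rewrite inE fcoefZ fcoef_delta => /negPf ->; rewrite mulr0.
Qed.

End Sum.

Lemma fexpand (l : F) : l = \sum_(x <- fsupp l) fcoef l x *: delta x.
Proof.
apply: fcoef_inj => y.
rewrite (big_morph (fcoef ^~ y) (fun l l' => fcoefD l l' y) (fcoef0 y)).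
case: (boolP ((y : {classic X}) \in fsupp l)) => ys.
  rewrite (bigD1_seq (y : {classic X})) ?fsupp_uniq //= fcoefZ fcoef_delta eqxx mulr1.
  rewrite big1 ?addr0 // => x xy.
  by rewrite fcoefZ fcoef_delta eq_sym (negPf xy) mulr0.
rewrite fsuppP // big1_seq // => x /andP[_ xs].
rewrite fcoefZ fcoef_delta (_ : _ == _ = false) ?mulr0 //.
by apply: contraNF ys => /eqP ->.
Qed.

Lemma free_ind (P : F -> Prop) : P 0 -> (forall l l', P l -> P l' -> P (l + l')) ->
  (forall a x, P (a *: delta x)) -> forall l, P l.
Proof. by move=> P0 PD Pd l; rewrite (fexpand l); apply: (big_ind P). Qed.

Definition free_lift_psi (N : lmodType R) (phi : X -> N) (x : X) :
    {additive R -> N} :=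
  HB.pack (fun a : R => a *: phi x)
    (GRing.isZmodMorphism.Build R N (fun a : R => a *: phi x)
       (fun a b => scalerBl a b (phi x))).

Lemma free_lift_linear (N : lmodType R) (phi : X -> N) :
  linear (fsum (free_lift_psi phi)).
Proof.
move=> a l l'; rewrite raddfD; congr (_ + _).
elim/free_ind: l => [|l1 l2 h1 h2|b x].
- by rewrite scaler0 !raddf0.
- by rewrite scalerDr !raddfD /= h1 h2.
- by rewrite scalerA [LHS]fsumZdelta [X in _ *: X]fsumZdelta /= scalerA.
Qed.

Definition free_lift (N : lmodType R) (phi : X -> N) : {linear F -> N} :=
  mklin (free_lift_linear phi).

Lemma free_lift_delta (N : lmodType R) (phi : X -> N) x :
  free_lift phi (delta x) = phi x.
Proof. by rewrite -[delta x]scale1r [LHS]fsumZdelta /= scale1r. Qed.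

Lemma free_linear_ext (N : lmodType R) (g h : {linear F -> N}) :
  (forall x, g (delta x) = h (delta x)) -> g =1 h.
Proof.
move=> e; apply: free_ind => [|l l' h1 h2|a x].
- by rewrite !raddf0.
- by rewrite !linearD h1 h2.
- by rewrite !linearZZ e.
Qed.

Lemma free_projective : projective F.
Proof.
move=> N N' g f gs.
have /choice[phi hphi] : forall x, exists y, g y = f (delta x) by move=> x; apply: gs.
exists (free_lift phi).
apply: (free_linear_ext (g := g \o free_lift phi)) => x.
by rewrite -hphi -(free_lift_delta phi).
Qed.

End Theory.

End Free.

HB.lock Definition cover (R : nzRingType) (M : lmodType R) :
  {linear free_mod R M -> M} := free_lift id.

Lemma coverE (R : nzRingType) (M : lmodType R) (m : M) : cover M (delta R m) = m.
Proof. by rewrite cover.unlock free_lift_delta. Qed.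

Lemma cover_surj (R : nzRingType) (M : lmodType R) y : exists x, cover M x = y.
Proof. by exists (delta R y); rewrite coverE. Qed.

(** * Projective dimension through syzygies *)

Section ProjectiveDimension.
Variable R : nzRingType.
Implicit Types M N P K : lmodType R.

(** Recursive form of [has_proj_resolution], made for inductions that peel off one syzygy at a time;
    [resolutionP] is the equivalence. *)
Fixpoint pdle (d : nat) M : Prop :=
  if d is d'.+1 then
    exists (K P : lmodType R) (i : {linear K -> P}) (p : {linear P -> M}),
      [/\ short_exact i p, projective P & pdle d' K]
  else projective M.

Lemma short_exact_id0 M : exists i : {linear 'rV[R]_0 -> M},
  short_exact i (idfun : {linear M -> M}).
Proof.
have l : linear (fun _ : 'rV[R]_0 => 0 : M) by move=> a u v; rewrite scaler0 addr0.
exists (mklin l); split=> [x y _|y|x]; first by rewrite [x]thinmx0 [y]thinmx0.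
- by exists y.
- by split=> [/= xe|[k /= <-]] //; exists 0; rewrite /= xe.
Qed.

Lemma rV0_projective : projective ('rV[R]_0 : lmodType R).
Proof. by apply: projective_zero => x; rewrite [x]thinmx0. Qed.

Lemma pdleS d M : pdle d M -> pdle d.+1 M.
Proof.
elim: d M => [|d IH] M.
  move=> hM; have [i si] := short_exact_id0 M.
  exists _, M, i, idfun; split=> //; exact: rV0_projective.
move=> [K [P [i [p [se hP hK]]]]]; exists K, P, i, p; split=> //; exact: IH.
Qed.

Lemma pdle_leq d e M : (d <= e)%N -> pdle d M -> pdle e M.
Proof.
move=> /subnKC <-; elim: (e - d)%N => [|k IH] hM; first by rewrite addn0.
by rewrite addnS; apply: pdleS; apply: IH.
Qed.

Lemma pdle_prod_proj d K P : pdle d K -> projective P -> pdle d (K * P)%type.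
Proof.
case: d => [|d] hK hP; first exact: projective_prod.
have [K' [P' [i [p [[ii ps ex] hP' hK']]]]] := hK.
have li : linear (fun x : K' => (i x, 0 : P)).
  by move=> a u v /=; congr pair; rewrite ?linearP //= scaler0 addr0.
have lp : linear (fun x : P' * P => (p x.1, x.2)).
  by move=> a u v /=; rewrite linearP.
exists K', (P' * P)%type, (mklin li), (mklin lp).
split=> //; last exact: projective_prod.
split.
- by move=> a b /= [/ii].
- by move=> [y y']; have [x <-] := ps y; exists (x, y').
- move=> [x n] /=; split=> [[/ex[k <-] ->]|[k [<- <-]]]; first by exists k.
  by congr pair; apply/ex; exists k.
Qed.

(* The kernels of two projective covers of M, each enlarged by the other cover,
   are both isomorphic to the pullback of the covers. *)
Lemma schanuel_retract K P K' P' M (i : {linear K -> P}) (p : {linear P -> M})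
    (i' : {linear K' -> P'}) (p' : {linear P' -> M}) :
  short_exact i p -> short_exact i' p' -> projective P -> projective P' ->
  exists (s : {linear K' -> (K * P')%type}) (t : {linear (K * P')%type -> K'}),
    cancel s t.
Proof.
move=> se se' hP hP'; have [ii ps ex] := se; have [ii' ps' ex'] := se'.
have [u hu] := hP' _ _ p p' ps.
have [v hv] := hP _ _ p' p ps'.
have pi k : p (i k) = 0 by apply/ex; exists k.
have pi' k : p' (i' k) = 0 by apply/ex'; exists k.
have l1 : linear (fun k' : K' => - u (i' k')).
  by move=> a x y; rewrite !linearP.
have [w hw] := short_exact_lift (f := mklin l1) se
  (fun k => etrans (linearN _ _) (etrans (congr1 -%R (etrans (hu _) (pi' k))) (oppr0 _))).
(* On the image of [k' |-> (w k', i' k')] the argument of [v] vanishes, since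
   [i (w k') = - u (i' k')]; what remains is [i' k']. *)
have l2 : linear (fun z : K * P' => z.2 - v (i z.1 + u z.2)).
  move=> a x y /=; rewrite !(linearP, linearD) /= !scalerDr.
  by rewrite -!addrA; congr (_ + _); rewrite [LHS]addrCA; congr (_ + _);
    rewrite [RHS]addrCA; congr (_ + _); rewrite [LHS]addrCA.
have [|t ht] := short_exact_lift (f := mklin l2) se'.
  by move=> [k y] /=; rewrite linearB hv linearD pi hu add0r subrr.
have l3 : linear (fun k' : K' => (w k', i' k')).
  by move=> a x y; rewrite !linearP.
exists (mklin l3), t => k' /=; apply: ii'.
by rewrite ht /= hw /= addNr linear0 subr0.
Qed.

(** Cover [M] compatibly with its splitting into [N] and [C = ker t], by [E], the product of free
    covers of the two summands. The kernel of the cover of [N] is then a retract of the kernel of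
    the cover of [M], which by Schanuel is a retract of [K * E]; the induction hypothesis is applied
    twice. *)
Lemma pdle_retract d M N (s : {linear N -> M}) (t : {linear M -> N}) :
  cancel s t -> pdle d M -> pdle d N.
Proof.
elim: d M N s t => [|d IH] M N s t st; first exact: projective_summand.
move=> [K [P [i [p [se hP hK]]]]].
pose C := kerm t; pose E := (free_mod R N * free_mod R C)%type.
have lq : linear (fun x : E => s (cover N x.1) + kerm_incl t (cover C x.2)).
  by move=> a x y /=; rewrite !linearP /= !scalerDr addrACA.
have hE : projective E by apply: projective_prod; apply: free_projective.
have qs y : exists x, mklin lq x = y.
  have cy : t (y - s (t y)) = 0 by rewrite linearB st subrr.
  exists (delta R (t y), delta R (mksub (submodule_ker t) (cy : [set x | t x = 0] _))).
  by rewrite /= !coverE kerm_inclE /= addrC subrK.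
have seE := short_exact_ker qs.
have [s' [t' st']] := schanuel_retract se seE hP hE.
have hL := IH _ _ _ _ st' (pdle_prod_proj hK hE).
have seN := short_exact_ker (@cover_surj R N).
exists (kerm (cover N)), (free_mod R N), (kerm_incl (cover N)), (cover N).
split=> //; first exact: free_projective.
have la : linear (fun l : kerm (cover N) => (kerm_incl (cover N) l, 0 : free_mod R C)).
  by move=> a x y; congr pair; rewrite ?linearP //= scaler0 addr0.
have [|a ha] := short_exact_lift (f := mklin la) seE.
  by move=> l /=; rewrite mem_kerm !linear0 addr0.
have lb : linear (fun z : kerm (mklin lq) => (kerm_incl (mklin lq) z).1).
  by move=> c x y; rewrite linearP.
have [|b hb] := short_exact_lift (f := mklin lb) seN.
  move=> z /=; have /= /(congr1 t) := mem_kerm z.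
  by rewrite linearD st linear0 mem_kerm addr0.
apply: (IH _ _ a b) hL => l; have [iN _ _] := seN; apply: iN.
by rewrite hb /= ha.
Qed.

(** Schanuel makes the choice of presentation harmless: [K] is a retract of the product of the given
    syzygy with [P]. *)
Lemma pdle_syzygy d K P M (i : {linear K -> P}) (p : {linear P -> M}) :
  short_exact i p -> projective P -> pdle d.+1 M -> pdle d K.
Proof.
move=> se hP [K' [P' [i' [p' [se' hP' hK']]]]].
have [s [t st]] := schanuel_retract se' se hP' hP.
exact: pdle_retract st (pdle_prod_proj hK' hP).
Qed.

(** For a presentation [Q -> L] with kernel [K], the kernel of [Q -> L -> C] is an extension of [P]
    by [K]; it splits because [P] is projective, so it is a retract of [K * P]. The bound starts at
    1 since a quotient of two projective modules need not be projective. *)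
Lemma pdle_quot_proj d (P L C : lmodType R) (i : {linear P -> L}) (p : {linear L -> C}) :
  short_exact i p -> projective P -> pdle d.+1 L -> pdle d.+1 C.
Proof.
move=> [ii ps ex] hP [K [Q [j [q [[ij qs exq] hQ hK]]]]].
have lr : linear (fun x => p (q x)) by move=> a x y; rewrite !linearP.
have rs y : exists x, mklin lr x = y.
  by have [z <-] := ps y; have [x <-] := qs z; exists x.
have se := short_exact_ker rs.
exists (kerm (mklin lr)), Q, (kerm_incl (mklin lr)), (mklin lr); split=> //.
have [w hw] : exists w : {linear P -> Q}, forall x, q (w x) = i x.
  exact: hP.
have sei : short_exact i p by [].
have seq : short_exact j q by [].
have lz : linear (fun z : kerm (mklin lr) => q (kerm_incl (mklin lr) z)).
  by move=> a x y; rewrite !linearP.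
have [z hz] := short_exact_lift (f := mklin lz) sei (fun x => mem_kerm x).
have lk : linear (fun x : kerm (mklin lr) => kerm_incl (mklin lr) x - w (z x)).
  by move=> a x y; rewrite !linearP scalerDr addrACA.
have [|k hk] := short_exact_lift (f := mklin lk) seq.
  by move=> x /=; rewrite linearB hw hz /= subrr.
have ls : linear (fun x : kerm (mklin lr) => (k x, z x)).
  by move=> a x y; rewrite !linearP.
have pi x : p (i x) = 0 by apply/ex; exists x.
have lt : linear (fun x : K * P => j x.1 + w x.2).
  by move=> a x y /=; rewrite !linearP scalerDr addrACA.
have [|t ht] := short_exact_lift (f := mklin lt) se.
  move=> x /=; rewrite linearD hw (_ : q (j _) = 0) ?add0r ?pi //.
  by apply/exq; eexists.
apply: (pdle_retract (s := mklin ls) (t := t)) (pdle_prod_proj hK hP) => x.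
have [ir _ _] := se; apply: ir.
by rewrite ht /= hk /= subrK.
Qed.

End ProjectiveDimension.

(** * Resolutions, projective dimension and global dimension in terms of syzygies *)

Section Resolutions.
Variable R : nzRingType.
Implicit Types M N P K : lmodType R.

Lemma pdle_resolution d M : has_proj_resolution M d -> pdle d M.
Proof.
elim: d M => [|d IH] M [P [eps [del [hP es ex0 ex hz]]]].
  have eb : bijective eps.
    have ei : injective eps.
      move=> x y e; apply/eqP; rewrite -subr_eq0; apply/eqP.
      have /ex0[z <-] : eps (x - y) = 0 by rewrite linearB e subrr.
      by rewrite (hz 1%N _ z) // linear0.
    have /choice[t ts] := es.
    by exists t => // x; apply: ei; rewrite ts.
  have [t st ts] := eb; have lt : linear t.
    by move=> a x y; apply: (can_inj st); rewrite linearP !ts.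
  exact: (projective_summand (s := mklin lt) (t := eps)).
have se := short_exact_ker es.
exists (kerm eps), (P 0%N), (kerm_incl eps), eps; split=> //; apply: IH.
have [|eps' he] := short_exact_lift (f := del 0%N) se.
  by move=> u; apply/ex0; exists u.
have [ik _ _] := se.
exists (fun i => P i.+1), eps', (fun i => del i.+1); split=> //.
- move=> y; have /ex0[x hx] := mem_kerm y.
  by exists x; apply: ik; rewrite he.
- move=> x; rewrite -ex -he; split=> [->|]; first by rewrite linear0.
  by move=> e; apply: ik; rewrite e linear0.
- by move=> i hi x; apply: hz.
Qed.

Definition zero_lin M N : {linear M -> N} :=
  mklin (f := fun _ : M => 0 : N)
    (fun (a : R) u v => esym (etrans (addr0 _) (scaler0 _ a))).

Lemma resolution_pdle d M : pdle d M -> has_proj_resolution M d.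
Proof.
elim: d M => [|d IH] M.
  move=> hM; pose Z := 'rV[R]_0 : lmodType R.
  pose P i := if i is 0%N then M else Z.
  exists P, (idfun : {linear M -> M}).
  exists (fun i => match i return {linear P i.+1 -> P i} with
     0%N => zero_lin Z M | i'.+1 => zero_lin Z Z end).
  split.
  - by case=> [|i] //; exact: rV0_projective.
  - by move=> y; exists y.
  - by move=> x /=; split=> [xe|[z /= <-]] //; exists 0; rewrite /= xe.
  - case=> [|i] x /=; split=> // _; exists 0; by rewrite [x]thinmx0.
  - by case=> [|i] // _ x; rewrite [x]thinmx0.
move=> [K [P [i [p [[ii ps ex] hP /IH]]]]].
move=> [P' [eps [del [hP' es ex0 exd hz]]]].
pose PP j := if j is j'.+1 then P' j' else P.
exists PP, p.
exists (fun j => match j return {linear PP j.+1 -> PP j} with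
     0%N => i \o eps : {linear P' 0%N -> P} | j'.+1 => del j' end).
split.
- by case.
- exact: ps.
- move=> x; rewrite ex; split=> [[k <-]|[z <-]]; last by exists (eps z).
  by have [z <-] := es k; exists z.
- case=> [|j] x /=; last exact: exd.
  rewrite -ex0; split=> [e|->]; last exact: linear0.
  by apply: ii; rewrite e linear0.
- by case=> [|j] // hj x; apply: hz.
Qed.

Lemma resolutionP d M : has_proj_resolution M d <-> pdle d M.
Proof. by split; [exact: pdle_resolution | exact: resolution_pdle]. Qed.

Lemma least_nat (P : nat -> Prop) : (exists n, P n) ->
  exists n, P n /\ forall m, P m -> (n <= m)%N.
Proof.
move=> [n0 Pn0]; have ex : exists n, `[< P n >] by exists n0; apply/asboolP.
case: (ex_minnP ex) => n /asboolP Pn hn.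
by exists n; split=> // m /asboolP; apply: hn.
Qed.

Lemma pdim_exists M : exists v, is_pdim M v.
Proof.
have [/least_nat[d hd]|h] := pselect (exists d, has_proj_resolution M d).
  by exists (Some d).
by exists None => d hd; apply: h; exists d.
Qed.

Lemma pdim_upper_boundP d : pdim_upper_bound R (Some d) <-> forall M, pdle d M.
Proof.
split=> [h M|h M [e [_ he]|he]] /=.
- have [w hw] := pdim_exists M; have := h _ _ hw; case: w hw => [e [he _]|//] /= led.
  by apply: pdle_leq led _; apply/resolutionP.
- by apply: he; apply/resolutionP.
- by apply: (he d); apply/resolutionP.
Qed.

Lemma lgld_SomeP d : is_lgld R (Some d) <->
  (forall M, pdle d M) /\ (forall e, (forall M, pdle e M) -> (d <= e)%N).
Proof.
split=> [[/pdim_upper_boundP h1 h2]|[h1 h2]].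
- by split=> // e /pdim_upper_boundP/h2.
- split; first exact/pdim_upper_boundP.
  by move=> [e|] //= /pdim_upper_boundP; apply: h2.
Qed.

Lemma lgld_NoneP : is_lgld R None <-> forall e, ~ forall M, pdle e M.
Proof.
split=> [[_ h] e /pdim_upper_boundP/h //|h]; split.
  by move=> M w _; case: w.
by move=> [e|] //= /pdim_upper_boundP; apply: h.
Qed.

Lemma lgld_exists : exists v, is_lgld R v.
Proof.
have [/least_nat[d [h1 h2]]|h] := pselect (exists d, forall M, pdle d M).
  by exists (Some d); apply/lgld_SomeP.
by exists None; apply/lgld_NoneP => e he; apply: h; exists e.
Qed.

End Resolutions.

(** * Semisimple rings: every module is projective *)

Section Semisimple.
Variable R : nzRingType.
Hypothesis ssR : semisimple_ring R.

Section Lift.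
Variables (P N N' : lmodType R) (g : {linear N -> N'}) (f : {linear P -> N'}).
Hypothesis gs : forall y : N', exists x : N, g x = y.

(* A partial lift is recorded by its graph. *)
Definition partial_lift (G : set (P * N)) : Prop :=
  [/\ submodule (G : set (P * N)%type), (forall n, G (0, n) -> n = 0)
    & forall p n, G (p, n) -> g n = f p].

(** The scalars [r] with [r p] in the domain of [G] form a left ideal [I]; a complement [J] gives 1
    = e + e'. The new value at [p] is the forced value at [e p] plus [e'] times an arbitrary
    preimage of [f p]. It is consistent because for [r] in [I] the element r e' = r - r e lies in
    both [I] and [J]. *)
Lemma partial_lift_extend (G : set (P * N)) (p : P) : partial_lift G ->
  exists G', [/\ partial_lift G', G `<=` G' & exists n, G' (p, n)].
Proof.
move=> [sG uG gG]; have [G0 GL] := sG.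
pose I : set R^o := [set r | exists n, G ((r : R) *: p, n)].
have sI : submodule I.
  split; first by exists 0; rewrite scale0r.
  move=> a u v [n hn] [m hm]; exists (a *: n + m).
  by rewrite scalerDl -scalerA; exact: (GL a _ _ hn hm).
have [J [sJ IJ0 IJ]] := ssR sI.
have [e [e' [Ie Je' e1]]] := IJ 1.
have [ne hne] := Ie.
have [n0 hn0] := gs (f p).
(* r e' n0 is the part of the lift of r p not forced by G *)
pose n1 : N := ne + (e' : R) *: n0.
pose G' : set (P * N) := [set z | exists a r, G a /\ z = a + r *: (p, n1)].
exists G'; split; first split.
- split; first by exists 0, 0; rewrite scale0r addr0.
  move=> c u v [a [r [Ga ->]]] [b [s [Gb ->]]].
  exists (c *: a + b), (c * r + s); split; first exact: GL.
  by rewrite scalerDl scalerDr scalerA addrACA.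
- move=> n [[a1 a2] [r [Ga /= [/esym ap ->]]]].
  have Ir : I r.
    exists (- a2); suff -> : (r *: p, - a2) = (-1 : R) *: (a1, a2).
      by apply: submoduleZ.
    congr pair; rewrite /= scaleN1r //.
    by apply/eqP; rewrite -addr_eq0 addrC ap.
  have re : (r : R) * e' = 0.
    have : (I `&` J) ((r : R) * e').
      split; last exact: (submoduleZ (r : R) sJ Je').
      have -> : (r : R) * e' = (r : R^o) - (r : R) *: e.
        rewrite -[X in X - _]mulr1 [in X in X - _]e1 mulrDr.
        by rewrite addrC addrA addNr add0r.
      by apply: submoduleB => //; apply: submoduleZ.
    by rewrite IJ0.
  rewrite scalerDr scalerA re scale0r addr0.
  apply: uG; have := GL r _ _ hne Ga.
  suff -> : (r : R) *: ((e : R) *: p, ne) + (a1, a2) = (0, a2 + r *: ne) by [].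
  congr pair => /=; last by rewrite addrC.
  rewrite scalerA.
  have -> : (r : R) * e = r by rewrite -[RHS]mulr1 [in RHS]e1 mulrDr re addr0.
  by rewrite addrC ap.
- move=> q n [[a1 a2] [r [Ga /= [-> ->]]]].
  rewrite !linearD !linearZZ linearD linearZZ (gG _ _ Ga) (gG _ _ hne) hn0.
  by rewrite linearZZ -scalerDl -e1 scale1r.
- by move=> z Gz; exists z, 0; rewrite scale0r addr0.
- by exists n1, 0, 1; rewrite scale1r add0r.
Qed.

Lemma partial_lift_total : exists G, partial_lift G /\ forall p, exists n, G (p, n).
Proof.
pose Pr G := G = set0 \/ partial_lift G.
have start : partial_lift [set 0].
  split; last by move=> p n [-> ->]; rewrite !linear0.
    by split=> // a u v -> ->; rewrite scaler0 addr0.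
  by move=> n [].
have [F FP tot|G [PG maxG]] := @Zorn_bigcup _ Pr.
  have [[A [FA nA]]|hF] := pselect (exists A, F A /\ A !=set0); last first.
    left; rewrite -subset0 => x [A FA Ax]; apply: hF; exists A; split=> //.
    by exists x.
  have plF B x : F B -> B x -> partial_lift B.
    by move=> FB Bx; have [B0|//] := FP B FB; rewrite B0 in Bx.
  have [x Ax] := nA; have [[A0 _] _ _] := plF A x FA Ax.
  right; split; first split.
  - by exists A.
  - move=> a u v [B FB Bu] [C FC Cv].
    have [BC|CB] := tot B C FB FC.
      have [[_ CL] _ _] := plF C v FC Cv.
      by exists C => //; apply: CL => //; apply: BC.
    have [[_ BL] _ _] := plF B u FB Bu.
    by exists B => //; apply: BL => //; apply: CB.
  - by move=> n [B FB Bn]; have [_ h _] := plF B _ FB Bn; apply: h.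
  - by move=> p n [B FB Bn]; have [_ _ h] := plF B _ FB Bn; apply: h.
have plG : partial_lift G.
  case: PG => // G0; exfalso; apply: (maxG [set 0]); last by right.
  by rewrite G0; split; [exact: sub0set|move=> /(_ 0); apply].
exists G; split=> // p.
have [G' [plG' GG' [n hn]]] := partial_lift_extend p plG.
exists n; apply: contrapT => nG; apply: (maxG G'); last by right.
by split=> // /(_ _ hn).
Qed.

Lemma semisimple_lift : exists h : {linear P -> N}, forall x, g (h x) = f x.
Proof.
have [G [[sG uG gG] /choice[h hG]]] := partial_lift_total.
have Ginj p n m : G (p, n) -> G (p, m) -> n = m.
  move=> Gn Gm; apply/eqP; rewrite -subr_eq0; apply/eqP; apply: uG.
  have := submoduleB sG Gn Gm.
  by suff -> : (p, n) - (p, m) = (0, n - m) by []; congr pair => /=; rewrite subrr.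
have lh : linear h.
  move=> a u v; apply: (Ginj (a *: u + v)) => //; case: sG => _ GL.
    exact: (GL a (u, h u) (v, h v)).
by exists (mklin lh) => x; apply: gG.
Qed.

End Lift.

Lemma semisimple_projective (P : lmodType R) : projective P.
Proof. by move=> N N' g f gs; apply: semisimple_lift. Qed.

Lemma semisimple_lgld : is_lgld R (Some 0%N).
Proof. by apply/lgld_SomeP; split=> // M; apply: semisimple_projective. Qed.

End Semisimple.

(** * Skew polynomial and skew Laurent extensions *)

Definition idx (l : bool) : pred int := [pred z : int | l || (0 <= z)%R].

Lemma idx_nat l (n : nat) : idx l n.
Proof. by rewrite /idx /= orbT. Qed.

Lemma idxD l z w : idx l z -> idx l w -> idx l (z + w).
Proof. by rewrite /idx /=; case: l => //=; apply: addr_ge0. Qed.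

(* Common description of the extensions R[x; tau] (l = false) and
   R[x^{+-1}; tau] (l = true): b z stands for x^z, tw z for tau^z, and tw' z is
   the inverse of tw z. *)
Record skew_ext (l : bool) (R S : nzRingType) (iota : {rmorphism R -> S})
    (b : int -> S) (tw tw' : int -> R -> R) : Prop := {
  se_inj : injective iota;
  se_basis : left_basis iota (idx l) b;
  se_b0 : b 0 = 1;
  se_bD : forall z w, idx l z -> idx l w -> b (z + w) = b z * b w;
  se_tw : forall z a, idx l z -> b z * iota a = iota (tw z a) * b z;
  se_twK : forall z, cancel (tw z) (tw' z);
  se_tw'K : forall z, cancel (tw' z) (tw z)
}.

(** * Left coefficients and their product formulas *)

Section Coefficients.
Variables (l : bool) (R S : nzRingType) (iota : {rmorphism R -> S}).
Variables (b : int -> S) (tw tw' : int -> R -> R).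
Hypothesis h : skew_ext l iota b tw tw'.

Lemma rep_exists f : exists sc : seq int * (int -> R),
  [/\ uniq sc.1, all (idx l) sc.1 & f = \sum_(z <- sc.1) iota (sc.2 z) * b z].
Proof. by have [/(_ f)[s [c hf]] _] := se_basis h; exists (s, c). Qed.

(** A chosen list of exponents, which may include some with zero coefficient; [lc_unique] shows that
    [lc] does not depend on the choice. *)
Definition lsup f : seq int := (sval (cid (rep_exists f))).1.

Definition lc f z : R :=
  if z \in lsup f then (sval (cid (rep_exists f))).2 z else 0.

Lemma big_widen (s t : seq int) (c : int -> R) : uniq s -> uniq t ->
  {subset s <= t} ->
  \sum_(z <- t) iota (if z \in s then c z else 0) * b z =
  \sum_(z <- s) iota (c z) * b z.
Proof.
move=> us ut st; rewrite (bigID (fun z => z \in s)) /= [X in _ + X]big1 ?addr0.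
  rewrite (eq_bigr (fun z => iota (c z) * b z)) => [|z ->] //.
  rewrite -big_filter; apply: perm_big; apply: uniq_perm; rewrite ?filter_uniq //.
  by move=> z; rewrite mem_filter; case: (boolP (z \in s)) => //= /st.
by move=> z /negPf ->; rewrite rmorph0 mul0r.
Qed.

Lemma lsup_uniq f : uniq (lsup f).
Proof. by rewrite /lsup; case: cid => -[s c] []. Qed.

Lemma lsup_idx f : all (idx l) (lsup f).
Proof. by rewrite /lsup; case: cid => -[s c] []. Qed.

Lemma lc_notin f z : z \notin lsup f -> lc f z = 0.
Proof. by rewrite /lc => /negPf ->. Qed.

Lemma lc_idx f z : ~~ idx l z -> lc f z = 0.
Proof. by move=> hz; apply: lc_notin; apply: contra hz => /(allP (lsup_idx f)). Qed.

Lemma lexpand f : f = \sum_(z <- lsup f) iota (lc f z) * b z.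
Proof.
rewrite /lc; rewrite (@big_widen (lsup f)) ?lsup_uniq //.
by rewrite /lsup; case: cid => -[s c] [].
Qed.

Lemma lc_unique (s : seq int) (c : int -> R) z : uniq s -> all (idx l) s ->
  lc (\sum_(z <- s) iota (c z) * b z) z = if z \in s then c z else 0.
Proof.
move=> us sA; set f := (X in lc X z).
pose t := undup (lsup f ++ s).
have ut : uniq t by exact: undup_uniq.
have st : {subset s <= t} by move=> w ws; rewrite mem_undup mem_cat ws orbT.
have lt : {subset lsup f <= t} by move=> w ws; rewrite mem_undup mem_cat ws.
pose d w := lc f w - (if w \in s then c w else 0).
have tA : all (idx l) t.
  apply/allP => w; rewrite mem_undup mem_cat => /orP[/(allP (lsup_idx f))//|].
  exact: (allP sA).
have sum0 : \sum_(w <- t) iota (d w) * b w = 0.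
  rewrite (eq_bigr (fun w => iota (lc f w) * b w -
      iota (if w \in s then c w else 0) * b w)); last first.
    by move=> w _; rewrite rmorphB mulrBl.
  rewrite sumrB (big_widen _ us ut st) -/f /lc (big_widen _ (lsup_uniq f) ut lt).
  apply/eqP; rewrite subr_eq0; apply/eqP; rewrite [RHS]lexpand.
  by apply: eq_big_seq => w wl; rewrite /lc wl.
have [_ hb] := se_basis h; have d0 := hb t d ut tA sum0.
have [zt|] := boolP (z \in t).
  by apply/eqP; rewrite -subr_eq0 -/(d z) d0.
rewrite mem_undup mem_cat negb_or => /andP[zl /negPf ->].
exact: lc_notin.
Qed.

Lemma lcE f z (s : seq int) (c : int -> R) : uniq s -> all (idx l) s ->
  f = \sum_(z <- s) iota (c z) * b z -> lc f z = if z \in s then c z else 0.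
Proof. by move=> us sA ->; exact: lc_unique. Qed.

Lemma lc_is_zmod z : {morph lc ^~ z : f g / f - g}.
Proof.
move=> f g /=; pose t := undup (lsup f ++ lsup g).
have ut : uniq t by exact: undup_uniq.
have ft : {subset lsup f <= t} by move=> w ws; rewrite mem_undup mem_cat ws.
have gt : {subset lsup g <= t} by move=> w ws; rewrite mem_undup mem_cat ws orbT.
have tA : all (idx l) t.
  by apply/allP => w; rewrite mem_undup mem_cat => /orP[]; apply/allP; apply: lsup_idx.
have key e : {subset lsup e <= t} -> e = \sum_(w <- t) iota (lc e w) * b w.
  move=> et; rewrite /lc big_widen ?lsup_uniq // [LHS]lexpand.
  by apply: eq_big_seq => w we; rewrite /lc we.
rewrite (@lcE (f - g) z t (fun w => lc f w - lc g w)) //; last first.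
  rewrite [in LHS](key f ft) [in LHS](key g gt) -sumrB.
  by apply: eq_bigr => w _; rewrite rmorphB mulrBl.
case: (boolP (z \in t)) => // ; rewrite mem_undup mem_cat negb_or => /andP[zf zg].
by rewrite !lc_notin // subr0.
Qed.

Definition lcz z : {additive S -> R} :=
  HB.pack (lc ^~ z) (GRing.isZmodMorphism.Build S R (lc ^~ z) (lc_is_zmod z)).

Lemma lcD f g z : lc (f + g) z = lc f z + lc g z.
Proof. exact: (raddfD (lcz z)). Qed.

Lemma lcB f g z : lc (f - g) z = lc f z - lc g z.
Proof. exact: lc_is_zmod. Qed.

Lemma lc0 z : lc 0 z = 0.
Proof. exact: (raddf0 (lcz z)). Qed.

Lemma lc_sum (I : Type) (s : seq I) (P : pred I) (F : I -> S) z :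
  lc (\sum_(i <- s | P i) F i) z = \sum_(i <- s | P i) lc (F i) z.
Proof. exact: (raddf_sum (lcz z)). Qed.

Lemma lc_mono a z w : idx l z -> lc (iota a * b z) w = if w == z then a else 0.
Proof.
move=> hz; rewrite (@lcE _ w [:: z] (fun=> a)) ?inE //= ?hz //.
by rewrite big_seq1.
Qed.

Lemma lc_b z w : idx l z -> lc (b z) w = (w == z)%:R.
Proof.
by move=> hz; rewrite -[b z]mul1r -(rmorph1 iota) lc_mono //; case: eqP.
Qed.

Lemma lc_iota a w : lc (iota a) w = if w == 0 then a else 0.
Proof. by rewrite -[iota a]mulr1 -(se_b0 h) lc_mono // (idx_nat l 0). Qed.

Lemma lc_ext f g : lc f =1 lc g -> f = g.
Proof.
move=> e; apply/eqP; rewrite -subr_eq0; apply/eqP.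
rewrite [LHS]lexpand big1 // => z _.
by rewrite lcB e subrr rmorph0 mul0r.
Qed.

Lemma se_ind (P : S -> Prop) : P 0 -> (forall f g, P f -> P g -> P (f + g)) ->
  (forall a z, idx l z -> P (iota a * b z)) -> forall f, P f.
Proof.
move=> P0 PD Pm f; rewrite (lexpand f) big_seq.
by apply: (big_ind P) => // z /(allP (lsup_idx f)); apply: Pm.
Qed.

Lemma lcZ a f z : lc (iota a * f) z = a * lc f z.
Proof.
elim/se_ind: f => [|f g hf hg|c w hw].
- by rewrite mulr0 !lc0 mulr0.
- by rewrite mulrDr !lcD hf hg mulrDr.
- by rewrite mulrA -rmorphM !lc_mono //; case: eqP; rewrite ?mulr0.
Qed.

Lemma lc_bM z f w : idx l z -> lc (b z * f) w = tw z (lc f (w - z)).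
Proof.
move=> hz.
have twE c : tw z c = lc (b z * iota c) z.
  by rewrite (se_tw h) // lc_mono // eqxx.
have tw0 : tw z 0 = 0 by rewrite twE rmorph0 mulr0 lc0.
elim/se_ind: f => [|f g hf hg|c y hy].
- by rewrite mulr0 !lc0.
- by rewrite mulrDr !lcD hf hg (twE (_ + _)) rmorphD mulrDr lcD -!twE.
- rewrite mulrA (se_tw h) // -mulrA -(se_bD h) // !lc_mono ?idxD //.
  by rewrite [z + y]addrC -subr_eq; case: eqP.
Qed.

(** Expresses the twist through the ring [S], so that [tw z] inherits additivity and
    multiplicativity, which [skew_ext] does not list. *)
Lemma tw_lc z c : idx l z -> tw z c = lc (b z * iota c) z.
Proof. by move=> hz; rewrite (se_tw h) // lc_mono // eqxx. Qed.

Lemma twD z c d : idx l z -> tw z (c + d) = tw z c + tw z d.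
Proof. by move=> hz; rewrite !tw_lc // rmorphD mulrDr lcD. Qed.

Lemma tw0 z : idx l z -> tw z 0 = 0.
Proof. by move=> hz; rewrite tw_lc // rmorph0 mulr0 lc0. Qed.

Lemma twM z c d : idx l z -> tw z (c * d) = tw z c * tw z d.
Proof.
move=> hz; rewrite tw_lc // rmorphM mulrA (se_tw h) // -mulrA (se_tw h) // mulrA.
by rewrite -rmorphM lc_mono // eqxx.
Qed.

Lemma tw1 z : idx l z -> tw z 1 = 1.
Proof. by move=> hz; rewrite tw_lc // rmorph1 mulr1 lc_b // eqxx. Qed.

Lemma tw_0 c : tw 0 c = c.
Proof. by rewrite tw_lc ?(idx_nat l 0) // (se_b0 h) mul1r lc_iota eqxx. Qed.

Lemma tw'D z c d : idx l z -> tw' z (c + d) = tw' z c + tw' z d.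
Proof. by move=> hz; apply: (can_inj (se_twK h z)); rewrite twD // !(se_tw'K h). Qed.

Lemma tw'M z c d : idx l z -> tw' z (c * d) = tw' z c * tw' z d.
Proof. by move=> hz; apply: (can_inj (se_twK h z)); rewrite twM // !(se_tw'K h). Qed.

Lemma tw'0 z : idx l z -> tw' z 0 = 0.
Proof. by move=> hz; apply: (can_inj (se_twK h z)); rewrite tw0 // !(se_tw'K h). Qed.

Lemma tw'1 z : idx l z -> tw' z 1 = 1.
Proof. by move=> hz; apply: (can_inj (se_twK h z)); rewrite tw1 // !(se_tw'K h). Qed.

Lemma tw'_0 c : tw' 0 c = c.
Proof. by apply: (can_inj (se_twK h 0)); rewrite (se_tw'K h) tw_0. Qed.

Lemma lc_iotaM f a z : idx l z -> lc (f * iota a) z = lc f z * tw z a.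
Proof.
move=> hz; elim/se_ind: f => [|f g hf hg|c y hy].
- by rewrite mul0r !lc0 mul0r.
- by rewrite mulrDl !lcD hf hg mulrDl.
- rewrite -mulrA (se_tw h) // mulrA -rmorphM !lc_mono //.
  by case: eqP => [->|_]; rewrite ?mul0r.
Qed.

Lemma lcM f g z : lc (f * g) z = \sum_(y <- lsup f) lc f y * tw y (lc g (z - y)).
Proof.
rewrite {1}(lexpand f) mulr_suml lc_sum; apply: eq_big_seq => y yf.
by rewrite -mulrA lcZ lc_bM // (allP (lsup_idx f)).
Qed.

(** The case of the convolution sum in which one term survives; it serves for constant terms, linear
    terms and leading terms of products. *)
Lemma lcM1 f g z y : (forall w, idx l w -> w != y -> lc f w = 0 \/ lc g (z - w) = 0) ->
  idx l y -> lc (f * g) z = lc f y * tw y (lc g (z - y)).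
Proof.
move=> hw hy; rewrite lcM.
have [yf|yf] := boolP (y \in lsup f).
  rewrite (bigD1_seq y) ?lsup_uniq //= big_seq_cond big1 ?addr0 // => w /andP[].
  move=> /(allP (lsup_idx f)) iw wy.
  by case: (hw w iw wy) => ->; rewrite ?mul0r // tw0 // mulr0.
rewrite lc_notin // mul0r big_seq big1 // => w wf.
have iw := allP (lsup_idx f) w wf.
have wy : w != y by apply: contraNneq yf => <-.
by case: (hw w iw wy) => ->; rewrite ?mul0r // tw0 // mulr0.
Qed.

Lemma lc_bound f : exists N : nat, forall z : int, (N%:Z < z)%R -> lc f z = 0.
Proof.
exists (\max_(z <- lsup f) `|z|%N) => z hz; apply: lc_notin.
apply/negP => zf; move: hz; rewrite ltNge => /negP; apply.
apply: (@le_trans _ _ (`|z|%N : int)).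
  by rewrite abszE ler_norm.
by rewrite lez_nat; apply: (@leq_bigmax_seq _ _ predT (fun z : int => `|z|%N)).
Qed.

Lemma lc_bM_b f z w : idx l z -> lc (f * b z) w = lc f (w - z).
Proof.
move=> hz; elim/se_ind: f => [|f g hf hg|c y hy].
- by rewrite mul0r !lc0.
- by rewrite mulrDl !lcD hf hg.
- by rewrite -mulrA -(se_bD h) // !lc_mono ?idxD // subr_eq.
Qed.

End Coefficients.

(** * Global dimension of skew extensions *)

(* phi only serves to index the A-module structure put on M below. *)
Definition restr (A B : nzRingType) (phi : {rmorphism A -> B}) (M : lmodType B) :
  Type := M.

Section Restriction.
Variables (A B : nzRingType) (phi : {rmorphism A -> B}).
Local Notation restr := (restr phi).

Section Instances.
Variable M : lmodType B.
HB.instance Definition _ := GRing.Zmodule.copy (restr M) M.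

Definition restr_scale (a : A) (m : restr M) : restr M := phi a *: (m : M).

Lemma restr_scaleA a c (m : restr M) :
  restr_scale a (restr_scale c m) = restr_scale (a * c) m.
Proof. by rewrite /restr_scale scalerA rmorphM. Qed.
Lemma restr_scale1 : left_id 1 restr_scale.
Proof. by move=> m; rewrite /restr_scale rmorph1 scale1r. Qed.
Lemma restr_scaleDr : right_distributive restr_scale +%R.
Proof. by move=> a m n; rewrite /restr_scale scalerDr. Qed.
Lemma restr_scaleDl m : {morph restr_scale^~ m : a c / a + c}.
Proof. by move=> a c; rewrite /restr_scale rmorphD scalerDl. Qed.
HB.instance Definition _ := GRing.Zmodule_isLmodule.Build A (restr M)
  restr_scaleA restr_scale1 restr_scaleDr restr_scaleDl.
End Instances.

Lemma restrZ (M : lmodType B) (a : A) (m : restr M) :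
  a *: m = (phi a *: (m : M) : M).
Proof. by []. Qed.

Lemma restr_lin_subproof (M N : lmodType B) (g : {linear M -> N}) :
  linear (g : restr M -> restr N).
Proof. by move=> a u v; rewrite !restrZ -linearP. Qed.

Definition restr_lin (M N : lmodType B) (g : {linear M -> N}) :
  {linear restr M -> restr N} := mklin (restr_lin_subproof g).

Lemma restr_exact (K P M : lmodType B) (i : {linear K -> P}) (p : {linear P -> M}) :
  short_exact i p -> short_exact (restr_lin i) (restr_lin p).
Proof. by []. Qed.

End Restriction.

Section GlobalDimension.
Variables (l : bool) (R S : nzRingType) (iota : {rmorphism R -> S}).
Variables (b : int -> S) (tw tw' : int -> R -> R).
Hypothesis h : skew_ext l iota b tw tw'.

Notation restr := (restr iota).
Notation lc := (lc h).

Lemma mem_classic_int (s : seq int) (z : int) :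
  (z \in (s : seq {classic int})) = (z \in s).
Proof.
elim: s => [|y s IH] //; rewrite !inE -IH; congr (_ || _).
by apply/eqP/eqP.
Qed.

Lemma lc_fin f : @finsupp_fun R int (lc f).
Proof. by exists (lsup h f) => z; rewrite mem_classic_int; apply: lc_notin. Qed.

Definition lcoefs (f : S) : free_mod R int := mksub (@finsupp_funP R int) (lc_fin f).

Lemma fcoef_lcoefs f z : fcoef (lcoefs f) z = lc f z.
Proof. by []. Qed.

Lemma lcoefs_is_zmod : zmod_morphism lcoefs.
Proof. by move=> f g; apply: fcoef_inj => z; rewrite fcoefB !fcoef_lcoefs lcB. Qed.
HB.instance Definition _ :=
  GRing.isZmodMorphism.Build S (free_mod R int) lcoefs lcoefs_is_zmod.

Lemma lcoefsZ a f : lcoefs (iota a * f) = a *: lcoefs f.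
Proof. by apply: fcoef_inj => z; rewrite fcoefZ !fcoef_lcoefs lcZ. Qed.

Lemma lcoefs_b z : idx l z -> lcoefs (b z) = delta R z.
Proof.
move=> hz; apply: fcoef_inj => y.
rewrite fcoef_lcoefs lc_b // (@fcoef_delta R int z y).
by congr (nat_of_bool _)%:R; apply/eqP/eqP.
Qed.

Section FreeRestriction.
Variable X : Type.
Let F := free_mod S X.

Lemma restr_free_ind (P : F -> Prop) : P 0 ->
  (forall m m', P m -> P m' -> P (m + m')) ->
  (forall a z x, idx l z -> P (iota a *: (b z *: delta S x))) -> forall m, P m.
Proof.
move=> P0 PD Pd; apply: free_ind => // s x.
elim/(se_ind h): s => [|f g hf hg|a z hz]; first by rewrite scale0r.
- by rewrite scalerDl; apply: PD.
- by rewrite -scalerA; apply: Pd.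
Qed.

Lemma restr_free_ext (N : lmodType R) (f g : {linear restr F -> N}) :
  (forall z x, idx l z -> f (b z *: delta S x) = g (b z *: delta S x)) -> f =1 g.
Proof.
move=> e; apply: restr_free_ind => [|m m' e1 e2|a z x hz].
- by rewrite !linear0.
- by rewrite (linearD f) (linearD g) e1 e2.
- by rewrite -(restrZ (phi := iota)) (linearZZ f) (linearZZ g) e.
Qed.

Variables (N : lmodType R) (phi : int -> X -> N).

Definition restr_lift_psi (x : X) : {additive S -> N} :=
  free_lift (phi^~ x) \o lcoefs.

Lemma restr_lift_linear : linear (fsum restr_lift_psi : restr F -> N).
Proof.
move=> a m m'; rewrite raddfD restrZ; congr (_ + _).
elim/free_ind: m => [|m1 m2 h1 h2|s x].
- by rewrite scaler0 !raddf0.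
- by rewrite scalerDr !raddfD /= h1 h2.
- rewrite scalerA [LHS]fsumZdelta [in RHS]fsumZdelta /= lcoefsZ.
  exact: (linearZZ (free_lift (phi^~ x))).
Qed.

Definition restr_lift : {linear restr F -> N} := mklin restr_lift_linear.

Lemma restr_liftE z x : idx l z -> restr_lift (b z *: delta S x) = phi z x.
Proof.
move=> hz; rewrite [LHS]fsumZdelta /= lcoefs_b //.
exact: free_lift_delta.
Qed.
End FreeRestriction.

Lemma restr_free_projective X : projective (restr (free_mod S X)).
Proof.
move=> N N' g f gs.
have /choice[phi hphi] : forall zx : int * X,
    exists y, g y = f (b zx.1 *: delta S zx.2) by move=> zx; apply: gs.
exists (restr_lift (fun z x => phi (z, x))).
apply: (restr_free_ext (f := g \o restr_lift (fun z x => phi (z, x)))) => z x hz.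
by rewrite /= -(hphi (z, x)); congr (g _); exact: restr_liftE.
Qed.

Lemma restr_projective (P : lmodType S) : projective P -> projective (restr P).
Proof.
move=> hP; have [s hs] := hP _ _ (cover P) idfun (@cover_surj _ P).
apply: (projective_summand (s := restr_lin iota s) (t := restr_lin iota (cover P))).
  exact: hs.
exact: restr_free_projective.
Qed.

Lemma restr_pdle d (M : lmodType S) : pdle d M -> pdle d (restr M).
Proof.
elim: d M => [|d IH] M; first exact: restr_projective.
move=> [K [P [i [p [se hP hK]]]]].
exists (restr K), (restr P), (restr_lin iota i), (restr_lin iota p).
split; [exact: restr_exact se|exact: restr_projective|exact: IH].
Qed.

(** For a negative exponent, [f] commutes with the inverse power, which is a nonnegative power of x,
    and hence with the power itself. *)
Lemma se_linear (M N : lmodType S) (f : {additive M -> N}) :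
  (forall a m, f (iota a *: m) = iota a *: f m) ->
  (forall m, f (b 1 *: m) = b 1 *: f m) -> linear f.
Proof.
move=> fa fb s u v; rewrite raddfD; congr (_ + _).
elim/(se_ind h): s => [|s t hs ht|a z hz].
- by rewrite !scale0r raddf0.
- by rewrite !scalerDl raddfD hs ht.
rewrite -!scalerA fa; congr (_ *: _).
have pos n m : f (b (Posz n) *: m) = b (Posz n) *: f m.
  elim: n m => [|n IH] m; first by rewrite (se_b0 h) !scale1r.
  by rewrite -addn1 PoszD (se_bD h) ?idx_nat // -!scalerA IH fb.
case: z hz => [n _|n hz]; first exact: pos.
have ->: Negz n = - (n.+1%:Z) by [].
have bV : b (- n.+1%:Z) * b n.+1%:Z = 1.
  by rewrite -(se_bD h) ?idx_nat // addNr (se_b0 h).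
have bV' : b n.+1%:Z * b (- n.+1%:Z) = 1.
  by rewrite -(se_bD h) ?idx_nat // subrr (se_b0 h).
by rewrite -[LHS]scale1r -{1}bV -scalerA -pos scalerA bV' scale1r.
Qed.

(** The recursion is solved from k(0) = 0, upwards by substitution and downwards by dividing by x;
    downward steps are demanded only when negative exponents occur, and then x is a unit. *)
Lemma twisted_sum_exists (N : lmodType S) (e : int -> N) (P : set N) :
  submodule P -> (forall z, P (e z)) ->
  exists k : int -> N, (forall z, idx l z -> k (z + 1) = b 1 *: k z + e z) /\
    forall z, P (k z).
Proof.
move=> sP Pe; have [P0 _] := sP.
pose kp := fix kp n : N := if n is m.+1 then b 1 *: kp m + e m else 0.
(* [kn n] is the value at [Negz n], that is at -(n + 1), and [y] is the value at -n, which is 0 for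
   n = 0. *)
pose kn := fix kn n : N :=
  let y := if n is m.+1 then kn m else 0 in b (-1) *: (y - e (Negz n)).
have Pkp n : P (kp n).
  elim: n => [|n IH] //=; apply: submoduleD => //; exact: submoduleZ.
have Pkn n : P (kn n).
  by elim: n => [|n IH] /=; apply: submoduleZ => //; apply: submoduleB.
exists (fun z => match z with Posz n => kp n | Negz n => kn n end).
split; last by case.
case=> [n _|n hz]; first by rewrite -PoszD addn1.
have bV : b 1 * b (-1) = 1.
  by rewrite -(se_bD h) ?(idx_nat l 1) ?subrr ?(se_b0 h) //; move: hz; rewrite /idx /= !orbF.
case: n hz => [|n] hz.
  by rewrite (_ : Negz 0 + 1 = 0) //= scalerA bV scale1r sub0r addNr.
have -> : Negz n.+1 + 1 = Negz n.
  by rewrite !NegzE -[n.+2]addn1 PoszD opprD addrNK.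
by rewrite [kn n.+1]/= scalerA bV scale1r subrK.
Qed.

Section Lift.
Variables (K : lmodType S) (N N' : lmodType S).
Let F := free_mod S K.
Let L := kerm (cover K).
Variables (g : {linear N -> N'}) (f : {linear L -> N'}).
Hypothesis gs : forall y : N', exists x : N, g x = y.
Hypothesis hK : projective (restr K).

(* An R-linear lift H of f fails to be S-linear by eps; since F is free over S,
   eps is the defect of an R-linear map k into the kernel of g, and H - k is the
   required S-linear lift. *)
Lemma syzygy_lift : exists t : {linear L -> N}, forall x, g (t x) = f x.
Proof.
have [s hs] : exists s : {linear restr K -> restr F}, forall x, cover K (s x) = x.
  by have [s hs] := @hK _ _ (restr_lin iota (cover K)) idfun (@cover_surj _ K); exists s.
have rho0 (m : F) : cover K (m - s (cover K m)) = 0.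
  by rewrite linearB hs subrr.
(* [rho] is the R-linear projection of [F] onto [L] along the section [s]. It extends the problem
   from [L] to all of [F], where an R-basis is known. *)
pose rho (m : F) : L := mksub (submodule_ker (cover K))
  (rho0 m : [set x | cover K x = 0] _).
pose j : {linear L -> F} := kerm_incl (cover K).
have jrho m : j (rho m) = m - s (cover K m) by rewrite /j kerm_inclE.
have ij : injective j by exact: kerm_incl_inj.
have rhoD m m' : rho (m + m') = rho m + rho m'.
  by apply: ij; rewrite linearD !jrho linearD (linearD s) opprD addrACA.
have rhoZ a m : rho (iota a *: m) = iota a *: rho m.
  apply: ij; rewrite linearZZ !jrho linearZZ scalerBr; congr (_ - _).
  by rewrite -(restrZ (phi := iota)) (linearZZ s).
have rhoj x : rho (j x) = x.
  by apply: ij; rewrite jrho mem_kerm (linear0 s) subr0.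
have lf : linear (fun m : restr F => f (rho m) : restr N').
  by move=> a m m'; rewrite !restrZ rhoD rhoZ linearP.
have [H hH] : exists H : {linear restr F -> restr N}, forall m, g (H m) = f (rho m).
  exact: (@restr_free_projective K _ _ (restr_lin iota g) (mklin lf) gs).
pose X := b 1.
have Xa a : X * iota a = iota (tw 1 a) * X by apply: (se_tw h); exact: (idx_nat l 1).
pose eps (m : F) : N := H (X *: j (rho m)) - X *: H (j (rho m)).
have epsD m m' : eps (m + m') = eps m + eps m'.
  by rewrite /eps rhoD linearD scalerDr !(linearD H) scalerDr opprD addrACA.
have HZ a m : H (iota a *: m) = iota a *: (H m : N) by exact: (linearZZ H).
have epsZ a m : eps (iota a *: m) = iota (tw 1 a) *: eps m.
  rewrite /eps rhoZ linearZZ scalerA Xa -scalerA HZ scalerBr; congr (_ - _).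
  by rewrite HZ !scalerA Xa.
have geps m : g (eps m) = 0.
  by rewrite linearB linearZZ !hH rhoj -linearZZ rhoj linearZZ subrr.
(* [kap y z] is to be the value of [k] at [b z *: delta S y]. The recursion is the equation k(x m) =
   x k(m) + eps(m) on the basis; it spreads to all of [F] because [eps] is semilinear for tau, as x
   itself is. *)
have /choice[kap hkap] : forall y : K, exists k : int -> N,
    (forall z, idx l z -> k (z + 1) = X *: k z + eps (b z *: delta S y)) /\
    forall z, g (k z) = 0.
  move=> y; apply: (twisted_sum_exists (P := [set x | g x = 0])).
    exact: submodule_ker.
  by move=> z; exact: geps.
have [k kE] : exists k : {linear restr F -> restr N},
    forall z y, idx l z -> k (b z *: delta S y) = kap y z.
  exists (@restr_lift K (restr N) (fun z y => kap y z)) => z y hz.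
  exact: restr_liftE.
have gk m : g (k m) = 0.
  have := @restr_free_ext K (restr N') (restr_lin iota g \o k) (zero_lin _ _) _ m.
  apply=> z y hz /=.
  by rewrite [X in g X]kE //; have [_] := hkap y.
have kZ a m : k (iota a *: m) = iota a *: (k m : N) by exact: (linearZZ k).
have kX m : k (X *: m) = X *: (k m : N) + eps m.
  elim/restr_free_ind: m => [|m m' e1 e2|a z y hz].
  - have e0 : eps 0 = 0.
      have := epsZ 0 0.
      by rewrite scaler0 (tw0 h) ?(idx_nat l 1) // rmorph0 scale0r.
    by rewrite scaler0 !(linear0 k) scaler0 e0 addr0.
  - by rewrite scalerDr !(linearD k) e1 e2 scalerDr epsD addrACA.
  - rewrite (scalerA X) Xa -scalerA kZ (scalerA X) /X -(se_bD h) ?(idx_nat l 1) // -/X.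
    rewrite [1 + z]addrC kE ?idxD ?(idx_nat l 1) //.
    have [-> // _] := hkap y.
    by rewrite kZ kE // scalerA Xa -scalerA epsZ scalerDr.
have tz : zmod_morphism (fun x : L => (H (j x) - k (j x) : N)).
  by move=> x y; rewrite linearB (linearB H) (linearB k) !opprD !opprK addrACA.
pose t0 : {additive L -> N} := HB.pack (fun x : L => (H (j x) - k (j x) : N))
  (GRing.isZmodMorphism.Build L N (fun x : L => (H (j x) - k (j x) : N)) tz).
have lt : linear t0.
  apply: se_linear => [a m|m] /=; rewrite linearZZ.
    by rewrite HZ kZ scalerBr.
  rewrite -/X kX /eps rhoj scalerBr opprD opprB.
  by rewrite addrCA [X in _ + X]addrC subrK addrC.
exists (mklin lt) => x /=; rewrite linearB hH gk subr0 rhoj.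
by [].
Qed.

End Lift.

Lemma pdle1_restr_projective (K : lmodType S) : projective (restr K) -> pdle 1 K.
Proof.
move=> hK; exists (kerm (cover K)), (free_mod S K), (kerm_incl (cover K)), (cover K).
split; [exact: short_exact_ker (@cover_surj _ K)|exact: free_projective|].
by move=> N N' g f gs; apply: syzygy_lift.
Qed.

(** A free [S]-module is [R]-projective, so each syzygy over [S] also lowers the bound over [R],
    until the [R]-projective case is reached. *)
Lemma pdle_restr_S d (M : lmodType S) : pdle d (restr M) -> pdle d.+1 M.
Proof.
elim: d M => [|d IH] M hM; first exact: pdle1_restr_projective.
have se := short_exact_ker (@cover_surj _ M).
exists (kerm (cover M)), (free_mod S M), (kerm_incl (cover M)), (cover M).
split=> //; first exact: free_projective.
by apply: IH; apply: (pdle_syzygy (restr_exact iota se)) => //; apply: restr_free_projective.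
Qed.

End GlobalDimension.

(** * Coinduced modules and lower bounds for the global dimension *)

Section Coinduced.
Variables (A B : nzRingType) (phi : {rmorphism A -> B}) (M : lmodType A).

Definition coind_pred : pred (B -> M) := fun f =>
  `[< (forall s t, f (s + t) = f s + f t) /\
      (forall a s, f (phi a * s) = a *: f s) >].

Lemma coind_closed : zmod_closed coind_pred.
Proof.
split=> [|f g /asboolP[fD fZ] /asboolP[gD gZ]]; apply/asboolP.
  by split=> [s t|a s]; rewrite ?addr0 ?scaler0.
have E s : (f - g) s = f s - g s by [].
by split=> [s t|a s]; rewrite !E ?fD ?gD ?fZ ?gZ ?scalerBr // opprD addrACA.
Qed.

Record coind := Coind { coind_fun :> B -> M; coind_funP : coind_pred coind_fun }.

HB.instance Definition _ := [isSub for coind_fun].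
HB.instance Definition _ := [Choice of coind by <:].
HB.instance Definition _ :=
  GRing.SubChoice_isSubZmodule.Build (B -> M) coind_pred coind coind_closed.

Lemma coindD (f : coind) s t : f (s + t) = f s + f t.
Proof. by have /asboolP[] := coind_funP f. Qed.

Lemma coindZ (f : coind) a s : f (phi a * s) = a *: f s.
Proof. by have /asboolP[] := coind_funP f. Qed.

Lemma coind_ext (f g : coind) : f =1 g -> f = g.
Proof. by move=> e; apply: val_inj; apply/funext. Qed.

Lemma coind_scale_subproof (c : B) (f : coind) : coind_pred (fun s => f (s * c)).
Proof.
apply/asboolP; split=> [s t|a s]; first by rewrite mulrDl coindD.
by rewrite -mulrA coindZ.
Qed.

Definition coind_scale (c : B) (f : coind) : coind :=
  Coind (coind_scale_subproof c f).

Lemma coind_addE (f g : coind) s : (f + g) s = f s + g s.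
Proof. by []. Qed.

Lemma coind_scaleA a c f : coind_scale a (coind_scale c f) = coind_scale (a * c) f.
Proof. by apply: coind_ext => s /=; rewrite mulrA. Qed.
Lemma coind_scale1 : left_id 1 coind_scale.
Proof. by move=> f; apply: coind_ext => s /=; rewrite mulr1. Qed.
Lemma coind_scaleDr : right_distributive coind_scale +%R.
Proof. by move=> a f g; apply: coind_ext. Qed.
Lemma coind_scaleDl f : {morph coind_scale^~ f : a c / a + c}.
Proof. by move=> a c; apply: coind_ext => s; rewrite coind_addE /= mulrDr coindD. Qed.
HB.instance Definition _ := GRing.Zmodule_isLmodule.Build B coind
  coind_scaleA coind_scale1 coind_scaleDr coind_scaleDl.

Lemma coind_scaleE (c : B) (f : coind) s : (c *: f) s = f (s * c).
Proof. by []. Qed.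

End Coinduced.

Lemma projective_section (S : nzRingType) (P : lmodType S) : projective P ->
  exists t : {linear P -> free_mod S P}, forall x, cover P (t x) = x.
Proof. by move=> hP; apply: (hP _ _ (cover P) idfun (@cover_surj _ P)). Qed.

Section LowerBound.
Variables (l : bool) (R S : nzRingType) (iota : {rmorphism R -> S}).
Variables (b : int -> S) (tw tw' : int -> R -> R).
Hypothesis h : skew_ext l iota b tw tw'.

(** The section sends [m] to the map taking [s] to its constant coefficient times [m], and
    evaluation at 1 retracts it. The section is [R]-linear because the constant coefficient respects
    right multiplication by [R]. *)
Lemma pdle_coind d (M : lmodType R) :
  pdle d (coind iota M : lmodType S) -> pdle d M.
Proof.
move=> /(restr_pdle h) hd.
have c0 (m : M) : coind_pred iota (fun s => lc h s 0 *: m).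
  apply/asboolP; split=> [s t|a s]; first by rewrite lcD scalerDl.
  by rewrite lcZ scalerA.
have ls : linear (fun m : M => (Coind (c0 m) : restr iota (coind iota M))).
  move=> a u v; apply: coind_ext => s; rewrite coind_addE restrZ coind_scaleE /=.
  rewrite (lc_iotaM h) ?(idx_nat l 0) // (tw_0 h) scalerDr.
  by rewrite scalerA.
have lt : linear (fun f : restr iota (coind iota M) => (f : coind iota M) 1).
  move=> a u v; rewrite coind_addE restrZ coind_scaleE mul1r.
  by rewrite -[iota a]mulr1 coindZ.
apply: (pdle_retract (s := mklin ls) (t := mklin lt)) hd => m /=.
by rewrite -(rmorph1 iota) lc_iota eqxx scale1r.
Qed.

(** Comparing coefficients, tau maps the one at w - 1 to the one at w, so vanishing spreads
    downwards from the exponents above the support. *)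
Lemma b1_fixed s : b 1 * s = s -> s = 0.
Proof.
move=> e; apply: (lc_ext (h := h)) => z; rewrite lc0.
have step w : lc h s w = 0 -> lc h s (w - 1) = 0.
  rewrite -{1}e lc_bM ?(idx_nat l 1) // => e1.
  by apply: (can_inj (se_twK h 1)); rewrite e1 (tw0 h) // (idx_nat l 1).
have [N hN] := lc_bound h s.
have key k : lc h s (N%:Z + 1 - k%:Z) = 0.
  elim: k => [|k IH]; first by rewrite subr0 hN // ltrDl.
  by rewrite -addn1 PoszD opprD addrA; apply: step.
have [/hN //|zN] := ltP N%:Z z.
have : (0 <= N%:Z + 1 - z)%R by rewrite subr_ge0 (le_trans zN) // lerDl.
case E : (N%:Z + 1 - z) => [k|//] _; have := key k.
by rewrite -E opprB addrC subrK.
Qed.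

(** The sum-of-coefficients functional is a nonzero vector of Hom_R(S, R) fixed by x. If that module
    were projective it would embed in a free module, whose only fixed vector is 0. *)
Lemma not_all_projective : ~ forall M : lmodType S, projective M.
Proof.
move=> hP; pose u : {linear free_mod R int -> R^o} := free_lift (fun=> 1 : R^o).
have up : coind_pred iota (M := R^o) (fun s => u (lcoefs h s)).
  apply/asboolP; split=> [s t|a s]; first by rewrite raddfD linearD.
  by rewrite lcoefsZ linearZZ.
pose f : (coind iota R^o : lmodType S) := Coind up.
have fb z : idx l z -> f (b z) = 1.
  by move=> hz; rewrite /f /= lcoefs_b //; exact: free_lift_delta.
have ff : b 1 *: f = f.
  apply: coind_ext => s; rewrite coind_scaleE.
  elim/(se_ind h): s => [|s t e1 e2|a z hz].
  - by rewrite mul0r.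
  - by rewrite mulrDl !coindD e1 e2.
  - by rewrite -mulrA -(se_bD h) ?(idx_nat l 1) // !coindZ !fb ?idxD // (idx_nat l 1).
have [t ht] := projective_section (hP (coind iota R^o)).
have tf0 : t f = 0.
  apply: fcoef_inj => y; rewrite fcoef0; apply: b1_fixed.
  by rewrite -fcoefZ -linearZZ ff.
have := ht f; rewrite tf0 linear0 => /(congr1 (fun g : coind iota R^o => g (b 0))).
rewrite fb ?(idx_nat l 0) // => /esym/eqP.
by rewrite oner_eq0.
Qed.

Lemma lgld_step d : is_lgld R (Some d) ->
  exists e, is_lgld S (Some e) /\ (d <= e <= d.+1)%N.
Proof.
move=> /lgld_SomeP[h1 h2].
have up (M : lmodType S) : pdle d.+1 M by apply: (pdle_restr_S h).
have [e [he me]] := least_nat (ex_intro (fun e => forall M : lmodType S, pdle e M) _ up).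
exists e; split; first by apply/lgld_SomeP.
rewrite me // andbT; apply: h2 => M; apply: pdle_coind; exact: he.
Qed.

Lemma lgld_semisimple_step : is_lgld R (Some 0%N) -> is_lgld S (Some 1%N).
Proof.
move=> /lgld_step[[|[|e]] [he //]].
by have /lgld_SomeP[/not_all_projective] := he.
Qed.

End LowerBound.

Section FreeMap.
Variables (A B : nzRingType) (X : Type) (u : {additive A -> B}).

Lemma free_map_subproof (m : free_mod A X) :
  @finsupp_fun B X (fun x => u (fcoef m x)).
Proof. by exists (fsupp m) => x hx /=; rewrite fsuppP ?raddf0. Qed.

Definition free_map (m : free_mod A X) : free_mod B X :=
  mksub (@finsupp_funP B X) (free_map_subproof m).

Lemma fcoef_free_map m x : fcoef (free_map m) x = u (fcoef m x).
Proof. by []. Qed.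

Lemma free_mapD m m' : free_map (m + m') = free_map m + free_map m'.
Proof. by apply: fcoef_inj => x; rewrite fcoefD !fcoef_free_map fcoefD raddfD. Qed.

Lemma free_map_delta a x : free_map (a *: delta A x) = u a *: delta B x.
Proof.
apply: fcoef_inj => y; rewrite fcoefZ fcoef_free_map fcoefZ.
rewrite (@fcoef_delta A X x y) (@fcoef_delta B X x y).
by case: eqP => _; rewrite ?mulr1 // !mulr0 raddf0.
Qed.

End FreeMap.

(** * The polynomial case: global dimension grows by exactly one *)

Section Polynomial.
Variables (R S : nzRingType) (iota : {rmorphism R -> S}).
Variables (b : int -> S) (tw tw' : int -> R -> R).
Hypothesis h : skew_ext false iota b tw tw'.
Notation lc := (lc h).
Let i1 : idx false 1 := isT.

Lemma lcM_0 f g : lc (f * g) 0 = lc f 0 * lc g 0.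
Proof.
rewrite (lcM1 (y := 0)) ?tw_0 // ?subr0 ?(tw_0 h) // => w hw w0; right.
apply: lc_idx; rewrite /idx /= sub0r oppr_ge0 -ltNge.
by rewrite lt_def w0.
Qed.

Lemma shift_exists f : exists t, f = iota (lc f 0) + t * b 1.
Proof.
elim/(se_ind h): f => [|f1 f2 [t1 e1] [t2 e2]|a z hz].
- by exists 0; rewrite lc0 rmorph0 mul0r addr0.
- by exists (t1 + t2); rewrite lcD rmorphD mulrDl addrACA -e1 -e2.
- case: z hz => [[|n]|//] hz.
    by exists 0; rewrite lc_mono // (se_b0 h) mulr1 mul0r addr0.
  exists (iota a * b n); rewrite lc_mono //= rmorph0 add0r -mulrA -(se_bD h) //.
  by rewrite -PoszD addn1.
Qed.

Lemma lcM_1 f g : lc (f * g) 1 = lc f 0 * lc g 1 + lc f 1 * tw 1 (lc g 0).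
Proof.
have [t ht] := shift_exists f.
have lt : lc f 1 = lc t 0.
  by rewrite {1}ht lcD lc_iota /= add0r lc_bM_b.
rewrite {1}ht mulrDl lcD lcZ; congr (_ + _); rewrite -mulrA.
have -> : lc (t * (b 1 * g)) 1 = lc t 0 * tw 0 (lc (b 1 * g) (1 - 0)).
  apply: lcM1 => // w hw w0; right; rewrite lc_bM //.
  rewrite lc_idx ?(tw0 h) //.
  rewrite /idx /= addrAC subrr sub0r oppr_ge0 -ltNge.
  by rewrite lt_def w0.
by rewrite (tw_0 h) lc_bM // subr0 subrr lt.
Qed.

Lemma eps_monoid (u : R -> R) : u 1 = 1 -> {morph u : x y / x * y} ->
  monoid_morphism (fun f => u (lc f 0)).
Proof.
move=> u1 uM; split=> [|f g]; last by rewrite lcM_0 uM.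
by rewrite -(rmorph1 iota) lc_iota eqxx u1.
Qed.

Lemma eps_zmod (u : R -> R) : {morph u : x y / x - y} ->
  zmod_morphism (fun f => u (lc f 0)).
Proof. by move=> uB f g; rewrite lcB uB. Qed.

Definition eps : {rmorphism S -> R} :=
  HB.pack (fun f => id (lc f 0))
    (GRing.isZmodMorphism.Build S R _ (@eps_zmod id (fun _ _ => erefl)))
    (GRing.isMonoidMorphism.Build S R _ (@eps_monoid id erefl (fun _ _ => erefl))).

Lemma tw'1B : {morph tw' 1 : x y / x - y}.
Proof.
by move=> x y; apply/eqP; rewrite eq_sym subr_eq -(tw'D h) // subrK.
Qed.

Definition epstw : {rmorphism S -> R} :=
  HB.pack (fun f => tw' 1 (lc f 0))
    (GRing.isZmodMorphism.Build S R _ (eps_zmod tw'1B))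
    (GRing.isMonoidMorphism.Build S R _
       (eps_monoid (tw'1 h i1) (fun x y => tw'M h x y i1))).

Lemma epsE f : eps f = lc f 0. Proof. by []. Qed.
Lemma epstwE f : epstw f = tw' 1 (lc f 0). Proof. by []. Qed.

Lemma rc1_zmod : zmod_morphism (fun f => tw' 1 (lc f 1)).
Proof. by move=> f g; rewrite lcB tw'1B. Qed.

Definition rc1 : {additive S -> R} :=
  HB.pack (fun f => tw' 1 (lc f 1)) (GRing.isZmodMorphism.Build S R _ rc1_zmod).

(** [rc1] is the coefficient of x written to the right of x, whence the tau^-1 in it. The formula
    says that it is a skew derivation from [epstw], which is tau^-1 after [eps], to [eps]. *)
Lemma rc1M f g : rc1 (f * g) = epstw f * rc1 g + rc1 f * eps g.
Proof.
rewrite /= lcM_1 (tw'D h) // !(tw'M h) //.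
by rewrite (se_twK h).
Qed.

Lemma coverZ (M : lmodType R) (s : S) (m : restr eps M) :
  cover (restr eps M) (s *: delta S m) = (lc s 0 *: (m : M) : M).
Proof. by rewrite linearZZ coverE. Qed.

(* Elements of the kernel L have zero constant term modulo M, so their linear
   term is well defined modulo x L; reducing L modulo x exhibits M as a summand. *)
Lemma projective_of_pdle1 (M : lmodType R) :
  pdle 1 (restr eps M : lmodType S) -> projective M.
Proof.
move=> hM; pose M0 : lmodType S := restr eps M.
have se := short_exact_ker (@cover_surj _ M0).
have hL : projective (kerm (cover M0)) := pdle_syzygy se (@free_projective _ _) hM.
move=> N N' g f gs.
pose j := kerm_incl (cover M0); have ij : injective j by exact: kerm_incl_inj.
pose F := free_mod S M0.
pose psi (m : M0) : {additive S -> M} := free_lift_psi (fun m : M => m) m \o rc1.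
pose p1 : F -> M := fsum psi.
have p1D m m' : p1 (m + m') = p1 m + p1 m' by exact: raddfD.
have p1d s x : p1 (s *: delta S x) = rc1 s *: (x : M) by exact: fsumZdelta.
(* On the kernel of the cover the last term vanishes, so there [p1] is linear for the action of [S]
   through [epstw]. *)
have p1Z s m : p1 (s *: m) = epstw s *: p1 m + rc1 s *: (cover M0 m : M).
  elim/free_ind: m => [|m1 m2 e1 e2|t x].
  - by rewrite scaler0 linear0 [p1 0]raddf0 !scaler0 addr0.
  - by rewrite scalerDr !p1D e1 e2 linearD !scalerDr addrACA.
  - by rewrite scalerA !p1d coverZ rc1M scalerDl !scalerA.
have lth : linear (fun x : kerm (cover M0) => f (p1 (j x)) : restr epstw N').
  move=> s x y; rewrite restrZ linearP p1D p1Z mem_kerm scaler0 addr0.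
  by rewrite linearP.
have [t ht] := hL _ _ (restr_lin epstw g) (mklin lth) gs.
have u0 (m : M0) : cover M0 (b 1 *: delta S m) = 0.
  by rewrite coverZ lc_b //= scale0r.
pose U (m : M0) : kerm (cover M0) := mksub (submodule_ker (cover M0))
  (u0 m : [set x | cover M0 x = 0] _).
have jU m : j (U m) = b 1 *: delta S m by rewrite /j kerm_inclE.
have lU : linear (fun m : M => t (U m) : N).
  move=> a m m'.
  have e0 : cover M0 (delta S (a *: m + m' : M) - iota a *: delta S (m : M0)
                      - delta S (m' : M0)) = 0.
    rewrite !linearB /= !coverE linearZZ coverE restrZ epsE lc_iota eqxx.
    by rewrite addrAC addrK subrr.
  pose e : kerm (cover M0) := mksub (submodule_ker (cover M0))
    (e0 : [set x | cover M0 x = 0] _).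
  (* [U] fails to be linear by a multiple of x inside the kernel. Since x acts as 0 on
     [restr epstw N], [t] kills this defect, and [epstw] turns [tw 1 a] back into [a]. *)
  have je : b 1 *: e = U (a *: m + m' : M) - iota (tw 1 a) *: U m - U m'.
    apply: ij; rewrite !linearB !linearZZ !jU /j kerm_inclE /= !scalerBr.
    by rewrite !scalerN !scalerA (se_tw h).
  have := congr1 t je.
  rewrite linearZZ restrZ epstwE lc_b //= (tw'0 h) // scale0r !linearB linearZZ.
  rewrite restrZ epstwE lc_iota eqxx (se_twK h) => /esym/eqP.
  by rewrite -addrA -opprD subr_eq0 => /eqP.
exists (mklin lU) => m; have /= -> := ht (U m).
by rewrite jU p1d /= lc_b // eqxx (tw'1 h) // scale1r.
Qed.

Section ReductionExact.
Variable M : lmodType R.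
Let M0 : lmodType S := restr eps M.
Let L : lmodType S := kerm (cover M0).
Let K : lmodType R := kerm (cover M).

Lemma cover_eps (m : free_mod S M0) :
  cover M (free_map eps m : free_mod R M) = cover M0 m.
Proof.
elim/free_ind: m => [|m1 m2 e1 e2|t x].
- rewrite (_ : free_map _ 0 = 0) ?linear0 //.
  by apply: fcoef_inj => x; rewrite fcoef_free_map !fcoef0 raddf0.
- by rewrite free_mapD !linearD e1 e2.
- by rewrite free_map_delta linearZZ coverE coverZ.
Qed.

Lemma mulr_b1_zmod : zmod_morphism (fun s : S => s * b 1).
Proof. by move=> s t; rewrite mulrBl. Qed.
Definition mulr_b1 : {additive S -> S} :=
  HB.pack (fun s : S => s * b 1) (GRing.isZmodMorphism.Build S S _ mulr_b1_zmod).

Lemma mulr_b1_inj : injective mulr_b1.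
Proof.
move=> s t e; apply: (lc_ext (h := h)) => z; have /= := congr1 (fun f => lc f (z + 1)) e.
by rewrite !lc_bM_b // addrK.
Qed.

(** Right multiplication of coefficients by x is a left [S]-linear embedding of the free module in
    itself. Its image consists of the vectors with zero constant coefficients: it lies in [L]
    because x acts as 0 on [M], and it is the kernel of the reduction of [L] onto [K]. *)
Lemma reduction_exact :
  exists (i : {linear free_mod S M0 -> L}) (p : {linear L -> restr eps K}),
  short_exact i p.
Proof.
pose j : {linear L -> free_mod S M0} := kerm_incl (cover M0).
have ij : injective j by exact: kerm_incl_inj.
pose jK : {linear K -> free_mod R M} := kerm_incl (cover M).
have ijK : injective jK by exact: kerm_incl_inj.
have lb : linear (free_map mulr_b1 : free_mod S M0 -> free_mod S M0).
  move=> s m m'; apply: fcoef_inj => x.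
  by rewrite fcoefD fcoefZ !fcoef_free_map fcoefD fcoefZ /= mulrDl mulrA.
have eb (m : free_mod S M0) : free_map eps (free_map mulr_b1 m) = 0 :> free_mod R M.
  apply: fcoef_inj => x.
  by rewrite fcoef0 !fcoef_free_map /= lc_bM_b // lc_idx.
have [|i hi] := short_exact_lift (f := mklin lb) (short_exact_ker (@cover_surj _ M0)).
  by move=> m /=; rewrite -cover_eps eb linear0.
have pk (x : L) : cover M (free_map eps (j x) : free_mod R M) = 0.
  by rewrite cover_eps mem_kerm.
pose p (x : L) : K := mksub (submodule_ker (cover M)) (pk x : [set x | cover M x = 0] _).
have jp x : jK (p x) = free_map eps (j x) by rewrite /jK kerm_inclE.
have lp : linear (p : L -> restr eps K).
  move=> s x y; apply: ijK; rewrite restrZ linearP !jp linearP.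
  apply: fcoef_inj => z.
  by rewrite fcoefD fcoefZ !fcoef_free_map fcoefD fcoefZ raddfD /= lcM_0.
exists i, (mklin lp); split.
- move=> m m' e; apply: fcoef_inj => x; apply: mulr_b1_inj.
  have : j (i m) = j (i m') by rewrite e.
  by rewrite !hi => /(congr1 (fun m => fcoef m x)).
- move=> k; pose m : free_mod S M0 := free_map iota (jK k).
  have em : free_map eps m = jK k.
    by apply: fcoef_inj => x; rewrite !fcoef_free_map /= lc_iota eqxx.
  have m0 : cover M0 m = 0 by rewrite -cover_eps em mem_kerm.
  exists (mksub (submodule_ker (cover M0)) (m0 : [set x | cover M0 x = 0] _)).
  by apply: ijK; rewrite /= jp /j kerm_inclE /= em.
- move=> x; split=> [/(congr1 jK)|[m <-]].
    rewrite /= jp linear0 => e0.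
    have /choice[t ht] := shift_exists.
    have e (y : M0) : fcoef (j x) y = t (fcoef (j x) y) * b 1.
      rewrite {1}(ht (fcoef (j x) y)) -epsE -(fcoef_free_map eps) e0 fcoef0.
      by rewrite rmorph0 add0r.
    have ft : @finsupp_fun S M0 (fun y => t (fcoef (j x) y)).
      exists (fsupp (j x)) => y hy; apply: mulr_b1_inj.
      by rewrite /= -e fsuppP // mul0r.
    exists (mksub (@finsupp_funP S M0) ft); apply: ij; rewrite hi.
    by apply: fcoef_inj => y /=; rewrite fcoef_free_map /= [RHS]e.
  by apply: ijK; rewrite /= jp hi /= eb linear0.
Qed.

End ReductionExact.

(** The syzygy [L] of [M] over [S], divided by a free submodule, is the syzygy [K] of [M] over [R]
    with x acting as 0; so the bound for [L] passes to [K], and the induction hypothesis applies to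
    [K]. *)
Lemma pdle_of_eps d (M : lmodType R) :
  pdle d.+1 (restr eps M : lmodType S) -> pdle d M.
Proof.
elim: d M => [|d IH] M hM; first exact: projective_of_pdle1.
have hL := pdle_syzygy (short_exact_ker (@cover_surj _ (restr eps M)))
  (@free_projective _ _) hM.
have [i [p se]] := reduction_exact M.
exists (kerm (cover M)), (free_mod R M), (kerm_incl (cover M)), (cover M).
split; [exact: short_exact_ker (@cover_surj _ M)|exact: free_projective|].
by apply: IH; apply: pdle_quot_proj se (@free_projective _ _) hL.
Qed.

Lemma lgld_poly v : is_lgld R v -> is_lgld S (enat_addn v 1).
Proof.
case: v => [d|] /=.
  move=> /lgld_SomeP[h1 h2]; apply/lgld_SomeP; rewrite addn1; split.
    by move=> M; apply: (pdle_restr_S h).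
  case=> [/(not_all_projective h)//|e he]; rewrite ltnS.
  by apply: h2 => M; apply: pdle_of_eps.
move=> /lgld_NoneP hR; apply/lgld_NoneP => e he; apply: (hR e) => M.
by apply: (pdle_coind h).
Qed.

End Polynomial.

(** * Krull dimension *)

Lemma ole_weak (a : Ord) (Y : Type) (g : Y -> Ord) (j : Y) :
  ole a (g j) -> ole a (OSup g).
Proof.
elim: a Y g j => X f IH Y g j /= h i; exists j.
by case: (g j) h => Z k /(_ i)[y hy]; apply: (IH i Z k y).
Qed.

Lemma ole_refl a : ole a a.
Proof. by elim: a => X f IH /= i; exists i. Qed.

Lemma ole_trans a b c : ole a b -> ole b c -> ole a c.
Proof.
elim: a b c => X f IH [Y g] [Z k] /= ab bc i.
by have [j fg] := ab i; have [m gk] := bc j; exists m; apply: IH gk.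
Qed.

Lemma ole_or a b : ole a b \/ let: OSup X f := a in exists i : X, ole b (f i).
Proof.
elim: a b => X f IH [Y g] /=.
have [h|] := pselect (forall i, exists j, ole (f i) (g j)); first by left.
move=> /existsNP[i /forallNP hi]; right; exists i.
case E : (f i) => [Z k] j; have := IH i (g j); rewrite E; case=> // hj.
by case: (hi j); rewrite E.
Qed.

Lemma ole_total a b : ole a b \/ ole b a.
Proof.
have [|] := ole_or a b; first by left.
by case: a => X f [i hi]; right; apply: ole_weak hi.
Qed.

(** * Deviation of preordered sets *)

Section Deviation.
Variables (T : Type) (D : T -> Prop) (le : T -> T -> Prop).

(* Krull dimension of the interval between lo and hi in an arbitrary preorder. *)
Fixpoint dev_le (a : Ord) (lo hi : T) {struct a} : Prop :=
  let: OSup X f := a in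
  ~ exists c : nat -> T,
      [/\ c 0%N = hi,
          forall i : nat, D (c i),
          forall i : nat, le lo (c i.+1) /\ le (c i.+1) (c i)
        & forall i : nat, ~ (le (c i) (c i.+1) \/
            exists j : X, dev_le (f j) (c i.+1) (c i))].

Hypothesis le_refl : forall x, le x x.
Hypothesis le_tr : forall x y z, le x y -> le y z -> le x z.

Lemma dev_sub a lo hi lo' hi' : D hi -> le lo lo' -> le hi' hi ->
  dev_le a lo hi -> dev_le a lo' hi'.
Proof.
elim: a lo hi lo' hi' => X f IH lo hi lo' hi' Dhi ll hh hd [c [c0 Dc cl cb]].
apply: hd; exists (fun i => if i is 0%N then hi else c i); split=> //.
- by case.
- move=> i; have [l1 l2] := cl i; split; first exact: le_tr ll l1.
  case: i l2 {l1} => // l2; apply: le_tr l2 _.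
  by rewrite c0.
- case=> [|i]; last exact: cb.
  move=> [e|[j hj]]; apply: (cb 0%N).
    by left; apply: le_tr e; rewrite c0.
  by right; exists j; apply: (IH j _ _ _ _ Dhi _ _ hj); rewrite ?c0.
Qed.

Lemma dev_mono a a' lo hi : ole a a' -> dev_le a lo hi -> dev_le a' lo hi.
Proof.
elim: a a' lo hi => X f IH [Y g] lo hi /= h hd [c [c0 Dc cl cb]].
apply: hd; exists c; split=> // i [e|[j hj]]; apply: (cb i); first by left.
by right; have [k hk] := h j; exists k; apply: IH hj.
Qed.

Lemma dev_triv a lo hi : le hi lo -> dev_le a lo hi.
Proof.
case: a => X f hl [c [c0 Dc cl cb]]; apply: (cb 0%N); left.
by rewrite c0; apply: le_tr hl _; case: (cl 0%N).
Qed.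

Lemma chain_le (c : nat -> T) : (forall i, le (c i.+1) (c i)) ->
  forall m k, (m <= k)%N -> le (c k) (c m).
Proof.
move=> hc m k /subnKC <-; elim: (k - m)%N => [|n IH]; first by rewrite addn0.
by rewrite addnS; apply: le_tr IH.
Qed.

(** The definition yields one small factor; here all factors from some point on are small, since
    infinitely many bad factors could be gathered into a chain with no small factor. *)
Lemma dev_tail (X : Type) (f : X -> Ord) lo hi (c : nat -> T) :
  dev_le (OSup f) lo hi -> c 0%N = hi -> (forall i, D (c i)) ->
  (forall i, le lo (c i.+1) /\ le (c i.+1) (c i)) ->
  exists N, forall k, (N <= k)%N ->
    le (c k) (c k.+1) \/ exists j, dev_le (f j) (c k.+1) (c k).
Proof.
move=> hd c0 Dc cl; apply: contrapT => /forallNP hN.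
have /choice[nxt hnxt] : forall N, exists k, (N <= k)%N /\
    ~ (le (c k) (c k.+1) \/ exists j, dev_le (f j) (c k.+1) (c k)).
  move=> N; have /existsNP[k /not_implyP[Nk hk]] := hN N.
  by exists k.
(* [m n.+1] lies just past the bad index [nxt (m n)], so the factor of the subchain between them
   contains that bad factor. *)
pose m := fix m n := if n is n'.+1 then (nxt (m n')).+1 else 0%N.
have cdec i : le (c i.+1) (c i) by case: (cl i).
apply: hd; exists (fun i => c (m i)); split=> //.
- move=> i /=; split; first by case: (cl (nxt (m i))).
  by apply: chain_le => //; have [h _] := hnxt (m i); apply: leq_trans h _.
- move=> i /=; have [h1 h2] := hnxt (m i); move=> [e|[j hj]]; apply: h2.
    by left; apply: le_tr e; apply: chain_le.
  by right; exists j; apply: dev_sub hj => //; apply: chain_le.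
Qed.

End Deviation.

(** The third hypothesis is strictness: [phi] collapses no proper step, so a chain without small
    factors is carried to another such chain. *)
Lemma dev_map (T T' : Type) (D : T -> Prop) (D' : T' -> Prop)
    (le : T -> T -> Prop) (le' : T' -> T' -> Prop) (phi : T -> T') a lo hi :
  (forall x, D x -> D' (phi x)) ->
  (forall x y, D x -> D y -> le x y -> le' (phi x) (phi y)) ->
  (forall x y, D x -> D y -> le x y -> le' (phi y) (phi x) -> le y x) ->
  D lo -> dev_le D' le' a (phi lo) (phi hi) -> dev_le D le a lo hi.
Proof.
move=> hD hm hs; elim: a lo hi => X f IH lo hi Dlo hd [c [c0 Dc cl cb]].
apply: hd; exists (phi \o c); split=> [|i|i|i] /=.
- by rewrite c0.
- exact: hD.
- by have [l1 l2] := cl i; split; apply: hm.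
- have [l1 l2] := cl i; move=> [e|[j hj]]; apply: (cb i).
    by left; apply: hs e.
  by right; exists j; apply: IH.
Qed.

Definition prod_dom (T1 T2 : Type) (D1 : T1 -> Prop) (D2 : T2 -> Prop)
  (x : T1 * T2) : Prop := D1 x.1 /\ D2 x.2.

Definition prod_le (T1 T2 : Type) (le1 : T1 -> T1 -> Prop) (le2 : T2 -> T2 -> Prop)
  (x y : T1 * T2) : Prop := le1 x.1 y.1 /\ le2 x.2 y.2.

(** Past the tails of both component chains the two factors are small at the same time, and the
    larger of their two ordinals bounds both. *)
Lemma dev_prod (T1 T2 : Type) (D1 : T1 -> Prop) (D2 : T2 -> Prop)
    (le1 : T1 -> T1 -> Prop) (le2 : T2 -> T2 -> Prop) a lo hi :
  (forall x, le1 x x) -> (forall x y z, le1 x y -> le1 y z -> le1 x z) ->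
  (forall x, le2 x x) -> (forall x y z, le2 x y -> le2 y z -> le2 x z) ->
  dev_le D1 le1 a lo.1 hi.1 -> dev_le D2 le2 a lo.2 hi.2 ->
  dev_le (prod_dom D1 D2) (prod_le le1 le2) a lo hi.
Proof.
move=> r1 t1 r2 t2; elim: a lo hi => X f IH lo hi h1 h2 [c [c0 Dc cl cb]].
have [||i|N1 hN1] := dev_tail r1 t1 (c := fst \o c) h1.
- by rewrite /= c0.
- by move=> i; case: (Dc i).
- by have [[? _] [? _]] := cl i.
have [||i|N2 hN2] := dev_tail r2 t2 (c := snd \o c) h2.
- by rewrite /= c0.
- by move=> i; case: (Dc i).
- by have [[_ ?] [_ ?]] := cl i.
pose k := maxn N1 N2; apply: (cb k).
have g1 := hN1 k (leq_maxl _ _); have g2 := hN2 k (leq_maxr _ _).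
case: g1 => [e1|[j1 e1]]; case: g2 => [e2|[j2 e2]]; first by left.
- by right; exists j2; apply: IH => //; apply: dev_triv e1.
- by right; exists j1; apply: IH => //; apply: dev_triv e2.
- have [j12|j21] := ole_total (f j1) (f j2).
    by right; exists j2; apply: IH => //; apply: dev_mono e1.
  by right; exists j1; apply: IH => //; apply: dev_mono e2.
Qed.

Section Sequences.
Variables (T : Type) (D : T -> Prop) (le : T -> T -> Prop).
Hypothesis le_refl : forall x, le x x.
Hypothesis le_tr : forall x y z, le x y -> le y z -> le x z.

Definition seq_dom (s : nat -> T) : Prop :=
  (forall i, D (s i)) /\ exists N, forall m, (N <= m)%N -> s m = s N.

Definition seq_le (s t : nat -> T) : Prop := forall i, le (s i) (t i).

Lemma seq_le_refl s : seq_le s s. Proof. by move=> i. Qed.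
Lemma seq_le_tr s t u : seq_le s t -> seq_le t u -> seq_le s u.
Proof. by move=> st tu i; apply: le_tr (st i) (tu i). Qed.

(** A sequence is the pair of its first entry and its shift. Splitting off [N] entries in this way
    leaves an interval between constant sequences. *)
Lemma dev_seq_shift a N lo hi : seq_dom lo ->
  (forall i, dev_le D le a (lo i) (hi i)) ->
  (forall m, (N <= m)%N -> lo m = lo N) -> (forall m, (N <= m)%N -> hi m = hi N) ->
  dev_le seq_dom seq_le a (fun=> lo N) (fun=> hi N) ->
  dev_le seq_dom seq_le a lo hi.
Proof.
elim: N lo hi => [|N IH] lo hi Dlo hd hlo hhi hc.
  have -> : lo = fun=> lo 0%N by apply/funext => i; apply: hlo.
  by have -> : hi = fun=> hi 0%N by apply/funext => i; apply: hhi.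
pose phi (s : nat -> T) := (s 0%N, fun i => s i.+1).
have Dshift s : seq_dom s -> seq_dom (fun i => s i.+1).
  move=> [Ds [K hK]]; split=> //; exists K => m Km.
  by rewrite (hK m.+1 (leqW Km)) (hK K.+1 (leqnSn K)).
apply: (@dev_map _ _ _ (prod_dom D seq_dom) _ (prod_le le seq_le) phi) => //.
- by move=> s Ds; split; [case: Ds => Ds _; apply: (Ds 0%N)|exact: Dshift].
- by move=> s t _ _ st; split=> [|i]; apply: st.
- by move=> s t _ _ _ [e0 eS] [|i]; [exact: e0|exact: eS].
apply: dev_prod; [exact: le_refl|exact: le_tr|exact: seq_le_refl|exact: seq_le_tr
  |exact: hd|].
by apply: IH => //=; [exact: Dshift|move=> m; apply: (hlo m.+1)|move=> m; apply: (hhi m.+1)].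
Qed.

(* The eventual values of a chain of sequences form a chain in T; at a small
   factor of the latter, the factor of sequences is a finite product of intervals
   of T and of an interval of constant sequences handled by induction. *)
Lemma dev_seq a lo hi : D lo -> D hi -> dev_le D le a lo hi ->
  dev_le seq_dom seq_le (osucc a) (fun=> lo) (fun=> hi).
Proof.
elim: a lo hi => X f IH lo hi Dlo Dhi hd [c [c0 Dc cl cb]].
have /choice[lim hlim] : forall k, exists N, forall m, (N <= m)%N -> c k m = c k N.
  by move=> k; case: (Dc k).
pose u k := c k (lim k).
have uE k m : (lim k <= m)%N -> c k m = u k by apply: hlim.
have lh : le lo hi.
  have [/(_ 0%N) h1 /(_ 0%N) h2] := cl 0%N.
  by rewrite c0 in h2; apply: le_tr h1 h2.
have cle k i : le lo (c k i) /\ le (c k i) hi.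
  elim: k => [|k [_ h2]]; first by rewrite c0.
  by have [/(_ i) ? /(_ i) ?] := cl k; split=> //; apply: le_tr h2.
apply: (hd); exists u; split=> [|k|k|k].
- by rewrite /u c0.
- by rewrite /u; case: (Dc k) => Dk _; apply: Dk.
- have [_ h2] := cl k; split; first by case: (cle k.+1 (lim k.+1)).
  rewrite -(uE k.+1 (maxn (lim k) (lim k.+1))) ?leq_maxr //.
  by rewrite -(uE k (maxn (lim k) (lim k.+1))) ?leq_maxl.
move=> hk; apply: (cb k); right; exists tt.
pose N := maxn (lim k) (lim k.+1).
have N1 : (lim k <= N)%N by exact: leq_maxl.
have N2 : (lim k.+1 <= N)%N by exact: leq_maxr.
change (dev_le seq_dom seq_le (OSup f) (c k.+1) (c k)).
apply: (@dev_seq_shift _ N); first exact: Dc.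
- move=> i; have [h1 _] := cle k.+1 i; have [_ h2] := cle k i.
  exact: (dev_sub le_refl le_tr Dhi h1 h2 hd).
- by move=> m Nm; rewrite !uE // (leq_trans _ Nm).
- by move=> m Nm; rewrite !uE // (leq_trans _ Nm).
rewrite !uE //; case: hk => [e|[j hj]].
  by apply: dev_triv => //; exact: seq_le_tr.
apply: (dev_mono (a := osucc (f j))).
  by move=> []; exists j; apply: ole_refl.
by apply: IH => //; rewrite /u; [case: (Dc k.+1) => Dk _|case: (Dc k) => Dk _]; apply: Dk.
Qed.

End Sequences.

(** * Krull dimension of modules as a deviation *)

Section KrullDimension.
Variables (R : nzRingType) (M : lmodType R).
Implicit Types lo hi : set M.

Lemma kdim_leE a lo hi :
  kdim_le a lo hi = dev_le (@submodule R M) (fun A B => A `<=` B) a lo hi.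
Proof.
elim: a lo hi => X f IH lo hi; apply/propext.
have IHf j A B : kdim_le (f j) A B <->
    dev_le (@submodule R M) (fun A B => A `<=` B) (f j) A B by rewrite IH.
split=> hN [c [c0 Dc cl cb]]; apply: hN; exists c; split=> // i [e|[j hj]].
- by apply: (cb i); left.
- by apply: (cb i); right; exists j; exact: (proj1 (IHf _ _ _) hj).
- by apply: (cb i); left.
- by apply: (cb i); right; exists j; exact: (proj2 (IHf _ _ _) hj).
Qed.

Lemma kdim_le_mono a a' lo hi : ole a a' -> kdim_le a lo hi -> kdim_le a' lo hi.
Proof. by rewrite !kdim_leE; exact: dev_mono. Qed.

Lemma kdim_min a lo hi : ~ hi `<=` lo -> kdim_le a lo hi ->
  exists a', ~ kdim_lt a' lo hi /\ kdim_le a' lo hi.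
Proof.
move=> hl; elim: a => X f IH hf.
have [[j hj]|hN] := pselect (exists j, kdim_le (f j) lo hi); first exact: IH hj.
by exists (OSup f); split=> // -[].
Qed.

Lemma kdim_least a a' lo hi : ~ kdim_lt a lo hi -> kdim_le a' lo hi -> ole a a'.
Proof.
move=> hl ha'; have [//|] := ole_or a a'.
case: a hl => X f hl [i hi']; case: hl; right; exists i.
exact: kdim_le_mono ha'.
Qed.

(** Noetherian induction on [lo]. If every [lo'] strictly above [lo] has a bound for M / lo', the
    strict supremum of these bounds serves for M / lo: the first factor of a chain is M / c 1, and
    if [c 1] equals [lo] the next step is trivial. *)
Lemma noetherian_kdim_exists : noetherian_module M ->
  exists a, kdim_le a [set 0] [set: M].
Proof.
move=> hM; apply: contrapT => h0.
pose bad lo := submodule lo /\ ~ exists a, kdim_le a lo [set: M].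
have step lo : bad lo -> exists lo', [/\ bad lo', lo `<=` lo' & ~ lo' `<=` lo].
  move=> [slo nlo]; apply: contrapT => hN; apply: nlo.
  pose X := {lo' : set M | [/\ submodule lo', lo `<=` lo' & ~ lo' `<=` lo]}.
  have /choice[f hf] : forall x : X, exists a, kdim_le a (sval x) [set: M].
    move=> [lo' [s1 s2 s3]] /=; apply: contrapT => s4.
    by apply: hN; exists lo'; split.
  exists (OSup f) => -[c [c0 Dc cl cb]].
  have [hc|hc] := pselect (c 1%N `<=` lo).
    by apply: (cb 1%N); left; apply: subset_trans hc _; case: (cl 1%N).
  have [l1 _] := cl 0%N.
  apply: (cb 0%N); right.
  have := hf (exist _ (c 1%N) (And3 (Dc 1%N) l1 hc)); rewrite -c0.
  by eexists; eassumption.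
have bad0 : bad [set 0].
  by split=> //; split=> // a u v -> ->; rewrite scaler0 addr0.
have /choice[nxt hnxt] : forall x : {lo | bad lo}, exists y : {lo | bad lo},
    sval x `<=` sval y /\ ~ sval y `<=` sval x.
  by move=> [lo blo]; have [lo' [b1 b2 b3]] := step lo blo; exists (exist _ lo' b1).
pose ch n := iter n nxt (exist _ _ bad0).
have [|i|N hN] := hM (fun n => sval (ch n)).
- by move=> i; case: (svalP (ch i)).
- by case: (hnxt (ch i)).
have [_] := hnxt (ch N); apply.
by have /= -> := hN N.+1 (leqnSn N).
Qed.

End KrullDimension.

Lemma ring_setT_not0 (R : nzRingType) : ~ ([set: R^o] `<=` [set 0]).
Proof. by move=> /(_ 1 I) /eqP; rewrite oner_eq0. Qed.

Lemma submodule_set0 (R : nzRingType) (M : lmodType R) : submodule ([set 0] : set M).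
Proof. by split=> // a u v -> ->; rewrite scaler0 addr0. Qed.

Lemma noetherian_lKdim_exists (R : nzRingType) : left_noetherian R ->
  exists a, is_lKdim R a.
Proof.
move=> /noetherian_kdim_exists[a ha].
have [a' [h1 h2]] := kdim_min (@ring_setT_not0 R) ha.
by exists a'.
Qed.

(** * Leading coefficients, Hilbert's basis theorem and Krull bounds *)

Section KrullStep.
Variables (l : bool) (R S : nzRingType) (iota : {rmorphism R -> S}).
Variables (b : int -> S) (tw tw' : int -> R -> R).
Hypothesis h : skew_ext l iota b tw tw'.
Notation lc := (lc h).
Let i0 : idx l 0 := idx_nat l 0.
Let i1 : idx l 1 := idx_nat l 1.

(** The coefficient of x^z written on the right of x^z. Left multiplication by x only shifts these
    coefficients, which makes [lead I] ascending without a twist. *)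
Definition rc (f : S) (z : int) : R := tw' z (lc f z).

Lemma tw_add z w a : idx l z -> idx l w -> tw (z + w) a = tw z (tw w a).
Proof.
move=> hz hw; rewrite (tw_lc h) ?idxD // (se_bD h) // -mulrA (se_tw h) //.
by rewrite mulrA (se_tw h) // -mulrA -(se_bD h) // lc_mono ?idxD // eqxx.
Qed.

Lemma tw'_add z w a : idx l z -> idx l w -> tw' (z + w) (tw z a) = tw' w a.
Proof.
by move=> hz hw; rewrite -{1}[a](se_tw'K h w) -tw_add // (se_twK h).
Qed.

Definition supp_below (n : nat) (f : S) : Prop :=
  forall z : int, (z < 0) || (n%:Z <= z) -> lc f z = 0.

Definition lead (I : set S^o) (n : nat) : set R^o :=
  [set a | exists f, [/\ I f, supp_below n.+1 f & rc f n = a]].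

Lemma lead_submodule I n : submodule I -> submodule (lead I n).
Proof.
move=> sI; split.
  exists 0; split; [by case: sI|by move=> z _; rewrite lc0|].
  by rewrite /rc lc0 (tw'0 h) ?idx_nat.
move=> a u v [f [If sf <-]] [g [Ig sg <-]].
exists (iota (tw n a) * f + g); split.
- by case: sI => _; apply.
- by move=> z hz; rewrite lcD lcZ sf // sg // mulr0 addr0.
- rewrite /rc lcD lcZ (tw'D h) ?idx_nat // (tw'M h) ?idx_nat //.
  by rewrite (se_twK h).
Qed.

Lemma lead_ascending I n : submodule I -> lead I n `<=` lead I n.+1.
Proof.
move=> sI a [f [If sf <-]]; exists (b 1 * f); split.
- exact: (submoduleZ (b 1) sI If).
- move=> z hz; rewrite lc_bM // sf ?(tw0 h) //; case/orP: hz => hz.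
    by rewrite subr_lt0 (lt_trans hz).
  by rewrite orbC lerBrDr -PoszD addn1 hz.
- rewrite /rc lc_bM // -addn1 PoszD addrK [_ + 1]addrC.
  by rewrite tw'_add ?idx_nat.
Qed.

Lemma lead_mono (I J : set S^o) n : I `<=` J -> lead I n `<=` lead J n.
Proof. by move=> IJ a [f [/IJ Jf sf e]]; exists f. Qed.

Lemma b_neg (k : nat) : l -> b (- k%:Z) * b k%:Z = 1.
Proof. by move=> hl; rewrite -(se_bD h) ?addNr ?(se_b0 h) // /idx /= hl. Qed.

(** In the Laurent case a power of the unit x clears all negative exponents, so the nonnegative
    exponents seen by [lead] determine a left ideal; in the polynomial case k = 0 does. *)
Lemma nonneg_shift f : exists (u : S) (k : nat), u * b k = 1 /\
  forall z : int, (z < 0) -> lc (b k * f) z = 0.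
Proof.
have /orP[hl|hl] := orbN l; last first.
  exists 1, 0%N; split=> [|z hz]; first by rewrite (se_b0 h) mulr1.
  by apply: lc_idx; rewrite /idx /= (negPf hl) /= -ltNge.
pose k := \max_(z <- lsup h f) `|z|%N.
exists (b (- k%:Z)), k; split=> [|z hz]; first exact: b_neg.
rewrite lc_bM ?idx_nat // lc_notin ?(tw0 h) ?idx_nat //.
apply/negP => zf; have : (`|z - k%:Z| <= k)%N.
  exact: (@leq_bigmax_seq _ _ predT (fun z : int => `|z|%N)).
by apply/negP; rewrite -ltnNge; case: z hz zf => // m _ _; lia.
Qed.

Lemma supp_below_shift f : exists (u : S) (k n : nat), u * b k = 1 /\
  supp_below n (b k * f).
Proof.
have [u [k [uk hk]]] := nonneg_shift f; have [N hN] := lc_bound h (b k * f).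
exists u, k, N.+1; split=> // z /orP[/hk//|hz]; apply: hN.
by apply: lt_le_trans hz; rewrite ltz_nat.
Qed.

(** An element of [J], shifted to nonnegative exponents, loses its top term on subtracting an
    element of [I] with the same leading coefficient; induction on the degree bound. *)
Lemma lead_strict (I J : set S^o) : submodule I -> submodule J -> I `<=` J ->
  (forall n, lead J n `<=` lead I n) -> J `<=` I.
Proof.
move=> sI sJ IJ hl.
have key n g : J g -> supp_below n g -> I g.
  elim: n g => [|n IH] g Jg sg.
    have -> : g = 0.
      by apply: (lc_ext (h := h)) => z; rewrite lc0 sg //; case: ltP.
    by case: sI.
  have [f [If sf ef]] : lead I n (rc g n) by apply: hl; exists g.
  have Igf : I (g - f).
    apply: IH; first by apply: submoduleB => //; apply: IJ.
    move=> z; rewrite lcB; have [->|zn] := eqVneq z n.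
      by move=> _; rewrite (can_inj (se_tw'K h n) ef) subrr.
    move=> hz; have hz' : (z < 0) || (n.+1%:Z <= z).
      by case/orP: hz => [->//|hz]; apply/orP; right; lia.
    by rewrite sg // sf // subrr.
  by rewrite -[g](subrK f); apply: submoduleD.
move=> f Jf; have [u [k [n [uk hn]]]] := supp_below_shift f.
have : I (b k * f) by apply: key hn; apply: (submoduleZ (b k) sJ Jf).
move=> /(submoduleZ u sI); rewrite /GRing.scale /= mulrA uk mul1r.
by [].
Qed.

Lemma chain_sub (T : Type) (c : nat -> set T) : (forall i, c i `<=` c i.+1) ->
  forall m n, (m <= n)%N -> c m `<=` c n.
Proof.
move=> hc m n /subnKC <-; elim: (n - m)%N => [|k IH]; first by rewrite addn0.
by rewrite addnS; apply: subset_trans IH (hc _).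
Qed.

Section Noetherian.
Hypothesis hR : left_noetherian R.

Lemma lead_seq_dom I : submodule I -> seq_dom (@submodule R R^o) (lead I).
Proof.
move=> sI; split=> [i|]; first exact: lead_submodule.
apply: hR => i; first exact: lead_submodule.
exact: lead_ascending.
Qed.

(** The diagonal chain [lead (c n) n] is constant from [N] on, which settles all degrees at least
    [N] at once; the finitely many degrees below [N] each have their own bound [K n]. *)
Lemma noetherian_step : left_noetherian S.
Proof.
move=> c sc cc; have clm := chain_sub cc.
have lm i j n m : (i <= j)%N -> (n <= m)%N -> lead (c i) n `<=` lead (c j) m.
  move=> ij nm; apply: (subset_trans (lead_mono (n := n) (clm _ _ ij))).
  by apply: (chain_sub (c := lead (c j))) nm => k; apply: lead_ascending.
have [|i|N hN] := hR (c := fun n => lead (c n) n).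
- by move=> i; apply: lead_submodule.
- by apply: lm.
have /choice[K hK] : forall n, exists K, forall m, (K <= m)%N ->
    lead (c m) n = lead (c K) n.
  move=> n; apply: (hR (c := fun m => lead (c m) n)) => i.
    exact: lead_submodule.
  exact: lm.
pose K0 := maxn N (\max_(n < N) K n).
exists K0 => m hm; apply/seteqP; split; last exact: clm.
apply: lead_strict => //; first exact: clm.
move=> n; have [nN|Nn] := ltnP n N.
  have kn : (K n <= K0)%N.
    by apply: leq_trans (leq_maxr _ _); apply: (leq_bigmax (Ordinal nN)).
  by rewrite hK ?(leq_trans kn) // -(hK n K0).
have NK : (N <= K0)%N by exact: leq_maxl.
apply: (subset_trans (lm m (maxn m n) n (maxn m n) (leq_maxl _ _) (leq_maxr _ _))).
rewrite (hN (maxn m n)) ?(leq_trans Nn (leq_maxr _ _)) //.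
exact: lm.
Qed.

Lemma kdim_upper a : kdim_le a [set 0] [set: R^o] ->
  kdim_le (osucc a) [set 0] [set: S^o].
Proof.
rewrite !kdim_leE => ha.
apply: (@dev_map _ _ _ (seq_dom (@submodule R R^o)) _
  (seq_le (fun A B : set R^o => A `<=` B)) lead).
- exact: lead_seq_dom.
- by move=> I J _ _ IJ n; apply: lead_mono.
- by move=> I J sI sJ IJ hl; apply: lead_strict.
- exact: submodule_set0.
have -> : lead [set 0] = fun=> [set 0].
  apply/funext => n; apply/seteqP; split=> [a' [f [-> _ <-]]|_ ->].
    by rewrite /rc lc0 (tw'0 h) ?idx_nat.
  by exists 0; split=> // [z _|]; rewrite ?lc0 // /rc lc0 (tw'0 h) ?idx_nat.
have -> : lead [set: S^o] = fun=> [set: R^o].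
  apply/funext => n; apply/seteqP; split=> // a' _.
  exists (iota (tw n a') * b n); split=> // [z hz|]; last first.
    by rewrite /rc lc_mono ?idx_nat // eqxx (se_twK h).
  by rewrite lc_mono ?idx_nat //; case: eqP hz => // ->; rewrite lez_nat ltnn.
apply: dev_seq => //; last exact: submodule_set0.
  by move=> A.
by move=> A B C; apply: subset_trans.
Qed.

End Noetherian.

(** The extended left ideal S J, described by right coefficients; [J] is recovered as the constants
    it contains. *)
Definition ext_ideal (J : set R^o) : set S^o :=
  [set f | forall z, idx l z -> J (rc f z)].

Lemma ext_ideal_submodule J : submodule J -> submodule (ext_ideal J).
Proof.
move=> sJ; have [J0 _] := sJ.
have add f g : ext_ideal J f -> ext_ideal J g -> ext_ideal J (f + g).
  move=> Jf Jg z hz; rewrite /rc lcD (tw'D h) //.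
  exact: (submoduleD sJ (Jf z hz) (Jg z hz)).
have E0 : ext_ideal J 0 by move=> z hz; rewrite /rc lc0 (tw'0 h).
split=> // s f g Jf Jg; apply: (add (s * f) g) => //.
elim/(se_ind h): s => [|s t hs ht|a w hw].
- by rewrite mul0r.
- by rewrite mulrDl; apply: add.
- move=> z hz; rewrite /rc -mulrA lcZ lc_bM //.
  have [hzw|hzw] := boolP (idx l (z - w)).
    have ez : z = w + (z - w) by rewrite addrC subrK.
    have e : tw' z (tw w (lc f (z - w))) = rc f (z - w) by rewrite {1}ez tw'_add.
    rewrite (tw'M h) // e; exact: (submoduleZ (tw' z a) sJ (Jf _ hzw)).
  by rewrite lc_idx // (tw0 h) // mulr0 (tw'0 h).
Qed.

Lemma kdim_lower a : kdim_le a [set 0] [set: S^o] -> kdim_le a [set 0] [set: R^o].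
Proof.
rewrite !kdim_leE => ha.
apply: (@dev_map _ _ _ (@submodule S S^o) _ (fun A B => A `<=` B) ext_ideal).
- exact: ext_ideal_submodule.
- by move=> I J _ _ IJ f hf z hz; apply: IJ; apply: hf.
- move=> I J [I0 _] [J0 _] _ hl a' Ja; have : ext_ideal I (iota a').
    apply: hl => z hz; rewrite /rc lc_iota; case: eqP => [->|_].
      by rewrite (tw'_0 h).
    by rewrite (tw'0 h).
  by move=> /(_ 0 i0); rewrite /rc lc_iota eqxx (tw'_0 h).
- exact: submodule_set0.
have -> : ext_ideal [set 0] = [set 0].
  apply/seteqP; split=> [f hf|_ -> z hz]; last by rewrite /rc lc0 (tw'0 h).
  apply: (lc_ext (h := h)) => z; rewrite lc0.
  have [hz|] := boolP (idx l z); last exact: lc_idx.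
  by apply: (can_inj (se_tw'K h z)); rewrite (tw'0 h) //; apply: hf.
have -> // : ext_ideal [set: R^o] = [set: S^o] by apply/seteqP; split.
Qed.

(** The top coefficient of a product is the product of the top coefficients, the second one twisted
    by an injective power of tau. *)
Lemma domain_step : domain_ring R -> domain_ring S.
Proof.
move=> dR.
have top f : f <> 0 -> exists z, [/\ idx l z, lc f z <> 0 &
    forall w, (z < w) -> lc f w = 0].
  move=> f0; have [N hN] := lc_bound h f.
  have [n [hn1 hn2]] : exists n, lc f (N%:Z - n%:Z) <> 0 /\
      forall m, lc f (N%:Z - m%:Z) <> 0 -> (n <= m)%N.
    apply: (least_nat (P := fun n => lc f (N%:Z - n%:Z) <> 0)).
    apply: contrapT => hN0; apply: f0; apply: (lc_ext (h := h)) => z; rewrite lc0.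
    have [/hN//|zN] := ltP N%:Z z.
    apply: contrapT => fz; apply: hN0; exists `|N%:Z - z|%N.
    by rewrite gez0_abs ?subr_ge0 // subKr.
  exists (N%:Z - n%:Z); split=> //.
    by apply/negPn/negP => /(lc_idx h f).
  move=> w hw; have [/hN//|wN] := ltP N%:Z w.
  apply: contrapT => fw.
  have /hn2 : lc f (N%:Z - `|N%:Z - w|%N%:Z) <> 0.
    by rewrite gez0_abs ?subr_ge0 // subKr.
  by rewrite leqNgt => /negP; apply; lia.
move=> f g fg0; have [->|/eqP/top[z [hz fz fw]]] := eqVneq f 0; first by left.
have [->|/eqP/top[y [hy gy gw]]] := eqVneq g 0; first by right.
have : lc (f * g) (z + y) = lc f z * tw z (lc g (z + y - z)).
  apply: lcM1 => // w hw; rewrite neq_lt => /orP[wz|/fw ->]; last by left.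
  by right; apply: gw; rewrite ltrBrDr addrC ltrD2r.
rewrite fg0 lc0 addrAC subrr add0r => /esym/dR[//|e].
by case: gy; apply: (can_inj (se_twK h z)); rewrite e (tw0 h).
Qed.

End KrullStep.

Section KrullPolynomial.
Variables (R S : nzRingType) (iota : {rmorphism R -> S}).
Variables (b : int -> S) (tw tw' : int -> R -> R).
Hypothesis h : skew_ext false iota b tw tw'.
Notation lc := (lc h).

(** As [J] varies from 0 to [R], a copy of the left ideals of [R] between S x^(n+1) and S x^n. *)
Definition low_ideal (n : nat) (J : set R^o) : set S^o :=
  [set f | (forall z : int, z < n%:Z -> lc f z = 0) /\ J (rc h f n)].

Lemma low_ideal_submodule n J : submodule J -> submodule (low_ideal n J).
Proof.
move=> sJ; have [J0 _] := sJ.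
have add f g : low_ideal n J f -> low_ideal n J g -> low_ideal n J (f + g).
  move=> [f1 f2] [g1 g2]; split=> [z hz|].
    by rewrite lcD f1 // g1 // addr0.
  by rewrite /rc lcD (tw'D h) //; apply: (submoduleD sJ f2 g2).
have E0 : low_ideal n J 0.
  by split=> [z _|]; rewrite ?lc0 // /rc lc0 (tw'0 h).
split=> // s f g Jf Jg; apply: (add (s * f) g) => //.
have [f1 f2] := Jf.
elim/(se_ind h): s => [|s t hs ht|a w hw].
- by rewrite mul0r.
- by rewrite mulrDl; apply: add.
rewrite -mulrA; split=> [z hz|].
  rewrite lcZ lc_bM // f1 ?(tw0 h) ?mulr0 //.
  by apply: le_lt_trans hz; rewrite gerBl.
rewrite /rc lcZ lc_bM // (tw'M h) //; have [->|w0] := eqVneq w 0.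
  by rewrite subr0 (tw_0 h); apply: (submoduleZ _ sJ).
rewrite f1 ?(tw0 h) ?(tw'0 h) ?mulr0 //.
by rewrite ltrBlDr ltrDl lt_def w0.
Qed.

Lemma kdim_poly a : is_lKdim R a -> left_noetherian R -> is_lKdim S (osucc a).
Proof.
move=> [hlt hle] hR; split; last exact: (kdim_upper h).
move=> [/ring_setT_not0//|[_]].
rewrite kdim_leE /=.
case: a hlt {hle} => X f hlt /= hd; apply: hlt; right.
have E0 n : low_ideal n [set 0] = low_ideal n.+1 setT.
  apply/seteqP; split=> g [g1 g2]; split=> //.
    move=> z hz; have [/g1//|nz] := ltP z n%:Z.
    have -> : z = n by lia.
    by apply: (can_inj (se_tw'K h n)); rewrite (tw'0 h) //; apply: g2.
  by move=> z hz; apply: g1; apply: lt_trans hz _; rewrite ltz_nat.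
  by rewrite /= /rc g1 ?ltz_nat // (tw'0 h).
apply: contrapT => hN; apply: hd; exists (fun n => low_ideal n setT); split.
- apply/seteqP; split=> // g _; split=> // z hz; apply: lc_idx.
  by rewrite /idx /= -ltNge.
- by move=> n; apply: low_ideal_submodule.
- move=> n; split.
    move=> _ ->; split=> // z _; exact: lc0.
  by rewrite -E0 => g [g1 g2]; split.
- move=> n; rewrite -E0; move=> [e|[j hj]].
    have : low_ideal n [set 0] (b n).
      apply: e; split=> // z hz; rewrite lc_b //.
      by case: eqP hz => // ->; rewrite ltxx.
    by case=> _; rewrite /= /rc lc_b // eqxx (tw'1 h) // => /eqP; rewrite oner_eq0.
  apply: hN; exists j; rewrite kdim_leE.
  apply: (@dev_map _ _ _ (@submodule S S^o) _ (fun A B => A `<=` B) (low_ideal n)).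
  + exact: low_ideal_submodule.
  + by move=> I J _ _ IJ g [g1 g2]; split=> //; apply: IJ.
  + move=> I J _ _ _ hl a' Ja; have : low_ideal n I (iota (tw n a') * b n).
      apply: hl; split=> [z hz|]; rewrite /rc lc_mono //.
        by case: eqP hz => // ->; rewrite ltxx.
      by rewrite eqxx (se_twK h).
    by case=> _; rewrite /rc lc_mono // eqxx (se_twK h).
  + exact: submodule_set0.
  + exact: hj.
Qed.

End KrullPolynomial.

Lemma kdim_step (l : bool) (R S : nzRingType) (iota : {rmorphism R -> S})
    (b : int -> S) (tw tw' : int -> R -> R) (a c : Ord) :
  skew_ext l iota b tw tw' -> left_noetherian R -> is_lKdim R a -> is_lKdim S c ->
  ole a c /\ ole c (osucc a).
Proof.
move=> h hR [a1 a2] [c1 c2]; split.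
  by apply: kdim_least a1 _; apply: (kdim_lower h).
by apply: kdim_least c1 _; apply: (kdim_upper h).
Qed.

Lemma lKdim_field (k : fieldType) : is_lKdim k ozero.
Proof.
split; first by move=> [/ring_setT_not0|[[]]].
rewrite kdim_leE => -[c [c0 Dc cl cb]].
apply: (cb 1%N); left => x c1x.
have [x0|x0] := eqVneq x 0; first by rewrite x0; case: (Dc 2%N).
exfalso; apply: (cb 0%N); left => y _.
have := submoduleZ ((y : k) / x) (Dc 1%N) c1x.
by rewrite /GRing.scale /= mulfVK.
Qed.

Lemma noetherian_field (k : fieldType) : left_noetherian k.
Proof.
move=> c sc cc; have clm := chain_sub cc.
have [[n [x [cx x0]]]|hN] := pselect (exists n x, c n x /\ x <> 0).
  exists n => m nm; apply/seteqP; split; last exact: clm.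
  move=> y _; have := submoduleZ ((y : k) / x) (sc n) cx.
  by rewrite /GRing.scale /= mulfVK //; apply/eqP.
have c0 n : c n = [set 0].
  apply/seteqP; split=> [x cx|_ ->]; last by case: (sc n).
  by apply: contrapT => x0; apply: hN; exists n, x.
by exists 0%N => m _; rewrite !c0.
Qed.

(** * Krull dimension one over a field *)

Section LaurentNotArtinian.
Variables (l : bool) (k : fieldType) (S : nzRingType) (iota : {rmorphism k -> S}).
Variables (b : int -> S) (tw tw' : int -> k -> k).
Hypothesis h : skew_ext l iota b tw tw'.

(** The sum of the coefficients vanishes on S(1 - x) and is 1 at 1. *)
Lemma one_sub_x_not_unit (g : S) : g * (1 - b 1) <> 1.
Proof.
pose u : {linear free_mod k int -> k^o} := free_lift (fun=> 1 : k^o).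
pose phi (s : S) : k := u (lcoefs h s).
have phiD s t : phi (s + t) = phi s + phi t by rewrite /phi raddfD linearD.
have phi_mono a z : idx l z -> phi (iota a * b z) = a.
  move=> hz; rewrite /phi lcoefsZ lcoefs_b // linearZZ.
  by rewrite /u free_lift_delta [LHS]mulr1.
have phi0 : phi 0 = 0 by rewrite /phi raddf0 linear0.
have phix s : phi (s * (1 - b 1)) = 0.
  elim/(se_ind h): s => [|s t e1 e2|a z hz].
  - by rewrite mul0r.
  - by rewrite mulrDl phiD e1 e2 addr0.
  - rewrite mulrBr mulr1 -mulrA -(se_bD h) ?(idx_nat l 1) // -mulNr -rmorphN phiD.
    by rewrite !phi_mono ?idxD ?(idx_nat l 1) // subrr.
move=> /(congr1 phi); rewrite phix.
rewrite -[1](se_b0 h) -[b 0]mul1r -(rmorph1 iota) phi_mono ?(idx_nat l 0) //.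
by move=> /esym/eqP; rewrite oner_eq0.
Qed.

(** The left ideals S (1 - x)^n descend strictly: in a domain, equality of two consecutive ones
    would give 1 - x a left inverse. Powers of x would not do, as x may be a unit. *)
Lemma laurent_field_kdim : is_lKdim S (osucc ozero).
Proof.
split; last first.
  apply: (kdim_upper h); first exact: noetherian_field.
  by case: (lKdim_field k).
have dS : domain_ring S.
  apply: (domain_step h) => x y /eqP; rewrite mulf_eq0 => /orP[]/eqP ->; by [left|right].
have hN0 : 1 - b 1 <> 0.
  move=> /(congr1 (fun f => lc h f 0)); rewrite -(se_b0 h) lcB lc0.
  rewrite !lc_b ?(idx_nat l 0) ?(idx_nat l 1) //= subr0 => /eqP.
  by rewrite oner_eq0.
move=> [/ring_setT_not0//|[_]]; rewrite kdim_leE /=; apply.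
pose t := 1 - b 1.
exists (fun n => [set f : S^o | exists g : S, f = g * t ^+ n]); split.
- by apply/seteqP; split=> // f _; exists f; rewrite expr0 mulr1.
- move=> n; split; first by exists 0; rewrite mul0r.
  move=> a u v [f ->] [g ->]; exists (a * f + g).
  by rewrite mulrDl -mulrA.
- move=> n; split=> [_ ->|_ [g ->]]; first by exists 0; rewrite mul0r.
  by exists (g * t); rewrite exprS mulrA.
- move=> n [e|[[]]].
  have [|g] := e (t ^+ n); first by exists 1; rewrite mul1r.
  have tn m : t ^+ m <> 0.
    elim: m => [|m IH]; first by rewrite expr0; apply/eqP; exact: oner_neq0.
    by rewrite exprS => /dS[].
  rewrite exprS mulrA -[LHS]mul1r => /eqP; rewrite -subr_eq0 -mulrBl => /eqP/dS[|/tn//].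
  by move=> /eqP; rewrite subr_eq0 => /eqP/esym; apply: one_sub_x_not_unit.
Qed.

End LaurentNotArtinian.

(** * Noetherian domains are uniform *)

Section Goldie.
Variable R : nzRingType.
Hypotheses (hR : left_noetherian R) (dR : domain_ring R).

(* If R a and R b met in 0, the sum of the R a b^i would be direct and infinite. *)
Lemma noetherian_domain_ore (x y : R) : x <> 0 -> y <> 0 ->
  exists u v, u * x = v * y /\ u * x <> 0.
Proof.
move=> x0 y0; apply: contrapT => hN.
have dis u v : u * x = v * y -> u * x = 0.
  by move=> e; apply: contrapT => e0; apply: hN; exists u, v.
pose c n : set R^o := [set f | exists g : nat -> R, f = \sum_(i < n) g i * (x * y ^+ i)].
have [|n|N hN'] := hR (c := c).
- move=> n; split; first by exists (fun=> 0); rewrite big1 // => i _; rewrite mul0r.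
  move=> a u v [g ->] [g' ->]; exists (fun i => a * g i + g' i).
  rewrite /GRing.scale /= mulr_sumr -big_split /=; apply: eq_bigr => i _.
  by rewrite mulrDl !mulrA.
- move=> f [g ->]; exists (fun i => if (i < n)%N then g i else 0).
  rewrite big_ord_recr /= ltnn mul0r addr0.
  by apply: eq_bigr => i _; rewrite ltn_ord.
have cN : c N.+1 (x * y ^+ N).
  exists (fun i => if i == N then 1 else 0).
  rewrite big_ord_recr /= eqxx mul1r big1 ?add0r // => i _.
  by rewrite ltn_eqF ?mul0r.
rewrite hN' // in cN; have [g eg] := cN.
have yn m : y ^+ m <> 0.
  elim: m => [|m IH]; first by rewrite expr0; apply/eqP; exact: oner_neq0.
  by rewrite exprS => /dR[].
have cancel m (p q : R) : p * y ^+ m = q * y ^+ m -> p = q.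
  move=> /eqP; rewrite -subr_eq0 -mulrBl => /eqP/dR[/eqP|/yn//].
  by rewrite subr_eq0 => /eqP.
(* In such an expression of x y^m the term of index 0 lies in both R x and R y, so it vanishes;
   cancelling [y] on the right lowers m, down to x = 0. *)
have key (m : nat) : forall (j : nat) (g : nat -> R), (j + m = N)%N ->
    x * y ^+ m = \sum_(i < m) g i * (x * y ^+ i) -> False.
  elim: m => [|m IH] j g' jm.
    by rewrite big_ord0 expr0 mulr1.
  rewrite big_ord_recl /= expr0 mulr1.
  under eq_bigr => i _ do rewrite /bump /= add1n exprSr !mulrA.
  rewrite -mulr_suml exprSr mulrA => e.
  have e' : g' 0%N * x = (x * y ^+ m - \sum_(i < m) g' i.+1 * x * y ^+ i) * y.
    by rewrite mulrBl e addrK.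
  have g0 := dis _ _ e'; move: e; rewrite g0 add0r => /(cancel 1%N).
  move=> e; apply: (IH j.+1 (fun i => g' i.+1)); first by rewrite addSnnS.
  by rewrite e; apply: eq_bigr => i _; rewrite mulrA.
exact: (key N 0%N g).
Qed.

Lemma noetherian_domain_ludim : is_ludim R 1.
Proof.
exists (fun=> setT); split.
- move=> _; split=> //; first by exists 1; split=> //; apply/eqP; exact: oner_neq0.
  move=> A B sA sB _ _ [x [Ax x0]] [y [By y0]].
  have [u [v [e ne]]] := noetherian_domain_ore x0 y0.
  exists (u * x); split=> //; split; first exact: (submoduleZ u sA Ax).
  by rewrite e; apply: (submoduleZ v sB By).
- by move=> u _; rewrite big_ord1 => u0 i; rewrite ord1.
- split=> [|A sA [x [Ax x0]]].
    split; first by exists (fun=> 0); split=> //; rewrite big1.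
    move=> a u v _ _; exists (fun=> a *: u + v); split=> //.
    by rewrite big_ord1.
  exists x; split=> //; split=> //.
  by exists (fun=> x); split=> //; rewrite big_ord1.
Qed.

End Goldie.

(** * Quantum polynomials as iterated skew extensions *)

Section Zpow.
Variables (Q : nzRingType) (l : bool) (x xi : Q).
Hypothesis xV : l -> x * xi = 1 /\ xi * x = 1.

Lemma zpow0 : zpow x xi 0 = 1. Proof. by rewrite /= expr0. Qed.

Lemma zpowS z : idx l z -> zpow x xi (z + 1) = zpow x xi z * x.
Proof.
case: z => [n _|n hz]; first by rewrite -PoszD addn1 /= exprSr.
have [xxi xix] : x * xi = 1 /\ xi * x = 1 by apply: xV; move: hz; rewrite /idx /= orbF.
case: n {hz} => [|n]; first by rewrite /= expr1 xix.
have -> : Negz n.+1 + 1 = Negz n by rewrite !NegzE -[n.+2]addn1 PoszD opprD addrNK.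
by rewrite /= [xi ^+ n.+2]exprSr -mulrA xix mulr1.
Qed.

Lemma zpowP z : l -> zpow x xi (z - 1) = zpow x xi z * xi.
Proof.
move=> hl; have [xxi _] := xV hl.
rewrite -[in RHS](subrK 1 z) zpowS -?mulrA ?xxi ?mulr1 //.
by rewrite /idx /= hl.
Qed.

Lemma zpowD z w : idx l z -> idx l w -> zpow x xi (z + w) = zpow x xi z * zpow x xi w.
Proof.
move=> hz; case: w => [n _|n hw].
  elim: n => [|n IH]; first by rewrite addr0 zpow0 mulr1.
  by rewrite -addn1 PoszD addrA zpowS ?idxD ?idx_nat // IH [zpow x xi (n%:Z + 1)]zpowS
    ?idx_nat // mulrA.
have hl : l by move: hw; rewrite /idx /= orbF.
elim: n {hw} => [|n IH]; first by rewrite zpowP //= expr1.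
rewrite (_ : Negz n.+1 = Negz n - 1); last by rewrite !NegzE -[n.+2]addn1 PoszD opprD.
by rewrite addrA !zpowP // IH mulrA.
Qed.

End Zpow.

Section Generator.
Variables (l : bool) (R S : nzRingType) (iota : {rmorphism R -> S}) (x xi : S).
Variables (tau tau' : R -> R).

Definition tau_pow (t t' : R -> R) (z : int) : R -> R :=
  match z with Posz n => iter n t | Negz n => iter n.+1 t' end.

Lemma iter_cancel (t t' : R -> R) n : cancel t t' -> cancel (iter n t) (iter n t').
Proof. by move=> tK; elim: n => [|n IH] a //; rewrite iterSr iterS tK IH. Qed.

Lemma skew_ext_generator : injective iota -> left_basis iota (idx l) (zpow x xi) ->
  (l -> x * xi = 1 /\ xi * x = 1) ->
  (forall a, x * iota a = iota (tau a) * x) -> cancel tau tau' -> cancel tau' tau ->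
  skew_ext l iota (zpow x xi) (tau_pow tau tau') (tau_pow tau' tau).
Proof.
move=> ii hb xV xa tK t'K; split=> //.
- by move=> z w; apply: zpowD.
- case=> [n|n] a hz.
    elim: n {hz} => [|n IH] /=; first by rewrite expr0 mul1r mulr1.
    by rewrite exprS -mulrA IH mulrA xa -mulrA.
  have [xxi xix] : x * xi = 1 /\ xi * x = 1 by apply: xV; move: hz; rewrite /idx /= orbF.
  have xia c : xi * iota c = iota (tau' c) * xi.
    by rewrite -{1}[c]t'K -[LHS]mulr1 -xxi mulrA -[xi * _ * x]mulrA -xa mulrA xix mul1r.
  rewrite /=; elim: n {hz} => [|n IH]; first by rewrite expr1 xia.
  by rewrite exprS -mulrA IH mulrA xia -mulrA.
- by case=> n /=; apply: iter_cancel n.+1 _ || apply: iter_cancel.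
- by case=> n /=; apply: iter_cancel.
Qed.

End Generator.

Lemma skew_laurent_ext (R S : nzRingType) (tau : {rmorphism R -> R}) :
  is_skew_laurent_ring tau S ->
  exists (iota : {rmorphism R -> S}) b tw tw', skew_ext true iota b tw tw'.
Proof.
move=> [iota [x [xi [[tau' tK t'K] ii hb xV xa]]]].
exists iota, (zpow x xi), (tau_pow tau tau'), (tau_pow tau' tau).
by apply: skew_ext_generator.
Qed.

(** * Reindexing of bases and bases in towers *)

Section LeftBases.

Lemma sum_by_key (V : nmodType) (P J : eqType) (s : seq P) (key : P -> J) (F : P -> V) :
  \sum_(p <- s) F p = \sum_(j <- undup (map key s)) \sum_(p <- s | key p == j) F p.
Proof.
under [RHS]eq_bigr => j _ do rewrite big_mkcond.
rewrite exchange_big /=; apply: eq_big_seq => p ps.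
rewrite -big_mkcond -big_filter (_ : filter _ _ = [:: key p]) ?big_seq1 //.
apply: perm_small_eq => //; apply: uniq_perm; rewrite ?filter_uniq ?undup_uniq //.
move=> j; rewrite mem_filter inE mem_undup eq_sym.
by case: eqP => // ->; rewrite map_f.
Qed.

Variables (R Q : nzRingType) (iota : {rmorphism R -> Q}).

Lemma left_basis_reindex (I J : eqType) (A : pred I) (b : I -> Q) (A' : pred J)
    (b' : J -> Q) (t : J -> I) (k : I -> J) :
  cancel t k -> cancel k t -> (forall j, A (t j) = A' j) ->
  (forall j, A' j -> b (t j) = b' j) ->
  left_basis iota A b -> left_basis iota A' b'.
Proof.
move=> tk kt hA hb [h1 h2]; split.
  move=> f; have [s [c [us sA ->]]] := h1 f.
  exists (map k s), (c \o t); split.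
  - by rewrite map_inj_uniq //; apply: can_inj kt.
  - by rewrite all_map; apply: sub_all sA => i /= Ai; rewrite -hA kt.
  - rewrite big_map; apply: eq_big_seq => i si /=.
    by rewrite kt -hb ?kt // -hA kt; apply: (allP sA).
move=> s c us sA e j js.
have := h2 (map t s) (c \o k) _ _ _ (t j); rewrite /= tk; apply.
- by rewrite map_inj_uniq //; apply: can_inj tk.
- by rewrite all_map; apply: sub_all sA => i /= Ai; rewrite hA.
- rewrite big_map -[RHS]e; apply: eq_big_seq => i si /=.
  by rewrite tk hb //; apply: (allP sA).
- exact: map_f.
Qed.

(** A converse of the usual tower law. For independence, the coefficients of a [Q']-relation are
    expanded in [b1] over a common finite list [T], which gives an [R]-relation among the
    products. *)
Lemma left_basis_tower (Q' : nzRingType) (iota1 : {rmorphism R -> Q'})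
    (iota2 : {rmorphism Q' -> Q}) (I J : eqType) (A1 : pred I) (A2 : pred J)
    (b1 : I -> Q') (b2 : J -> Q) :
  (forall a, iota2 (iota1 a) = iota a) ->
  left_basis iota1 A1 b1 ->
  left_basis iota [pred p : I * J | A1 p.1 && A2 p.2] (fun p => iota2 (b1 p.1) * b2 p.2) ->
  left_basis iota2 A2 b2.
Proof.
move=> ii [h1 h2] [g1 g2]; split.
  move=> f; have [s [c [us sA ->]]] := g1 f.
  rewrite (sum_by_key _ snd).
  exists (undup (map snd s)), (fun j => \sum_(p <- s | p.2 == j) iota1 (c p) * b1 p.1).
  split; first exact: undup_uniq.
    apply/allP => j; rewrite mem_undup => /mapP[p ps ->].
    by have /andP[] := allP sA p ps.
  apply: eq_bigr => j _; rewrite rmorph_sum mulr_suml; apply: eq_bigr => p /eqP <-.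
  by rewrite rmorphM ii mulrA.
move=> s d us sA e j js.
have /choice[t ht] : forall j, exists tc : seq I * (I -> R),
    [/\ uniq tc.1, all A1 tc.1 & d j = \sum_(i <- tc.1) iota1 (tc.2 i) * b1 i].
  by move=> j'; have [t [c hc]] := h1 (d j'); exists (t, c).
pose T := undup (flatten [seq (t j).1 | j <- s]).
pose c (p : I * J) := if p.1 \in (t p.2).1 then (t p.2).2 p.1 else 0.
have uT : uniq T by exact: undup_uniq.
have TA : all A1 T.
  apply/allP => i; rewrite mem_undup => /flatten_mapP[j' _].
  by have [_ /allP h _] := ht j'; apply: h.
have dE j' : j' \in s -> d j' = \sum_(i <- T) iota1 (c (i, j')) * b1 i.
  move=> js'; have [ut tA ->] := ht j'.
  rewrite [RHS](bigID (fun i => i \in (t j').1)) /= [X in _ = _ + X]big1 ?addr0.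
    rewrite [RHS](eq_bigr (fun i => iota1 ((t j').2 i) * b1 i)) => [|i hi].
      rewrite -[RHS]big_filter; apply: perm_big; apply: uniq_perm; rewrite ?filter_uniq //.
      move=> i; rewrite mem_filter mem_undup; case: (boolP (i \in (t j').1)) => //= it.
      by apply/esym/flatten_mapP; exists j'.
    by rewrite /c /= hi.
  by move=> i /negPf hi; rewrite /c /= hi rmorph0 mul0r.
have c0 i j' : i \in T -> j' \in s -> c (i, j') = 0.
  move=> iT js'.
  apply: (g2 [seq (i, j) | i <- T, j <- s] c).
  - by apply: allpairs_uniq => // -[a a'] [b b'] _ _ /= [-> ->].
  - apply/allP => p /allpairsP[[a a'] /= [aT as' ->]] /=.
    by rewrite (allP TA) // (allP sA).
  - rewrite big_allpairs exchange_big /= -[RHS]e; apply: eq_big_seq => a as'.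
    rewrite dE // rmorph_sum mulr_suml; apply: eq_bigr => i' _.
    by rewrite rmorphM ii mulrA.
  - by apply/allpairsP; exists (i, j').
by rewrite dE // big_seq big1 // => i iT; rewrite c0 // rmorph0 mul0r.
Qed.

End LeftBases.

Definition subring_set (Q : nzRingType) (A : set Q) : Prop :=
  [/\ A 1, forall u v, A u -> A v -> A (u - v) & forall u v, A u -> A v -> A (u * v)].

Section Subrings.
Variables (Q : nzRingType) (A : set Q).
Hypothesis hA : subring_set A.

Definition subr_pred : pred Q := fun x => `[< A x >].

Lemma subr_pred_closed : subring_closed subr_pred.
Proof.
case: hA => A1 AB AM; split; first exact/asboolP.
- by move=> u v /asboolP Au /asboolP Av; apply/asboolP; apply: AB.
- by move=> u v /asboolP Au /asboolP Av; apply/asboolP; apply: AM.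
Qed.

(* The vacuous abstraction makes subr depend on the closure proof hA, which its
   ring structure needs. *)
Record subr := SubR { subr_val : Q; subr_valP : (fun=> subr_pred) hA subr_val }.

HB.instance Definition _ := [isSub for subr_val].
HB.instance Definition _ := [Choice of subr by <:].
HB.instance Definition _ :=
  GRing.SubChoice_isSubNzRing.Build Q subr_pred subr subr_pred_closed.

Lemma subrP (u : subr) : A (val u).
Proof. by have /asboolP := valP u. Qed.

Definition mksubr (u : Q) (Au : A u) : subr := @Sub Q subr_pred subr u (asboolT Au).

Definition subr_incl : {rmorphism subr -> Q} := val.

Lemma subr_incl_inj : injective subr_incl.
Proof. by move=> u v; exact: (@val_inj Q subr_pred subr u v). Qed.

Lemma subr_incl_mk (u : Q) (Au : A u) : subr_incl (mksubr Au) = u.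
Proof. by []. Qed.

End Subrings.

(** * Commutation up to units of the base ring *)

Section Commutation.
Variables (R Q : nzRingType) (iota : {rmorphism R -> Q}).

(** [s] plays the role of conjugation by [X] on [R], available without [X] being invertible. *)
Definition normal_by (X : Q) (s s' : R -> R) : Prop :=
  [/\ cancel s s', cancel s' s, s 1 = 1, {morph s : a c / a * c}
    & forall a, X * iota a = iota (s a) * X].

Definition normal_elt X := exists s s', normal_by X s s'.

(** The unit is left unspecified: for products and powers it becomes a word in the q_ij and their
    images under the twists, of which only invertibility is used. *)
Definition scomm (X Y : Q) : Prop :=
  exists u v : R, [/\ u * v = 1, v * u = 1 & X * Y = iota u * (Y * X)].

Lemma normal_by_inv X Xi s s' : X * Xi = 1 -> Xi * X = 1 ->
  normal_by X s s' -> normal_by Xi s' s.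
Proof.
move=> XXi XiX [sK s'K s1 sM Xa]; split=> //.
- by rewrite -s1 sK.
- by move=> a c; apply: (can_inj sK); rewrite sM !s'K.
- move=> a; rewrite -{1}[a]s'K -[LHS]mulr1 -XXi mulrA -[Xi * _ * X]mulrA -Xa.
  by rewrite mulrA XiX mul1r.
Qed.

Lemma normal_1 : normal_elt 1.
Proof. by exists id, id; split=> // a; rewrite mul1r mulr1. Qed.

Lemma normal_mul X Y : normal_elt X -> normal_elt Y -> normal_elt (X * Y).
Proof.
move=> [s [s' [sK s'K s1 sM Xa]]] [t [t' [tK t'K t1 tM Ya]]].
exists (s \o t), (t' \o s'); split=> //=.
- by move=> a /=; rewrite sK tK.
- by move=> a /=; rewrite t'K s'K.
- by rewrite t1.
- by move=> a c /=; rewrite tM sM.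
- by move=> a; rewrite -mulrA Ya mulrA Xa mulrA.
Qed.

Lemma normal_zpow (l : bool) (X Xi : Q) (z : int) :
  (l -> X * Xi = 1 /\ Xi * X = 1) -> idx l z ->
  normal_elt X -> normal_elt (zpow X Xi z).
Proof.
have pow Y n : normal_elt Y -> normal_elt (Y ^+ n).
  move=> nY; elim: n => [|n IH]; first by rewrite expr0; apply: normal_1.
  by rewrite exprS; apply: normal_mul.
move=> XV hz nX; case: z hz => n hz; apply: pow => //.
have [XXi XiX] : X * Xi = 1 /\ Xi * X = 1 by apply: XV; move: hz; rewrite /idx /= orbF.
by have [s [s' hs]] := nX; exists s', s; apply: (normal_by_inv (X := X)).
Qed.

Lemma scomm_sym X Y : scomm X Y -> scomm Y X.
Proof.
move=> [u [v [uv vu e]]]; exists v, u; split=> //.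
by rewrite e mulrA -rmorphM vu rmorph1 mul1r.
Qed.

Lemma scomm1 X : scomm X 1.
Proof. by exists 1, 1; split; rewrite ?mulr1 // rmorph1 !mul1r. Qed.

Lemma scommM X Y Z : normal_elt Y -> scomm X Y -> scomm X Z -> scomm X (Y * Z).
Proof.
move=> [s [s' [sK s'K s1 sM Ya]]] [u [v [uv vu e]]] [u' [v' [uv' vu' e']]].
exists (u * s u'), (s v' * v); split.
- by rewrite mulrA -[u * s u' * _]mulrA -sM uv' s1 mulr1.
- by rewrite mulrA -[s v' * v * u]mulrA vu mulr1 -sM vu' s1.
- rewrite mulrA e -mulrA -[Y * X * Z]mulrA e' [Y * (iota u' * _)]mulrA Ya.
  by rewrite rmorphM !mulrA.
Qed.

Lemma scommV X Y Yi : Y * Yi = 1 -> Yi * Y = 1 -> normal_elt Y ->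
  scomm X Y -> scomm X Yi.
Proof.
move=> YYi YiY [s [s' nY]] [u [v [uv vu e]]].
have [s'K sK s1 sM Ya] := normal_by_inv YYi YiY nY.
exists (s' v), (s' u); split; rewrite -?sM ?uv ?vu //.
have -> : X * Yi = Yi * (Y * X) * Yi by rewrite mulrA YiY mul1r.
have -> : Y * X = iota v * (X * Y) by rewrite e [RHS]mulrA -rmorphM vu rmorph1 mul1r.
by rewrite -!mulrA YYi mulr1 mulrA Ya -mulrA.
Qed.

Lemma scomm_zpow (l : bool) (X Y Yi : Q) (z : int) :
  (l -> Y * Yi = 1 /\ Yi * Y = 1) -> idx l z ->
  normal_elt Y -> scomm X Y -> scomm X (zpow Y Yi z).
Proof.
have pow Z n : normal_elt Z -> scomm X Z -> scomm X (Z ^+ n).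
  move=> nZ XZ; elim: n => [|n IH]; first by rewrite expr0; apply: scomm1.
  by rewrite exprS; apply: scommM.
move=> YV hz nY XY; case: z hz => n hz; first exact: pow.
have [YYi YiY] : Y * Yi = 1 /\ Yi * Y = 1 by apply: YV; move: hz; rewrite /idx /= orbF.
apply: pow; last exact: scommV XY.
by have [s [s' hs]] := nY; exists s', s; apply: (normal_by_inv (X := Y)).
Qed.

End Commutation.

(** * Splitting off the last variable *)

Section Split.
Variables (R Q : nzRingType) (n r : nat) (q : 'M[R]_n.+1).
Variables (sigma : 'I_n.+1 -> {rmorphism R -> R}) (iota : {rmorphism R -> Q}).
Variables (x xi : 'I_n.+1 -> Q).
Hypothesis H : skew_quantum_polynomials r q sigma iota x xi.

Let W (i : 'I_n) : 'I_n.+1 := widen_ord (leqnSn n) i.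
Let p (i : 'I_n.+1) (z : int) : Q := zpow (x i) (xi i) z.
Let adm (i : 'I_n.+1) (z : int) : bool := idx (i < r)%N z.
Let m (beta : {ffun 'I_n -> int}) : Q := \prod_(i < n) p (W i) (beta i).

Lemma admissibleP k (alpha : {ffun 'I_k -> int}) :
  reflect (forall i : 'I_k, idx (i < r)%N (alpha i)) (admissible r alpha).
Proof.
apply: (iffP forallP) => h i; have := h i;
  by rewrite /idx /= (leqNgt r i) implybE negbK.
Qed.

Let pV (i : 'I_n.+1) : (i < r)%N -> x i * xi i = 1 /\ xi i * x i = 1.
Proof. exact: sqp_xinv H i. Qed.

Let pD i z w : adm i z -> adm i w -> p i (z + w) = p i z * p i w.
Proof. by apply: zpowD; apply: pV. Qed.

Let x_normal i : normal_elt iota (x i).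
Proof.
have [s' sK s'K] := sqp_auto H i; exists (sigma i), s'; split=> //.
- exact: rmorph1.
- exact: rmorphM.
- exact: sqp_xa H i.
Qed.

Let p_normal i z : adm i z -> normal_elt iota (p i z).
Proof. by move=> hz; apply: normal_zpow (pV (i := i)) hz (x_normal i). Qed.

Let p_comm i j z w : adm i z -> adm j w -> scomm iota (p i z) (p j w).
Proof.
move=> hz hw; apply: scomm_zpow (pV (i := j)) hw (x_normal j) _.
apply: scomm_sym; apply: scomm_zpow (pV (i := i)) hz (x_normal i) _.
have [h1 h2] := sqp_q_inv H i j; exists (q i j), (q j i); split=> //.
by rewrite (sqp_xx H) mulrA.
Qed.

(** The new power moves right past the factors before position [i], each passage costing a unit of
    [R], and merges with the power of the same variable; the units are collected on the left. *)
Let prod_mul (s : seq 'I_n) (i : 'I_n) e (beta : {ffun 'I_n -> int}) :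
  uniq s -> i \in s -> adm (W i) e -> (forall j, adm (W j) (beta j)) ->
  exists u, p (W i) e * \prod_(j <- s) p (W j) (beta j) =
    iota u * \prod_(j <- s) p (W j) (beta j + (if j == i then e else 0)).
Proof.
move=> + + he hb; elim: s => [|k s IH] //= /andP[ks us]; rewrite inE.
rewrite !big_cons; have [ik _|ik /= is'] := eqVneq i k.
  subst k.
  exists 1; rewrite rmorph1 mul1r mulrA [beta i + _]addrC pD //; congr (_ * _).
  apply: eq_big_seq => j js; case: eqP => [jk|]; last by rewrite addr0.
  by rewrite -jk js in ks.
have [u eu] := IH us is'.
have [v [v' [_ _ ev]]] := p_comm he (hb k).
have [s1 [s1' [_ _ _ _ sa]]] := p_normal (hb k).
exists (v * s1 u); rewrite mulrA ev -!mulrA eu [p (W k) _ * (iota u * _)]mulrA sa.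
by rewrite addr0 rmorphM !mulrA.
Qed.

(** The [R]-span of the ordered monomials in the first n variables. An exponent may occur several
    times in the list, so that sums are concatenations. *)
Let V : set Q := [set f | exists s : seq (R * {ffun 'I_n -> int}),
  all (fun a => admissible r a.2) s /\ f = \sum_(a <- s) iota a.1 * m a.2].

Let V0 : V 0.
Proof. by exists [::]; rewrite big_nil. Qed.

Let VD f g : V f -> V g -> V (f + g).
Proof.
move=> [s [hs ->]] [t [ht ->]]; exists (s ++ t); rewrite big_cat; split=> //.
by rewrite all_cat hs.
Qed.

Let Vm c beta : admissible r beta -> V (iota c * m beta).
Proof. by move=> hb; exists [:: (c, beta)]; rewrite big_seq1 /= hb. Qed.

Let Vind (P : Q -> Prop) : P 0 -> (forall f g, P f -> P g -> P (f + g)) ->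
  (forall c beta, admissible r beta -> P (iota c * m beta)) -> forall f, V f -> P f.
Proof.
move=> P0 PD Pm f [s [hs ->]]; rewrite big_seq; apply: (big_ind P) => // a as'.
by apply: Pm; apply: (allP hs).
Qed.

Let Viota c f : V f -> V (iota c * f).
Proof.
elim/Vind => [|g1 g2 h1 h2|d beta hb]; first by rewrite mulr0.
- by rewrite mulrDr; apply: VD.
- by rewrite mulrA -rmorphM; apply: Vm.
Qed.

Let Vp i z f : adm (W i) z -> V f -> V (p (W i) z * f).
Proof.
move=> hz; elim/Vind => [|g1 g2 h1 h2|d beta hb]; first by rewrite mulr0.
- by rewrite mulrDr; apply: VD.
have /admissibleP hb' := hb.
have [s [s' [_ _ _ _ sa]]] := p_normal hz.
have [||u hu] := @prod_mul (index_enum 'I_n) i z beta _ _ hz hb'.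
- exact: index_enum_uniq.
- exact: mem_index_enum.
rewrite mulrA sa -mulrA /m hu mulrA -rmorphM.
pose beta' : {ffun 'I_n -> int} := [ffun j => beta j + (if j == i then z else 0)].
have -> : \prod_(j < n) p (W j) (beta j + (if j == i then z else 0)) = m beta'.
  by apply: eq_bigr => j _; rewrite ffunE.
apply: Vm; apply/admissibleP => j; rewrite ffunE; apply: idxD; first exact: hb'.
by case: eqP => [->|_]; [exact: hz|exact: (idx_nat _ 0)].
Qed.

Let VM f g : V f -> V g -> V (f * g).
Proof.
move=> + Vg; elim/Vind => [|f1 f2 h1 h2|c beta /admissibleP hb]; first by rewrite mul0r.
- by rewrite mulrDl; apply: VD.
rewrite -mulrA; apply: Viota; rewrite /m.
elim: (index_enum _) => [|j s IH]; first by rewrite big_nil mul1r.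
by rewrite big_cons -mulrA; apply: Vp => //; apply: hb.
Qed.

Let m0 : m [ffun=> 0] = 1.
Proof. by rewrite /m big1 // => i _; rewrite ffunE /p zpow0. Qed.

Let V1 : V 1.
Proof.
rewrite -m0 -[m _]mul1r -(rmorph1 iota); apply: Vm; apply/admissibleP => i.
by rewrite ffunE; apply: (idx_nat _ 0).
Qed.

Lemma first_subring : subring_set V.
Proof.
split=> // f g Vf Vg; apply: VD => //.
by rewrite -mulN1r -(rmorph1 iota) -rmorphN; apply: Viota.
Qed.

Let Q' : nzRingType := subr first_subring.
Let j : {rmorphism Q' -> Q} := subr_incl first_subring.
Let mk f (Vf : V f) : Q' := mksubr first_subring Vf.

Let V_iota c : V (iota c).
Proof. by rewrite -[iota c]mulr1; apply: Viota. Qed.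

Let Vpz i z : adm (W i) z -> V (p (W i) z).
Proof. by move=> hz; rewrite -[p _ _]mulr1; apply: Vp. Qed.

Let iota'_zmod : zmod_morphism (fun c => mk (V_iota c)).
Proof.
by move=> c d; apply: (@subr_incl_inj _ _ first_subring); exact: (rmorphB iota).
Qed.

Let iota'_monoid : monoid_morphism (fun c => mk (V_iota c)).
Proof.
split=> [|c d]; apply: (@subr_incl_inj _ _ first_subring).
  exact: (rmorph1 iota).
exact: (rmorphM iota).
Qed.

Let iota' : {rmorphism R -> Q'} :=
  HB.pack (fun c => mk (V_iota c))
    (GRing.isZmodMorphism.Build R Q' _ iota'_zmod)
    (GRing.isMonoidMorphism.Build R Q' _ iota'_monoid).

Let jiota c : j (iota' c) = iota c. Proof. by []. Qed.

Let jinj : injective j. Proof. exact: subr_incl_inj. Qed.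

Let x' (i : 'I_n) : Q' := mk (@Vpz i 1 (idx_nat _ 1)).

Let xi'_exists (i : 'I_n) : exists y : Q', (i < r)%N -> j y = xi (W i).
Proof.
(* For a variable that is not inverted, [xi (W i)] need not lie in the subring, so [xi'] takes the
   default 0. *)
have [hi|hi] := boolP (i < r)%N; last by exists 0.
have h1 : adm (W i) (-1) by rewrite /adm /idx /= hi.
by exists (mk (Vpz h1)) => _; rewrite /j subr_incl_mk /p /= expr1.
Qed.

Let xi' (i : 'I_n) : Q' := sval (cid (xi'_exists i)).

Let jx' i : j (x' i) = x (W i). Proof. by rewrite /j subr_incl_mk /p /= expr1. Qed.

Let jxi' (i : 'I_n) : (i < r)%N -> j (xi' i) = xi (W i).
Proof. by rewrite /xi'; case: cid. Qed.

Let jzpow (i : 'I_n) z : adm (W i) z -> j (zpow (x' i) (xi' i) z) = p (W i) z.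
Proof.
case: z => k hz.
  by change (j (x' i ^+ k) = x (W i) ^+ k); rewrite rmorphXn jx'.
have hi : (i < r)%N by move: hz; rewrite /adm /idx /= orbF.
by change (j (xi' i ^+ k.+1) = xi (W i) ^+ k.+1); rewrite rmorphXn jxi'.
Qed.

Let jm beta : admissible r beta -> j (monomial x' xi' beta) = m beta.
Proof.
move=> /admissibleP hb; rewrite /monomial rmorph_prod; apply: eq_bigr => i _.
by rewrite jzpow //; apply: hb.
Qed.

Let glue (bz : {ffun 'I_n -> int} * int) : {ffun 'I_n.+1 -> int} :=
  [ffun i => if unlift ord_max i is Some k then bz.1 k else bz.2].

Let cut (alpha : {ffun 'I_n.+1 -> int}) : {ffun 'I_n -> int} * int :=
  ([ffun k => alpha (W k)], alpha ord_max).

Let WE k : W k = lift ord_max k.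
Proof. by apply: val_inj; rewrite /= /bump leqNgt ltn_ord. Qed.

Let glueW bz k : glue bz (W k) = bz.1 k.
Proof. by rewrite ffunE WE liftK. Qed.

Let glue_max bz : glue bz ord_max = bz.2.
Proof. by rewrite ffunE unlift_none. Qed.

Let glueK : cancel glue cut.
Proof.
move=> [beta z]; rewrite /cut glue_max; congr pair.
by apply/ffunP => k; rewrite ffunE glueW.
Qed.

Let cutK : cancel cut glue.
Proof.
move=> alpha; apply/ffunP => i; rewrite ffunE; case: unliftP => [k ->|->] //=.
by rewrite ffunE WE.
Qed.

Let adm_glue bz : admissible r (glue bz) =
  (admissible r bz.1 && idx (n < r)%N bz.2).
Proof.
apply/admissibleP/andP => [h|[/admissibleP h1 h2] i].
  split; last by have := h ord_max; rewrite glue_max.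
  by apply/admissibleP => k; have := h (W k); rewrite glueW.
rewrite ffunE; case: unliftP => [k ->|->] //.
by have := h1 k; rewrite -WE.
Qed.

Let mono_glue bz : monomial x xi (glue bz) = m bz.1 * p ord_max bz.2.
Proof.
rewrite /monomial big_ord_recr /= glue_max; congr (_ * _).
by apply: eq_bigr => k _; rewrite glueW.
Qed.

Let basis_pairs : left_basis iota
  [pred bz : {ffun 'I_n -> int} * int | admissible r bz.1 && idx (n < r)%N bz.2]
  (fun bz => j (monomial x' xi' bz.1) * p ord_max bz.2).
Proof.
apply: (left_basis_reindex glueK cutK) (sqp_basis H).
  exact: adm_glue.
by move=> bz /andP[hb _]; rewrite mono_glue jm.
Qed.

Let basis' : left_basis iota' (@admissible n r) (monomial x' xi').
Proof.
have [_ h2] := basis_pairs; split.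
  move=> f; have [s [hs ef]] := subrP f.
  exists (undup (map snd s)), (fun beta => \sum_(a <- s | a.2 == beta) a.1).
  have hs' beta : beta \in undup (map snd s) -> admissible r beta.
    by rewrite mem_undup => /mapP[a as' ->]; apply: (allP hs).
  split; [exact: undup_uniq|exact/allP|apply: jinj].
  rewrite [LHS]ef (sum_by_key _ snd) rmorph_sum; apply: eq_big_seq => beta hb.
  rewrite rmorphM jiota jm ?hs' // rmorph_sum mulr_suml.
  by apply: eq_bigr => a /eqP <-.
move=> s c us sA e beta bs.
apply: (h2 [seq (b, 0) | b <- s] (fun bz => c bz.1)) (beta, 0) _.
- by rewrite map_inj_uniq // => a b [].
- rewrite all_map; apply: sub_all sA => b /= ->.
  exact: (idx_nat _ 0).
- rewrite big_map -[RHS](rmorph0 j) -[in RHS]e rmorph_sum; apply: eq_bigr => b _.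
  by rewrite rmorphM; congr (_ * _); exact: mulr1.
- by apply/mapP; exists beta.
Qed.

Lemma first_quantum : skew_quantum_polynomials r
  (\matrix_(i < n, k < n) q (W i) (W k)) (fun i => sigma (W i)) iota' x' xi'.
Proof.
split.
- by move=> i; rewrite mxE (sqp_q_diag H).
- by move=> i k; rewrite !mxE; apply: (sqp_q_inv H).
- by move=> i; apply: (sqp_auto H).
- by move=> c d /(congr1 j); apply: (sqp_incl H).
- exact: basis'.
- move=> i hi; have [h1 h2] := pV (i := W i) hi.
  by split; apply: jinj; rewrite rmorphM jx' jxi' // rmorph1.
- by move=> i k; apply: jinj; rewrite !rmorphM !jx' jiota mxE (sqp_xx H).
- by move=> i c; apply: jinj; rewrite !rmorphM jx' !jiota (sqp_xa H).
Qed.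

Let xn := x ord_max.

Let xn_m beta : admissible r beta -> scomm iota xn (m beta).
Proof.
move=> /admissibleP hb; rewrite /m.
elim: (index_enum _) => [|k s IH]; first by rewrite big_nil; apply: scomm1.
rewrite big_cons; apply: scommM IH; first by apply: p_normal; apply: hb.
have := @p_comm ord_max (W k) 1 (beta k) (idx_nat _ 1) (hb k).
by rewrite {1}/p /= expr1.
Qed.

(** With [Vxn] this is x_n V = V x_n, the source of the twist and of its inverse. *)
Let xnV f : V f -> exists g, V g /\ xn * f = g * xn.
Proof.
elim/Vind => [|f1 f2 [g1 [V1' e1]] [g2 [V2 e2]]|c beta hb].
- by exists 0; rewrite mulr0 mul0r.
- by exists (g1 + g2); split; [exact: VD|rewrite mulrDr mulrDl e1 e2].
have [u [v [_ _ e]]] := xn_m hb.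
exists (iota (sigma ord_max c * u) * m beta); split; first exact: Vm.
by rewrite mulrA (sqp_xa H) -mulrA e rmorphM !mulrA.
Qed.

Let Vxn g : V g -> exists f, V f /\ xn * f = g * xn.
Proof.
elim/Vind => [|f1 f2 [g1 [V1' e1]] [g2 [V2 e2]]|c beta hb].
- by exists 0; rewrite mulr0 mul0r.
- by exists (g1 + g2); split; [exact: VD|rewrite mulrDr mulrDl e1 e2].
have [u [v [uv vu e]]] := xn_m hb.
have [s' sK s'K] := sqp_auto H ord_max.
(* Passing x_n applies sigma to the coefficient and contributes the unit [u]; the factor [v] is
   there to cancel it. *)
exists (iota (s' (c * v)) * m beta); split; first exact: Vm.
rewrite mulrA (sqp_xa H) s'K -mulrA e mulrA -rmorphM -mulrA vu mulr1.
by rewrite mulrA.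
Qed.

Let basis_xn : left_basis j (idx (n < r)%N) (p ord_max).
Proof. exact: (left_basis_tower jiota basis' basis_pairs). Qed.

Let mulr_xn_inj : injective (fun f : Q' => j f * xn).
Proof.
move=> f g /= e; apply/eqP; rewrite -subr_eq0; apply/eqP.
have [_ h2] := basis_xn.
have e0 : \sum_(z <- [:: 1 : int]) j (f - g) * p ord_max z = 0.
  rewrite big_seq1 rmorphB mulrBl; apply/eqP; rewrite subr_eq0; apply/eqP.
  exact: e.
apply: (h2 [:: 1 : int] (fun=> f - g) _ _ e0 1) => //=.
by rewrite andbT; apply: (idx_nat _ 1).
Qed.

(** Left cancellation is not immediate from a left basis: moving x_n to the right replaces each
    coefficient by its image under sigma times a unit of [R], and both operations are injective. *)
Let mull_xn_inj : injective (fun f : Q' => xn * j f).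
Proof.
move=> f g /= e; apply/eqP; rewrite -subr_eq0; apply/eqP.
have {e} : xn * j (f - g) = 0 by rewrite rmorphB mulrBr e subrr.
move: (f - g) => d e; have [h1 h2] := basis'.
have [s [c [us sA ed]]] := h1 d.
have [g1 g2] := basis_pairs.
have /choice[u hu] : forall beta, exists u, admissible r beta ->
    exists v, u * v = 1 /\ xn * m beta = iota u * (m beta * xn).
  move=> beta; have [hb|hb] := boolP (admissible r beta); last by exists 0.
  by have [u [v [uv vu e']]] := xn_m hb; exists u => _; exists v.
have key beta : beta \in s -> sigma ord_max (c beta) * u beta = 0.
  move=> bs; apply: (g2 [seq (b, 1 : int) | b <- s]
    (fun bz => sigma ord_max (c bz.1) * u bz.1) _ _ _ (beta, 1 : int)).
  - by rewrite map_inj_uniq // => a b [].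
  - rewrite all_map; apply: sub_all sA => b /= ->.
    exact: (idx_nat _ 1).
  - rewrite big_map -[RHS]e ed rmorph_sum mulr_sumr; apply: eq_big_seq => b bs'.
    have hb' := allP sA b bs'; have [v' [_ e']] := hu _ hb'.
    transitivity (iota (sigma ord_max (c b) * u b) * (m b * xn)).
      by congr (_ * (_ * _)); exact: jm.
    rewrite [j (_ * _)]rmorphM jiota jm // [RHS]mulrA (sqp_xa H) -[RHS]mulrA e'.
    by rewrite rmorphM !mulrA.
  - by apply/mapP; exists beta.
rewrite ed big_seq big1 // => beta bs.
have [v [uv _]] := hu _ (allP sA beta bs).
suff -> : c beta = 0 by rewrite rmorph0 mul0r.
have := congr1 (fun a => a * v) (key beta bs); rewrite mul0r -mulrA uv mulr1 => e0.
by apply: (bij_inj (sqp_auto H ord_max)); rewrite e0 rmorph0.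
Qed.

(** The twist and its inverse are chosen pointwise from x_n V = V x_n; cancelling x_n on the left
    and on the right makes them mutually inverse. *)
Lemma skew_ext_last : exists b tw tw', skew_ext (n < r)%N j b tw tw'.
Proof.
have /choice[t ht] : forall f : Q', exists g : Q', xn * j f = j g * xn.
  by move=> f; have [g [Vg e]] := xnV (subrP f); exists (mk Vg).
have /choice[t' ht'] : forall g : Q', exists f : Q', xn * j f = j g * xn.
  by move=> g; have [f [Vf e]] := Vxn (subrP g); exists (mk Vf).
exists (p ord_max), (tau_pow t t'), (tau_pow t' t).
apply: skew_ext_generator => //; first exact: (pV (i := ord_max)).
- by move=> f; apply: mull_xn_inj; rewrite /= ht' ht.
- by move=> f; apply: mulr_xn_inj; rewrite /= -ht ht'.
Qed.

Lemma skew_quantum_split : exists (Q0 : nzRingType) (q0 : 'M[R]_n)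
    (sigma0 : 'I_n -> {rmorphism R -> R}),
  is_skew_quantum_ring r q0 sigma0 Q0 /\
  exists (i0 : {rmorphism Q0 -> Q}) b tw tw', skew_ext (n < r)%N i0 b tw tw'.
Proof.
exists Q', (\matrix_(i < n, k < n) q (W i) (W k)), (fun i => sigma (W i)).
by split; [exists iota', x', xi'; exact: first_quantum|exists j; exact: skew_ext_last].
Qed.

End Split.

Lemma skew_quantum_one (R Q : nzRingType) (r : nat) (q : 'M[R]_1)
    (sigma : 'I_1 -> {rmorphism R -> R}) :
  is_skew_quantum_ring r q sigma Q ->
  exists (i0 : {rmorphism R -> Q}) b tw tw', skew_ext (0 < r)%N i0 b tw tw'.
Proof.
move=> [iota [x [xi H]]]; have [s' sK s'K] := sqp_auto H ord0.
exists iota, (zpow (x ord0) (xi ord0)), (tau_pow (sigma ord0) s'),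
  (tau_pow s' (sigma ord0)).
apply: skew_ext_generator => //.
- exact: sqp_incl H.
- apply: (left_basis_reindex (t := fun z => [ffun=> z])
    (k := fun alpha : {ffun 'I_1 -> int} => alpha ord0)) (sqp_basis H).
  + by move=> z; rewrite ffunE.
  + by move=> alpha; apply/ffunP => i; rewrite ffunE (ord1 i).
  + move=> z; apply/admissibleP/idP => [/(_ ord0)|hz i]; rewrite ffunE //.
    by rewrite (ord1 i).
  + by move=> z _; rewrite /monomial big_ord1 ffunE.
- exact: sqp_xinv H ord0.
- exact: sqp_xa H ord0.
Qed.

(** The descent ends at one variable, an extension of [R] itself. With no variable [Q] would only be
    isomorphic to [R], and [P] is not assumed invariant under isomorphism; hence the condition 0 <
    n. *)
Lemma skew_quantum_ind (R : nzRingType) (r : nat) (P : nat -> nzRingType -> Prop) :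
  P 0%N R ->
  (forall k (S T : nzRingType) (iota : {rmorphism S -> T}) b tw tw',
     P k S -> skew_ext (k < r)%N iota b tw tw' -> P k.+1 T) ->
  forall n (q : 'M[R]_n) (sigma : 'I_n -> {rmorphism R -> R}) (Q : nzRingType),
    (0 < n)%N -> is_skew_quantum_ring r q sigma Q -> P n Q.
Proof.
move=> P0 PS; elim=> [//|[|n] IH] q sigma Q _.
  by move=> /skew_quantum_one[iota [b [tw [tw' h]]]]; apply: PS h.
move=> [i [x [xi /skew_quantum_split[Q0 [q0 [s0 [hQ0 [iota [b [tw [tw' h]]]]]]]]]]].
by apply: PS h; apply: IH hQ0.
Qed.

(** * Dimensions of skew quantum polynomial rings *)

Section QuantumDimensions.
Variables (R : nzRingType) (n r : nat) (q : 'M[R]_n).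
Variables (sigma : 'I_n -> {rmorphism R -> R}) (Q : nzRingType).
Hypotheses (n_gt0 : (0 < n)%N) (hQ : is_skew_quantum_ring r q sigma Q).

Lemma skew_quantum_lgld d : is_lgld R (Some d) ->
  exists e, is_lgld Q (Some e) /\ (d <= e <= d + n)%N.
Proof.
move=> hd; apply: (skew_quantum_ind (P := fun n S =>
  exists e, is_lgld S (Some e) /\ (d <= e <= d + n)%N) _ _ n_gt0 hQ).
  by exists d; rewrite addn0 leqnn.
move=> k S T iota b tw tw' [e [he /andP[de ed]]] h.
have [e' [he' /andP[ee' e'e]]] := lgld_step h he.
exists e'; split=> //; rewrite (leq_trans de ee') addnS.
exact: leq_trans e'e _.
Qed.

Lemma skew_quantum_kdim a : left_noetherian R -> is_lKdim R a ->
  exists c, [/\ is_lKdim Q c, ole a c & ole c (oaddn a n)].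
Proof.
move=> hR ha.
suff [] : left_noetherian Q /\
    exists c, [/\ is_lKdim Q c, ole a c & ole c (oaddn a n)] by [].
apply: (skew_quantum_ind (P := fun n S => left_noetherian S /\
  exists c, [/\ is_lKdim S c, ole a c & ole c (oaddn a n)]) _ _ n_gt0 hQ).
  by split=> //; exists a; split=> //; exact: ole_refl.
move=> k S T iota b tw tw' [hS [c [hc ac ca]]] h.
have hT := noetherian_step h hS; split=> //.
have [c' hc'] := noetherian_lKdim_exists hT.
have [cc' c'c] := kdim_step h hS hc hc'.
exists c'; split=> //; first exact: ole_trans cc'.
by apply: ole_trans c'c _ => -[]; exists tt.
Qed.

Lemma skew_quantum_domain : left_noetherian R -> domain_ring R ->
  left_noetherian Q /\ domain_ring Q.
Proof.
move=> hR dR; apply: (skew_quantum_ind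
  (P := fun _ S => left_noetherian S /\ domain_ring S) _ _ n_gt0 hQ) => //.
move=> k S T iota b tw tw' [hS dS] h.
by split; [exact: noetherian_step h hS|exact: domain_step h dS].
Qed.

End QuantumDimensions.

Section QuantumPolynomials.
Variables (R : nzRingType) (n : nat) (q : 'M[R]_n).
Variables (sigma : 'I_n -> {rmorphism R -> R}) (Q : nzRingType).
Hypotheses (n_gt0 : (0 < n)%N) (hQ : is_skew_quantum_ring 0 q sigma Q).

Lemma quantum_poly_lgld v : is_lgld R v -> is_lgld Q (enat_addn v n).
Proof.
move=> hv; apply: (skew_quantum_ind (P := fun n S => is_lgld S (enat_addn v n))
  _ _ n_gt0 hQ).
  by case: v hv => //= d; rewrite addn0.
move=> k S T iota b tw tw' hS h; have := lgld_poly h hS.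
by case: (v) => //= d; rewrite -addnA addn1.
Qed.

Lemma quantum_poly_kdim a : left_noetherian R -> is_lKdim R a ->
  is_lKdim Q (oaddn a n).
Proof.
move=> hR ha; suff [] : left_noetherian Q /\ is_lKdim Q (oaddn a n) by [].
apply: (skew_quantum_ind
  (P := fun n S => left_noetherian S /\ is_lKdim S (oaddn a n)) _ _ n_gt0 hQ) => //.
move=> k S T iota b tw tw' [hS hk] h; split; first exact: noetherian_step h hS.
exact: (kdim_poly h).
Qed.

End QuantumPolynomials.

Theorem theorem4p3 (R : nzRingType) (n r : nat) (hn : (2 <= n)%N) (hr : (r <= n)%N)
    (q : 'M[R]_n) (sigma : 'I_n -> {rmorphism R -> R}) (Q : nzRingType)
    (hQ : is_skew_quantum_ring r q sigma Q) :
  ((forall d : nat, is_lgld R (Some d) ->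
      exists e : nat, is_lgld Q (Some e) /\ (d <= e <= d + n)%N) /\
   (forall (q' : 'M[R]_n) (A : nzRingType), is_quantum_ring 0 q' A ->
      exists v : enat, is_lgld R v /\ is_lgld A (enat_addn v n)) /\
   (semisimple_ring R ->
      (forall (q' : 'M[R]_n) (A : nzRingType), is_quantum_ring 0 q' A ->
         is_lgld A (Some n)) /\
      (forall (tau : {rmorphism R -> R}) (S : nzRingType),
         is_skew_laurent_ring tau S -> is_lgld S (Some 1%N)))) /\
  ((left_noetherian R ->
      (exists a b : Ord,
         [/\ is_lKdim R a, is_lKdim Q b, ole a b & ole b (oaddn a n)]) /\
      (forall (q' : 'M[R]_n) (A : nzRingType), is_quantum_ring 0 q' A ->
         exists a : Ord, is_lKdim R a /\ is_lKdim A (oaddn a n))) /\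
   (forall k : fieldType,
      (forall (q' : 'M[k]_n) (A : nzRingType), is_quantum_ring 0 q' A ->
         is_lKdim A (oaddn ozero n)) /\
      (forall (q' : 'M[k]_n) (A : nzRingType), is_quantum_ring n q' A ->
         exists b : Ord, is_lKdim A b /\ ole b (oaddn ozero n)) /\
      (forall (tau : {rmorphism k -> k}) (S : nzRingType),
         is_skew_laurent_ring tau S -> is_lKdim S (oaddn ozero 1)))) /\
  (left_noetherian R -> domain_ring R -> is_ludim Q 1).
Proof.
have n_gt0 : (0 < n)%N by exact: ltnW.
split; [split; [|split]|split; [split|]].
- by move=> d; apply: (skew_quantum_lgld n_gt0 hQ).
- move=> q' A hA; have [v hv] := lgld_exists R.
  by exists v; split=> //; apply: (quantum_poly_lgld n_gt0 hA).
- move=> /semisimple_lgld hR; split=> [q' A hA|tau S].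
    exact: (quantum_poly_lgld n_gt0 hA hR).
  by move=> /skew_laurent_ext[iota [b [tw [tw' h]]]]; apply: (lgld_semisimple_step h).
- move=> hR; have [a ha] := noetherian_lKdim_exists hR.
  split=> [|q' A hA]; last by exists a; split=> //; apply: (quantum_poly_kdim n_gt0 hA).
  by have [c [hc ac ca]] := skew_quantum_kdim n_gt0 hQ hR ha; exists a, c.
- move=> k; split=> [q' A hA|]; last split=> [q' A hA|tau S].
  + exact: (quantum_poly_kdim n_gt0 hA (@noetherian_field k) (lKdim_field k)).
  + have [c [hc _ ca]] := skew_quantum_kdim n_gt0 hA (@noetherian_field k) (lKdim_field k).
    by exists c.
  + by move=> /skew_laurent_ext[iota [b [tw [tw' h]]]]; apply: (laurent_field_kdim h).
- move=> hR dR; have [hQN dQ] := skew_quantum_domain n_gt0 hQ hR dR.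
  exact: noetherian_domain_ludim.
Qed.
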